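(* Let $(\mathcal{M},\phi,\xi,\eta,g)$ be an anti-quasi-Sasakian manifold, and let $\nabla$ be the Levi-Civita connection of $g$. Let $\mathcal{H}_1$ be the distribution on $\mathcal{M}$ whose sections are the vector fields $X$ satisfying $\nabla_X\phi=0$, and assume that the rank of $\mathcal{H}_1$ is constant. Then: (1) The distribution $\mathcal{H}_1$ is involutive, and its leaves carry a natural Kähler structure, namely the one whose almost complex structure is the restriction of $\phi$ to $\mathcal{H}_1$ and whose metric is the pullback of $g$ to the leaf. (2) The distribution $\{\xi\}\oplus\mathcal{H}_1$ is involutive, and its leaves carry a natural cosymplectic structure, namely the almost contact metric structure $(\tilde\phi,\xi,\tilde\eta,\tilde g)$ in which $\tilde\phi$ is the restriction of $\phi$, $\xi$ is the restriction of the characteristic vector field, and $\tilde\eta,\tilde g$ are the pullbacks of $\eta,g$ to the leaf.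
   Context: All manifolds are smooth and connected. An almost contact metric structure on a $(2n+1)$-dimensional manifold $\mathcal{M}$, $n\geqslant 1$, is a quadruple $(\phi,\xi,\eta,g)$, where $\phi$ is a $(1,1)$-tensor field, $\xi$ a vector field (the characteristic vector field), $\eta$ a 1-form (the characteristic form) and $g$ a Riemannian metric, such that for all vector fields $X,Y$ $$\phi^2X=-X+\eta(X)\xi,\quad \eta(\xi)=1,\quad g(\phi X,\phi Y)=g(X,Y)-\eta(X)\eta(Y).$$ The fundamental form is the 2-form $\Phi(X,Y)=g(X,\phi Y)$. The exterior derivative of a 1-form is normalized by $2d\eta(X,Y)=X\eta(Y)-Y\eta(X)-\eta([X,Y])$. The Nijenhuis torsion of $\phi$ is $$N_\phi(X,Y)=\phi^2[X,Y]+[\phi X,\phi Y]-\phi[\phi X,Y]-\phi[X,\phi Y],$$ and $N^{(1)}=N_\phi+2d\eta\otimes\xi$. The almost contact metric manifold is called normal if $N^{(1)}=0$; almost cosymplectic if $d\eta=0$ and $d\Phi=0$; cosymplectic if it is normal and almost cosymplectic. It is called anti-quasi-Sasakian if $N^{(1)}=4d\eta\otimes\xi$ (equivalently $N_\phi=2d\eta\otimes\xi$) and $d\Phi=0$. A leaf of an involutive distribution is a maximal connected integral submanifold. $\{\xi\}$ denotes the line distribution spanned by $\xi$.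
   Formalization: The Kähler assertion in (1) is stated only for non-cosymplectic M: if M is cosymplectic, then H_1 = TM and its leaf is M itself, odd-dimensional, so not Kähler. In (2), {ξ}⊕H_1 is taken as the plain sum {ξ}+H_1. *)

(* Defs.v *)
From HB Require Import structures.
From mathcomp Require Import all_boot all_order all_algebra.
From mathcomp Require Import all_classical all_reals all_analysis.
From mathcomp Require Import ring.
Import Order.TTheory GRing.Theory Num.Theory.
Import numFieldNormedType.Exports.

Set Implicit Arguments.
Unset Strict Implicit.
Unset Printing Implicit Defensive.

Local Open Scope classical_set_scope.
Local Open Scope ring_scope.

Section EuclideanSmoothness.
Context {R : realType} {m : nat}.
Implicit Types (U : set 'rV[R]_m) (f g : 'rV[R]_m -> R).

(* On the open set [U], the iterated partial derivatives of [f] of order at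
   most [k] exist and are continuous. *)
Fixpoint Ck (k : nat) U f : Prop :=
  (forall x, U x -> {for x, continuous f}) /\
  if k is k'.+1 then
    forall i : 'I_m, (forall x, U x -> derivable f x (delta_mx 0 i)) /\
      Ck k' U ('D_(delta_mx 0 i) f)
  else True.

Definition smooth_on U f : Prop := forall k, Ck k U f.

Lemma Ck_eq k U f g : open U -> (forall x, U x -> f x = g x) ->
  Ck k U f -> Ck k U g.
Proof.
move=> oU; have nearU (f' g' : 'rV[R]_m -> R) x :
    (forall x, U x -> f' x = g' x) -> U x -> \near x, f' x = g' x.
  by move=> fg Ux; apply: filterS fg _; apply: open_nbhs_nbhs.
have contU f' g' x : (forall x, U x -> f' x = g' x) -> U x ->
    {for x, continuous f'} -> {for x, continuous g'}.
  move=> fg Ux cf; rewrite /prop_for /continuous_at -(fg x Ux).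
  by apply: cvg_trans cf; apply: (@near_eq_cvg _ _ (nbhs x)); apply: nearU.
elim: k f g => [|k IH] f g fg [cf df].
  by split=> // x Ux; apply: contU (cf x Ux).
split=> [x Ux|i]; first exact: contU (cf x Ux).
have [dfi Cfi] := df i; split=> [x Ux|].
  by apply: near_eq_derivable (dfi x Ux); apply: nearU.
by apply: IH Cfi => x Ux; apply: near_eq_derive; apply: nearU.
Qed.

Lemma CkS k U f : Ck k.+1 U f -> Ck k U f.
Proof.
elim: k f => [|k IH] f [cf df]; split=> // i.
by have [dfi /IH] := df i.
Qed.

Lemma Ck_cst k U (c : R) : open U -> Ck k U (fun=> c).
Proof.
move=> oU; elim: k c => [|k IH] c.
  by split=> // x _; exact: cst_continuous.
split=> [x _|i]; first exact: cst_continuous.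
split=> [x _|]; first exact: derivable_cst.
by apply: Ck_eq (IH 0) => // x _; rewrite derive_cst.
Qed.

Lemma CkD k U f g : open U -> Ck k U f -> Ck k U g -> Ck k U (fun x => f x + g x).
Proof.
move=> oU; elim: k f g => [|k IH] f g [cf df] [cg dg].
  by split=> // x Ux; exact: (cvgD (cf x Ux) (cg x Ux)).
split=> [x Ux|i]; first exact: (cvgD (cf x Ux) (cg x Ux)).
have [dfi Cfi] := df i; have [dgi Cgi] := dg i; split=> [x Ux|].
  by apply: derivableD; [exact: dfi|exact: dgi].
apply: Ck_eq (IH _ _ Cfi Cgi) => // x Ux.
by rewrite -deriveD //; [exact: dfi|exact: dgi].
Qed.

Lemma CkM k U f g : open U -> Ck k U f -> Ck k U g -> Ck k U (fun x => f x * g x).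
Proof.
move=> oU; elim: k f g => [|k IH] f g; first move=> /= [cf _] [cg _].
  by split=> // x Ux; exact: (cvgM (cf x Ux) (cg x Ux)).
move=> Cf Cg; have [cf df] := Cf; have [cg dg] := Cg; split=> [x Ux|i].
  exact: (cvgM (cf x Ux) (cg x Ux)).
have [dfi Cfi] := df i; have [dgi Cgi] := dg i; split=> [x Ux|].
  by apply: derivableM; [exact: dfi|exact: dgi].
apply: (@Ck_eq _ _ (fun x => f x * 'D_(delta_mx 0 i) g x
                          + g x * 'D_(delta_mx 0 i) f x)) => //.
  by move=> x Ux; rewrite -deriveM //; [exact: dfi|exact: dgi].
by apply: CkD => //; apply: IH => //; exact: CkS.
Qed.

End EuclideanSmoothness.

(* A chart is represented by total maps [cmap] and [cinv] restricting to mutually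
   inverse homeomorphisms between [cdom] and its image. *)
Record chart (R : realType) (T : topologicalType) (m : nat) := Chart {
  cdom : set T;
  cmap : T -> 'rV[R]_m;
  cinv : 'rV[R]_m -> T;
  cdom_open : open cdom;
  cimg_open : open (cmap @` cdom);
  cmapK : forall p, cdom p -> cinv (cmap p) = p;
  cmap_continuous : forall p, cdom p -> {for p, continuous cmap};
  cinv_continuous : forall x, (cmap @` cdom) x -> {for x, continuous cinv} }.

Record manifold (R : realType) (m : nat) := Manifold {
  mcarrier :> topologicalType;
  atlas : set (chart R mcarrier m);
  m_hausdorff : hausdorff_space mcarrier;
  m_second_countable : @second_countable mcarrier;
  m_connected : connected [set: mcarrier];
  atlas_cover : forall p, exists2 c, atlas c & cdom c p;
  atlas_compatible : forall c d, atlas c -> atlas d -> forall j,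
    smooth_on (cmap c @` (cdom c `&` cdom d)) (fun x => cmap d (cinv c x) 0 j) }.

Section SmoothFunctions.
Context {R : realType} {m : nat} (M : manifold R m).
Implicit Types f g : M -> R.

Definition smooth f : Prop :=
  forall c, atlas c -> smooth_on (cmap c @` cdom c) (f \o cinv c).

Lemma smooth_cst (a : R) : smooth (fun=> a).
Proof. by move=> c _ k; apply: Ck_cst; exact: cimg_open. Qed.

Lemma smoothD f g : smooth f -> smooth g -> smooth (fun p => f p + g p).
Proof. by move=> sf sg c ac k; apply: CkD; [exact: cimg_open|exact: sf|exact: sg]. Qed.

Lemma smoothM f g : smooth f -> smooth g -> smooth (fun p => f p * g p).
Proof. by move=> sf sg c ac k; apply: CkM; [exact: cimg_open|exact: sf|exact: sg]. Qed.

End SmoothFunctions.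

Definition smooth_map (R : realType) (k m : nat) (N : manifold R k)
    (M : manifold R m) (F : N -> M) : Prop :=
  continuous F /\
  forall c d, atlas c -> atlas d -> forall j,
    smooth_on (cmap c @` (cdom c `&` F @^-1` cdom d))
      (fun x => cmap d (F (cinv c x)) 0 j).

Section TangentSpace.
Context {R : realType} {m : nat} {M : manifold R m}.
Implicit Types (p : M) (v : (M -> R) -> R).

(* Tangent vectors at [p] are the derivations at [p] of the algebra of smooth
   functions.  They are represented as operators on all functions, with the
   value 0 on non-smooth ones, so that equality is equality of derivations. *)
Definition derivation_at p v : Prop :=
  [/\ forall f, ~ smooth f -> v f = 0,
      forall (a : R) f g, smooth f -> smooth g ->
        v (fun q => a * f q + g q) = a * v f + v g
    & forall f g, smooth f -> smooth g ->
        v (fun q => f q * g q) = f p * v g + g p * v f].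

Definition derivations_at p : {pred (M -> R) -> R} := fun v => `[< derivation_at p v >].

Lemma derivations_at_submod p : submod_closed (derivations_at p).
Proof.
split=> [|a u v /asboolP[u0 uD uM] /asboolP[v0 vD vM]]; apply/asboolP.
  have E f : (0 : (M -> R) -> R) f = 0 by [].
  by split=> *; rewrite !E ?mulr0 ?addr0.
have E f : (a *: u + v) f = a * u f + v f by [].
split=> [f nf|b f g sf sg|f g sf sg]; rewrite !E.
- by rewrite u0 // v0 // mulr0 addr0.
- by rewrite uD // vD // !mulrDr addrACA mulrCA.
- by rewrite uM // vM // !mulrDr addrACA !(mulrCA a).
Qed.

HB.instance Definition _ p :=
  GRing.isSubmodClosed.Build R ((M -> R) -> R) (derivations_at p)
    (derivations_at_submod p).

Record tangent p := Tangent {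
  tangent_fun :> (M -> R) -> R;
  tangentP : tangent_fun \in derivations_at p }.

HB.instance Definition _ p := [isSub for @tangent_fun p].
HB.instance Definition _ p := [Choice of tangent p by <:].
HB.instance Definition _ p :=
  [SubChoice_isSubLmodule of tangent p by <:].

Lemma tangent_derivation p (v : tangent p) : derivation_at p v.
Proof. exact/asboolP/(tangentP v). Qed.

(* The derivation acting on smooth functions as [v]; 0 if there is none. *)
Definition to_tangent p v : tangent p :=
  insubd 0 (fun f => if `[< smooth f >] then v f else 0).

End TangentSpace.

Lemma to_tangentE (R : realType) (m : nat) (M : manifold R m) (p : M)
    (v : (M -> R) -> R) :
  (forall (a : R) f g, smooth f -> smooth g ->
     v (fun q => a * f q + g q) = a * v f + v g) ->
  (forall f g, smooth f -> smooth g ->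
     v (fun q => f q * g q) = f p * v g + g p * v f) ->
  forall f, smooth f -> to_tangent p v f = v f.
Proof.
move=> vD vM f sf; rewrite /to_tangent insubdK; first by rewrite asboolT.
apply/asboolP; split=> [h nh|a h k sh sk|h k sh sk]; first by rewrite asboolF.
- rewrite !asboolT ?vD //; apply: smoothD => //; apply: smoothM => //.
  exact: smooth_cst.
- by rewrite !asboolT ?vM //; apply: smoothM.
Qed.

Definition differential (R : realType) (k m : nat) (N : manifold R k)
    (M : manifold R m) (F : N -> M) (q : N) (v : tangent q) : tangent (F q) :=
  to_tangent (F q) (fun f => v (f \o F)).

Section TensorCalculus.
Context {R : realType} {m : nat} {M : manifold R m}.

Definition vfield := forall p : M, tangent p.
Definition endo_field := forall p : M, tangent p -> tangent p.
Definition covector_field := forall p : M, tangent p -> R.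
Definition bilinear_field := forall p : M, tangent p -> tangent p -> R.

Implicit Types (X Y Z xi : vfield) (phi : endo_field) (eta : covector_field)
  (g : bilinear_field) (p : M).

Definition smooth_vfield X : Prop :=
  forall f : M -> R, smooth f -> smooth (fun p => X p f).

Definition endo_app phi X : vfield := fun p => phi p (X p).

Definition smooth_endo phi : Prop :=
  (forall p (a : R) u v, phi p (a *: u + v) = a *: phi p u + phi p v) /\
  (forall X, smooth_vfield X -> smooth_vfield (endo_app phi X)).

Definition one_form eta : Prop :=
  (forall p (a : R) u v, eta p (a *: u + v) = a * eta p u + eta p v) /\
  (forall X, smooth_vfield X -> smooth (fun p => eta p (X p))).

Definition riemannian_metric g : Prop :=
  [/\ forall p (a : R) u v w, g p (a *: u + v) w = a * g p u w + g p v w,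
      forall p u v, g p u v = g p v u,
      forall p u, u != 0 -> 0 < g p u u
    & forall X Y, smooth_vfield X -> smooth_vfield Y ->
        smooth (fun p => g p (X p) (Y p))].

(* For smooth fields the operator is a derivation at [p], see [bracketE]. *)
Definition bracket X Y : vfield := fun p =>
  to_tangent p (fun f => X p (fun q => Y q f) - Y p (fun q => X q f)).

Definition levi_civita g (nabla : vfield -> vfield -> vfield) : Prop :=
  [/\ forall X Y, smooth_vfield X -> smooth_vfield Y -> smooth_vfield (nabla X Y),
      forall (f : M -> R) X X' Y p, smooth f ->
        smooth_vfield X -> smooth_vfield X' -> smooth_vfield Y ->
        nabla (fun q => f q *: X q + X' q) Y p = f p *: nabla X Y p + nabla X' Y p,
      forall (f : M -> R) X Y Y' p, smooth f ->
        smooth_vfield X -> smooth_vfield Y -> smooth_vfield Y' ->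
        nabla X (fun q => f q *: Y q + Y' q) p =
          X p f *: Y p + f p *: nabla X Y p + nabla X Y' p,
      forall X Y p, smooth_vfield X -> smooth_vfield Y ->
        nabla X Y p - nabla Y X p = bracket X Y p
    & forall X Y Z p, smooth_vfield X -> smooth_vfield Y -> smooth_vfield Z ->
        X p (fun q => g q (Y q) (Z q)) =
          g p (nabla X Y p) (Z p) + g p (Y p) (nabla X Z p)].

(* d eta (X, Y), with the convention including the factor 1/2. *)
Definition d1 eta X Y p : R :=
  2^-1 * (X p (fun q => eta q (Y q)) - Y p (fun q => eta q (X q))
          - eta p (bracket X Y p)).

(* d om (X, Y, Z) for a 2-form [om], with the matching factor 1/3. *)
Definition d2 (om : bilinear_field) X Y Z p : R :=
  3^-1 * (X p (fun q => om q (Y q) (Z q)) + Y p (fun q => om q (Z q) (X q))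
          + Z p (fun q => om q (X q) (Y q))
          - om p (bracket X Y p) (Z p) - om p (bracket Y Z p) (X p)
          - om p (bracket Z X p) (Y p)).

Definition closed_1form eta : Prop :=
  forall X Y p, smooth_vfield X -> smooth_vfield Y -> d1 eta X Y p = 0.

Definition closed_2form (om : bilinear_field) : Prop :=
  forall X Y Z p, smooth_vfield X -> smooth_vfield Y -> smooth_vfield Z ->
    d2 om X Y Z p = 0.

Definition nijenhuis phi X Y : vfield := fun p =>
  phi p (phi p (bracket X Y p)) + bracket (endo_app phi X) (endo_app phi Y) p
  - phi p (bracket (endo_app phi X) Y p) - phi p (bracket X (endo_app phi Y) p).

Definition fundamental_form g phi : bilinear_field := fun p u v => g p u (phi p v).

(* The dimension is not part of the predicate: the identities force it to be
   odd.  Dimension 1 is allowed. *)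
Definition almost_contact_metric phi xi eta g : Prop :=
  [/\ [/\ smooth_endo phi, smooth_vfield xi, one_form eta & riemannian_metric g],
      forall p v, phi p (phi p v) = - v + eta p v *: xi p,
      forall p, eta p (xi p) = 1
    & forall p u v, g p (phi p u) (phi p v) = g p u v - eta p u * eta p v].

Definition N1 phi xi eta X Y : vfield := fun p =>
  nijenhuis phi X Y p + (2 * d1 eta X Y p) *: xi p.

Definition normal phi xi eta : Prop :=
  forall X Y p, smooth_vfield X -> smooth_vfield Y -> N1 phi xi eta X Y p = 0.

Definition almost_cosymplectic phi eta g : Prop :=
  closed_1form eta /\ closed_2form (fundamental_form g phi).

Definition cosymplectic phi xi eta g : Prop :=
  [/\ almost_contact_metric phi xi eta g, normal phi xi eta
    & almost_cosymplectic phi eta g].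

Definition anti_quasi_sasakian phi xi eta g : Prop :=
  [/\ almost_contact_metric phi xi eta g,
      forall X Y p, smooth_vfield X -> smooth_vfield Y ->
        N1 phi xi eta X Y p = (4 * d1 eta X Y p) *: xi p
    & closed_2form (fundamental_form g phi)].

(* Kähler structure: an almost Hermitian structure whose almost complex structure
   is integrable, in the sense of vanishing Nijenhuis torsion, and whose
   fundamental form is closed. *)
Definition kaehler (J : endo_field) g : Prop :=
  [/\ smooth_endo J /\ riemannian_metric g,
      forall p v, J p (J p v) = - v,
      forall p u v, g p (J p u) (J p v) = g p u v,
      forall X Y p, smooth_vfield X -> smooth_vfield Y -> nijenhuis J X Y p = 0
    & closed_2form (fundamental_form g J)].

Definition distribution := forall p : M, set (tangent p).
Implicit Types D : distribution.

Definition distribution_section D X : Prop := smooth_vfield X /\ forall p, D p (X p).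

Definition involutive_distribution D : Prop :=
  forall X Y, distribution_section D X -> distribution_section D Y ->
    distribution_section D (bracket X Y).

(* [D p] is an [r]-dimensional linear subspace, for every [p]. *)
Definition has_rank D (r : nat) : Prop :=
  forall p, exists e : 'I_r -> tangent p,
    (forall v, D p v <-> exists a : 'I_r -> R, v = \sum_i a i *: e i) /\
    (forall a : 'I_r -> R, \sum_i a i *: e i = 0 -> forall i, a i = 0).

Definition constant_rank D : Prop := exists r, has_rank D r.

Definition parallel_along (nabla : vfield -> vfield -> vfield) phi X : Prop :=
  forall Y p, smooth_vfield Y ->
    nabla X (endo_app phi Y) p - phi p (nabla X Y p) = 0.

(* The condition nabla_X phi = 0 is on a vector field; the fibre at [p] collects
   the values at [p] of the fields satisfying it. *)
Definition parallel_distribution (nabla : vfield -> vfield -> vfield) phi :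
    distribution := fun p =>
  [set v | exists X, [/\ smooth_vfield X, parallel_along nabla phi X & X p = v]].

(* The sum is direct at [p] exactly when [xi p] is not in [D p]. *)
Definition line_plus xi D : distribution := fun p =>
  [set v | exists (a : R) w, D p w /\ v = a *: xi p + w].

End TensorCalculus.

Arguments vfield {R m} M.
Arguments endo_field {R m} M.
Arguments covector_field {R m} M.
Arguments bilinear_field {R m} M.
Arguments distribution {R m} M.

Lemma bracketE (R : realType) (m : nat) (M : manifold R m) (X Y : vfield M) p f :
  smooth_vfield X -> smooth_vfield Y -> smooth f ->
  bracket X Y p f = X p (fun q => Y q f) - Y p (fun q => X q f).
Proof.
move=> sX sY sf.
have lin (Z : vfield M) q (a : R) h k : smooth h -> smooth k ->
    Z q (fun q => a * h q + k q) = a * Z q h + Z q k.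
  by move=> sh sk; have [_ + _] := tangent_derivation (Z q); apply.
have add (Z : vfield M) q h k : smooth h -> smooth k ->
    Z q (fun q => h q + k q) = Z q h + Z q k.
  move=> sh sk; rewrite -[Z q h]mul1r -lin //; congr (Z q _).
  by apply/funext => x; rewrite mul1r.
have leibniz (Z : vfield M) q h k : smooth h -> smooth k ->
    Z q (fun q => h q * k q) = h q * Z q k + k q * Z q h.
  by move=> sh sk; have [_ _] := tangent_derivation (Z q); apply.
apply: to_tangentE => // [a h k sh sk|h k sh sk].
  have E (V W : vfield M) : smooth_vfield V -> V p (fun q => W q (fun q => a * h q + k q)) =
     V p (fun q => a * W q h + W q k).
    by move=> _; congr (V p _); apply/funext => q; rewrite lin.
  rewrite !E // !lin; try by [apply: sX|apply: sY].
  by rewrite mulrBr opprD addrACA.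
have E (V W : vfield M) : smooth_vfield W ->
    V p (fun q => W q (fun q => h q * k q)) =
    h p * V p (fun q => W q k) + W p k * V p h
    + (k p * V p (fun q => W q h) + W p h * V p k).
  move=> sW; rewrite -!leibniz //; try exact: sW.
  rewrite -add; try by apply: smoothM => //; exact: sW.
  by congr (V p _); apply/funext => q; rewrite leibniz.
rewrite !E //; set a := h p; set b := k p.
by ring.
Qed.

Section Submanifolds.
Context {R : realType} {m : nat} {M : manifold R m}.

Definition pullback_form (k : nat) (N : manifold R k) (i : N -> M)
    (eta : covector_field M) : covector_field N :=
  fun q v => eta (i q) (differential i v).

Definition pullback_metric (k : nat) (N : manifold R k) (i : N -> M)
    (g : bilinear_field M) : bilinear_field N :=
  fun q u v => g (i q) (differential i u) (differential i v).

(* [N] carries its own topology and smooth structure: the integral submanifold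
   [i] is injectively immersed, and need not be embedded.  It is connected
   because manifolds are. *)
Definition integral_submanifold (D : distribution M) (k : nat) (N : manifold R k)
    (i : N -> M) : Prop :=
  [/\ smooth_map i, injective i,
      forall q : N, injective (differential i (q := q))
    & forall (q : N) w, D (i q) w <-> exists v : tangent q, differential i v = w].

Definition leaf (D : distribution M) (k : nat) (N : manifold R k) (i : N -> M) : Prop :=
  integral_submanifold D i /\
  forall (k' : nat) (N' : manifold R k') (i' : N' -> M),
    integral_submanifold D i' -> range i `<=` range i' -> range i' `<=` range i.

End Submanifolds.

(* Main.v *)
(* Write d for d eta. The identities N_phi = 2 d eta (x) xi and d Phi = 0 give
     g ((nabla_X phi) Y, Z) = 2 eta(X) d(phi Y, Z) + eta(Z) d(phi Y, X) - eta(Y) d(phi Z, X)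
   together with d(phi X, phi Y) = - d(X, Y), so that d(xi, .) = 0. Hence nabla_X phi = 0
   if and only if d(X, .) = 0 and eta(X) d = 0, while the sections of {xi} + H_1 are the fields
   with d(X, .) = 0; both conditions are stable under brackets because d eta is closed.
   If W is in H_1 and eta(W) <> 0 at p, then eta(W) Y is in H_1 for every Y, so H_1 has full rank
   at p, hence everywhere, and d = 0; thus eta vanishes on H_1 unless M is cosymplectic.
   On a leaf the covariant derivative of phi along the leaf, restricted to tangent vectors of the
   leaf, vanishes by the formula above, which makes the Nijenhuis torsion and the exterior
   derivative of the fundamental form vanish.
   Tangent vectors are derivations of global smooth functions, so local frames require bump
   functions and Hadamard's lemma. *)
Require Import Defs.
From HB Require Import structures.
From mathcomp Require Import all_boot all_order all_algebra.
From mathcomp Require Import all_classical all_reals all_analysis.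
From mathcomp Require Import ring lra.
Import Order.TTheory GRing.Theory Num.Theory.
Import numFieldNormedType.Exports.

Set Implicit Arguments.
Unset Strict Implicit.
Unset Printing Implicit Defensive.

Local Open Scope classical_set_scope.
Local Open Scope ring_scope.

(** * Functions of class C^k on R^m *)

(** The two conditions on [X] come out of the formula separately: [Y = xi] isolates [d(X, .)], after
    which only [2 eta(X) d(phi Y, Z)] is left, and the image of [phi] together with [xi], which [d]
    annihilates, spans each tangent space. Two obstacles shape the rest. Coordinate fields and forms
    live in a chart, while derivations act on functions defined on all of [M]; frames are therefore
    multiplied by cutoffs, and every expansion carries a factor [rho] that is 1 at the base point.
    Evaluation at that point gives pointwise statements, and division by the factor near it gives
    smoothness. Moreover a leaf is only injectively immersed, so its vector fields need not be
    restrictions of fields on [M]. They are differentiated as sections of the pulled-back tangent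
    bundle, by a connection that is metric and torsion free. This is enough to compute brackets and
    exterior derivatives on the leaf, so the leaf's own Levi-Civita connection never enters. *)

Section MeanValue.
Context {R : realType} {V : normedModType R}.
Implicit Types (f g : V -> R) (x v : V).

Lemma is_derive_line f x v (s : R) :
  derivable f (x + s *: v) v ->
  is_derive s 1 (fun s => f (x + s *: v)) ('D_v f (x + s *: v)).
Proof.
move=> df; have E : (fun h : R => h^-1 *: (((fun s => f (x + s *: v)) \o shift s) (h *: 1) - f (x + s *: v))) =
    (fun h => h^-1 *: ((f \o shift (x + s *: v)) (h *: v) - f (x + s *: v))).
  apply/funext => h /=; congr (_ *: (f _ - _)).
  by rewrite [h *: 1]mulr1 scalerDl addrCA.
by split; rewrite ?/derivable ?/derive E.
Qed.

Lemma continuous_line x v : continuous (fun s : R => x + s *: v).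
Proof.
by move=> s; apply: cvgD; [exact: cvg_cst|apply: cvgZl; exact: cvg_id].
Qed.

(** The segment is parametrized by [[0, 1]], so that [t] may have either sign or vanish. *)
Lemma mean_value_line f x v (t : R) :
  (forall s : R, 0 <= s <= 1 -> {for x + (s * t) *: v, continuous f}) ->
  (forall s : R, 0 < s < 1 -> derivable f (x + (s * t) *: v) v) ->
  exists2 s : R, 0 < s < 1 &
    f (x + t *: v) - f x = t * 'D_v f (x + (s * t) *: v).
Proof.
move=> cf df; pose phi (s : R) := f (x + (s * t) *: v).
have dphi (s : R) : 0 < s < 1 -> is_derive s 1 phi (t * 'D_v f (x + (s * t) *: v)).
  move=> /df /is_derive_line d1.
  have d2 : is_derive s 1 (fun s => s * t) t.
    by apply: is_derive_eq; rewrite scaler0 add0r [_ *: _]mulr1.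
  have := @is_derive1_comp R (fun s => f (x + s *: v)) (fun s => s * t) s _ _ d1 d2.
  by rewrite mulrC.
have dphi' (s : R) : s \in `]0, 1[%R -> is_derive s 1 phi (t * 'D_v f (x + (s * t) *: v)).
  by rewrite in_itv => /dphi.
have cphi : {within `[0, 1], continuous phi}.
  apply: continuous_in_subspaceT => s /set_mem /=; rewrite in_itv => /cf /= cfs.
  apply: (@continuous_comp _ _ _ (fun s : R => x + (s * t) *: v) f) => //.
  apply: (@continuous_comp _ _ _ (fun s : R => s * t) (fun s : R => x + s *: v)).
    exact: mulrr_continuous.
  exact: continuous_line.
have [c] := MVT ltr01 dphi' cphi.
rewrite in_itv => c01; rewrite /phi mul0r scale0r addr0 mul1r subr0 mulr1 => E.
by exists c.
Qed.

(** The mean value theorem turns the difference quotient at [x] into a value of [g] at an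
    intermediate point, and [g] is continuous at [x]. This reaches the points where no
    differentiation rule applies: the hyperplane for quotients, the origin for [flat_exp]. *)
Lemma is_derive_extend f g x v :
  {for x, continuous g} ->
  (\forall h \near (0 : R), {for (x + h *: v), continuous f}) ->
  (\forall h \near (0 : R)^', is_derive (x + h *: v) v f (g (x + h *: v))) ->
  is_derive x v f (g x).
Proof.
move=> cg /nbhs_ballP[d /= d0 cf] /nbhs_ballP[d' /= d'0 df].
suff E : h^-1 *: ((f \o shift x) (h *: v) - f x) @[h --> 0^'] --> g x.
  by split; [apply/cvg_ex; exists (g x)|exact: cvg_lim E].
apply/cvgrPdist_lt => e e0.
have /cvgrPdist_lt/(_ e e0) : g (x + h *: v) @[h --> (0 : R)] --> g x.
  have {1}-> : g x = g (x + (0 : R) *: v) by rewrite scale0r addr0.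
  apply: (@continuous_comp _ _ _ (fun s : R => x + s *: v) g).
    exact: continuous_line.
  by rewrite scale0r addr0.
move=> /nbhs_ballP[d2 /= d20 cg2].
have hlt (r : R) : 0 < r -> \forall h \near (0 : R)^', `|h| < r by exact: dnbhs0_lt.
near=> h.
have hn0 : h != 0 by near: h; exact: nbhs_dnbhs_neq.
have hd : `|h| < d by near: h; exact: hlt.
have hd' : `|h| < d' by near: h; exact: hlt.
have hd2 : `|h| < d2 by near: h; exact: hlt.
have ballh (s r : R) : 0 <= s <= 1 -> `|h| < r -> ball (0 : R) r (s * h).
  move=> /andP[s0 s1] hr; rewrite /ball /= sub0r normrN normrM.
  by apply: le_lt_trans hr; rewrite ger0_norm // ler_piMl.
have [s /andP[s0 s1] E] : exists2 s : R, 0 < s < 1 &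
    f (x + h *: v) - f x = h * 'D_v f (x + (s * h) *: v).
  apply: mean_value_line => s s01; first by apply: cf; exact: ballh.
  have [s0 s1] := andP s01; have [||//] := df (s * h).
    by apply: ballh => //; rewrite !ltW.
  by rewrite mulf_neq0 // gt_eqF.
have sb r : `|h| < r -> ball (0 : R) r (s * h) by apply: ballh; rewrite !ltW.
have [|_ D] := df (s * h) (sb _ hd'); first by rewrite mulf_neq0 // gt_eqF.
rewrite /= (addrC (h *: v)) E D [_ *: _]mulKf //.
by apply: cg2; exact: sb.
Unshelve. all: by end_near. Qed.

End MeanValue.

Section PartialDerivatives.
Context {R : realType} {m : nat}.
Implicit Types (f : 'rV[R]_m -> R) (x y z : 'rV[R]_m) (U : set 'rV[R]_m).

Lemma rV_norm_le x (r : R) : 0 <= r -> (forall j, `|x 0 j| <= r) -> `|x| <= r.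
Proof.
move=> r0 xr; rewrite /Num.Def.normr /= mx_normrE; apply/bigmax_leP.
by split=> // -[i j] _ /=; rewrite ord1.
Qed.

Lemma rV_coord_le x j : `|x 0 j| <= `|x|.
Proof.
rewrite [leRHS]/Num.Def.normr /= mx_normrE.
exact: (le_bigmax _ (fun ij : 'I_1 * 'I_m => `|x ij.1 ij.2|) (0, j)).
Qed.

(** Coordinates are changed from those of [x] to those of [y] one at a time, with the one-variable
    theorem on each segment. In the maximum norm the whole path stays within [|y - x|] of [x]. *)
Lemma mean_value_partials f x y (r : R) :
  (forall z, ball x r z -> {for z, continuous f}) ->
  (forall z (i : 'I_m), ball x r z -> derivable f z (delta_mx 0 i)) ->
  ball x r y ->
  exists2 z : 'I_m -> 'rV[R]_m, forall i, `|z i - x| <= `|y - x| &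
    f y - f x = \sum_i (y 0 i - x 0 i) * 'D_(delta_mx 0 i) f (z i).
Proof.
move=> cf df xry.
pose p (k : nat) : 'rV[R]_m := \row_j (if (j < k)%N then y 0 j else x 0 j).
have pS (i : 'I_m) : p i.+1 = p i + (y 0 i - x 0 i) *: delta_mx 0 i.
  apply/rowP => j; rewrite !mxE /= ltnS -[j == i]/(val j == val i).
  case: (ltngtP (val j) (val i)) => [_|_|/val_inj ->].
  - by rewrite mulr0 addr0.
  - by rewrite mulr0 addr0.
  - by rewrite mulr1 addrC subrK.
have close (i : 'I_m) (s : R) : 0 <= s <= 1 ->
    `|p i + (s * (y 0 i - x 0 i)) *: delta_mx 0 i - x| <= `|y - x|.
  move=> /andP[s0 s1]; apply: rV_norm_le => // j; rewrite !mxE /=.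
  case: eqP => [->|_].
    rewrite ltnn mulr1 addrAC subrr add0r normrM ger0_norm //.
    have := rV_coord_le (y - x) i; rewrite !mxE; apply: le_trans.
    by rewrite ler_piMl.
  rewrite mulr0 addr0; case: ifP => _; last by rewrite subrr normr0.
  by have := rV_coord_le (y - x) j; rewrite !mxE.
have inball z : `|z - x| <= `|y - x| -> ball x r z.
  rewrite -ball_normE /= -[`|x - z|]distrC => zy; apply: le_lt_trans zy _.
  by rewrite distrC; move: xry; rewrite -ball_normE.
have mv (i : 'I_m) : {s : R | 0 < s < 1 & f (p i.+1) - f (p i) =
    (y 0 i - x 0 i) * 'D_(delta_mx 0 i) f (p i + (s * (y 0 i - x 0 i)) *: delta_mx 0 i)}.
  apply: cid2; rewrite pS; apply: mean_value_line => s s01.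
    by apply: cf; apply: inball; exact: close.
  by apply: df; apply: inball; apply: close; have [] := andP s01; move=> /ltW -> /ltW ->.
exists (fun i : 'I_m => p i + (s2val (mv i) * (y 0 i - x 0 i)) *: delta_mx 0 i).
  move=> i; apply: close; case: (mv i) => s /= /andP[s0 s1] _.
  by rewrite !ltW.
have -> : f y - f x = f (p m) - f (p 0%N).
  by congr (f _ - f _); apply/rowP => j; rewrite !mxE // ltn_ord.
rewrite -(telescope_sumr (f \o p) (leq0n m)) big_mkord.
by apply: eq_bigr => i _; case: (mv i).
Qed.

(** Chain rule from partial derivatives alone: the increment of [f] is expanded by
    [mean_value_partials], and the intermediate points are squeezed towards [F x], where the partial
    derivatives are continuous. *)
Lemma is_derive_comp_partials {V : normedModType R} f (F : V -> 'rV[R]_m) (x v : V) (r : R) :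
  0 < r ->
  (forall z, ball (F x) r z -> {for z, continuous f}) ->
  (forall z (i : 'I_m), ball (F x) r z -> derivable f z (delta_mx 0 i)) ->
  (forall i : 'I_m, {for F x, continuous ('D_(delta_mx 0 i) f)}) ->
  (forall i : 'I_m, derivable (fun y : V => F y 0 i) x v) ->
  is_derive x v (f \o F)
    (\sum_i 'D_v (fun y : V => F y 0 i) x * 'D_(delta_mx 0 i) f (F x)).
Proof.
move=> r0 cf df cDf dF.
have cF : F (h *: v + x) @[h --> (0 : R)^'] --> F x.
  apply: cvg_within_filter; have dFx : derivable F x v.
    by apply/derivable_mxP => i j; rewrite ord1; exact: dF.
  move/derivable1P/derivable1_diffP/differentiable_continuous: dFx.
  by rewrite /prop_for /continuous_at scale0r add0r.
(* The intermediate points are chosen for all [h] at once, with a dummy value outside the ball, so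
   that their limit as [h] tends to 0 makes sense. *)
have /choice[Z HZ] : forall h : R, exists z : 'I_m -> 'rV[R]_m, ball (F x) r (F (h *: v + x)) ->
    (forall i, `|z i - F x| <= `|F (h *: v + x) - F x|) /\
    f (F (h *: v + x)) - f (F x) = \sum_i (F (h *: v + x) 0 i - F x 0 i) * 'D_(delta_mx 0 i) f (z i).
  move=> h; have [b|nb] := pselect (ball (F x) r (F (h *: v + x))).
    by have [z] := mean_value_partials cf df b; exists z.
  by exists (fun=> 0) => /nb.
have inball : \forall h \near (0 : R)^', ball (F x) r (F (h *: v + x)).
  by move/cvgrPdist_lt: cF => /(_ r r0); apply: filterS => h; rewrite -ball_normE.
have cZ (i : 'I_m) : Z h i @[h --> (0 : R)^'] --> F x.
  apply/cvgrPdist_lt => e e0; near=> h.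
  have [|Zh _] := HZ h; first by near: h.
  rewrite distrC; apply: le_lt_trans (Zh i) _; rewrite distrC; near: h.
  by move/cvgrPdist_lt: cF; apply.
suff E : h^-1 *: ((f \o F \o shift x) (h *: v) - (f \o F) x) @[h --> (0 : R)^'] -->
    \sum_i 'D_v (fun y : V => F y 0 i) x * 'D_(delta_mx 0 i) f (F x).
  by split; [apply/cvg_ex; eexists; exact: E|exact: cvg_lim E].
have : \sum_i (h^-1 *: (F (h *: v + x) 0 i - F x 0 i)) * 'D_(delta_mx 0 i) f (Z h i) @[h --> (0 : R)^'] -->
    \sum_i 'D_v (fun y : V => F y 0 i) x * 'D_(delta_mx 0 i) f (F x).
  apply: cvg_big => [|i _]; first exact: add_continuous.
  apply: cvgM; first exact: dF.
  by apply: (@cvg_comp _ _ _ (fun h : R => Z h i) ('D_(delta_mx 0 i) f)); [exact: cZ|exact: cDf].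
apply: cvg_trans; apply: near_eq_cvg; near=> h.
have [|_ E] := HZ h; first by near: h.
rewrite /= E scaler_sumr; apply: eq_bigr => i _.
by rewrite scalerAl.
Unshelve. all: by end_near. Qed.

End PartialDerivatives.

Section CkCalculus.
Context {R : realType} {m : nat}.
Implicit Types (f g : 'rV[R]_m -> R) (x : 'rV[R]_m) (U V : set 'rV[R]_m).

Lemma Ck_continuous k U f x : Ck k U f -> U x -> {for x, continuous f}.
Proof. by case: k => [|k] [cf _]; exact: cf. Qed.

Lemma Ck_sub k U V f : V `<=` U -> Ck k U f -> Ck k V f.
Proof.
move=> VU; elim: k f => [|k IH] f [cf df]; first by split=> // x /VU/cf.
split=> [x /VU/cf//|i].
by have [dfi Cfi] := df i; split=> [x /VU/dfi//|]; exact: IH.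
Qed.

Lemma Ck_local k U f :
  (forall x, U x -> exists2 V, V x & Ck k V f) -> Ck k U f.
Proof.
elim: k f => [|k IH] f loc.
  by split=> // x /loc[V Vx /Ck_continuous]; exact.
split=> [x /loc[V Vx /Ck_continuous]|i]; first exact.
split=> [x /loc[V Vx [_ df]]|]; first by have [+ _] := df i; apply.
by apply: IH => x /loc[V Vx [_ df]]; exists V => //; have [] := df i.
Qed.

Lemma Ck_sum k U (I : Type) (r : seq I) (F : I -> 'rV[R]_m -> R) : open U ->
  (forall i, Ck k U (F i)) -> Ck k U (fun x => \sum_(i <- r) F i x).
Proof.
move=> oU CF; elim: r => [|i r IH].
  by apply: Ck_eq (Ck_cst _ 0 oU) => // x _; rewrite big_nil.
by apply: Ck_eq (CkD oU (CF i) IH) => // x _; rewrite big_cons.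
Qed.

Lemma is_derive_coord (x v : 'rV[R]_m) (j : 'I_m) :
  is_derive x v (fun y : 'rV[R]_m => y 0 j : R) (v 0 j).
Proof.
have E : {near (0 : R)^', cst (v 0 j) =1 (fun h : R => h^-1 *: ((h *: v + x) 0 j - x 0 j))}.
  near=> h; rewrite !mxE addrK [_ *: _]mulKf //.
  by near: h; exact: nbhs_dnbhs_neq.
have L : h^-1 *: ((h *: v + x) 0 j - x 0 j) @[h --> (0 : R)^'] --> v 0 j.
  by apply: cvg_trans (near_eq_cvg E) _; exact: cvg_cst.
by split; [apply/cvg_ex; exists (v 0 j)|exact: cvg_lim L].
Unshelve. all: by end_near. Qed.

Lemma Ck_coord k U j : open U -> Ck k U (fun x => x 0 j).
Proof.
move=> oU; case: k => [|k]; first by split=> // x _; exact: coord_continuous.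
split=> [x _|i]; first exact: coord_continuous.
split=> [x _|].
  by have [] := is_derive_coord x (delta_mx 0 i) j.
apply: Ck_eq (Ck_cst k (delta_mx 0 i 0 j) oU) => // x _.
by have [_ ->] := is_derive_coord x (delta_mx 0 i) j.
Qed.

Lemma CkV k U f : open U -> (forall x, U x -> f x != 0) -> Ck k U f ->
  Ck k U (fun x => (f x)^-1).
Proof.
move=> oU f0; elim: k => [|k IH] Cf.
  by split=> // x Ux; have [cf _] := Cf; exact: (cvgV (f0 x Ux) (cf x Ux)).
have [cf df] := Cf; split=> [x Ux|i]; first by exact: (cvgV (f0 x Ux) (cf x Ux)).
have [dfi Cfi] := df i; split=> [x Ux|]; first by apply: derivableV; [exact: f0|exact: dfi].
have := IH (CkS Cf) => CV.
apply: Ck_eq (CkM oU (Ck_cst k (-1) oU) (CkM oU (CkM oU CV CV) Cfi)) => // x Ux.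
rewrite (deriveV (f0 x Ux) (dfi x Ux)) [_ *: _]mulrC.
by rewrite -exprVn expr2; ring.
Qed.

End CkCalculus.

Lemma rV_continuous {R : realType} {m : nat} {T : topologicalType} (F : T -> 'rV[R]_m) (x : T) :
  (forall j, {for x, continuous (fun y => F y 0 j)}) -> {for x, continuous F}.
Proof.
move=> cF; apply/cvgrPdist_lt => e e0.
have e2 : 0 < e / 2 by rewrite divr_gt0.
have H : \forall t \near x, forall j : 'I_m, `|F x 0 j - F t 0 j| < e / 2.
  by apply: filter_forall => j; have /cvgrPdist_lt := cF j; apply.
near=> t; apply: (@le_lt_trans _ _ (e / 2)); last by rewrite ltr_pdivrMr // ltr_pMr // ltr1n.
apply: rV_norm_le; first exact: ltW.
have Ht : forall j : 'I_m, `|F x 0 j - F t 0 j| < e / 2 by near: t.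
by move=> j; rewrite !mxE; apply: ltW; exact: Ht.
Unshelve. all: by end_near. Qed.

(** Induction on [k]: the chain rule writes a partial derivative of [f \o F] as a sum of products of
    partial derivatives of [F] and partial derivatives of [f] composed with [F], all one degree
    lower. *)
Lemma Ck_comp {R : realType} {m n : nat} k (F : 'rV[R]_m -> 'rV[R]_n) (f : 'rV[R]_n -> R)
    (U : set 'rV[R]_m) (V : set 'rV[R]_n) :
  open U -> open V -> (forall x, U x -> V (F x)) ->
  (forall j, Ck k U (fun x => F x 0 j)) -> Ck k V f -> Ck k U (f \o F).
Proof.
move=> oU oV UV; elim: k f => [|k IH] f CF Cf.
  split=> // x Ux; apply: continuous_comp; last by have [+ _] := Cf; apply; exact: UV.
  by apply: rV_continuous => j; have [+ _] := CF j; apply.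
have cF x : U x -> {for x, continuous F}.
  by move=> Ux; apply: rV_continuous => j; apply: Ck_continuous (CF j) Ux.
have [cf df] := Cf.
have D x i : U x -> is_derive x (delta_mx 0 i) (f \o F)
    (\sum_j 'D_(delta_mx 0 i) (fun y : 'rV[R]_m => F y 0 j) x * 'D_(delta_mx 0 j) f (F x)).
  move=> Ux; have /nbhs_ballP[r /= r0 rV] : nbhs (F x) V.
    by apply: open_nbhs_nbhs; split=> //; exact: UV.
  apply: (is_derive_comp_partials r0) => [z /rV/cf//|z j /rV Vz|j|j].
  - by have [+ _] := df j; apply.
  - by have [_ /Ck_continuous] := df j; apply; exact: UV.
  - by have [_ dF] := CF j; have [+ _] := dF i; apply.
split=> [x Ux|i]; first by apply: continuous_comp; [exact: cF|exact/cf/UV].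
split=> [x /(D x i)[]//|].
have CG : Ck k U (fun x => \sum_j 'D_(delta_mx 0 i) (fun y : 'rV[R]_m => F y 0 j) x * ('D_(delta_mx 0 j) f \o F) x).
  apply: Ck_sum => // j; apply: CkM => //; first by have [_ dF] := CF j; have [] := dF i.
  by apply: IH => [l|]; [exact: CkS|have [] := df j].
by apply: Ck_eq CG => // x /(D x i)[_ ->].
Qed.

Section SmoothOn.
Context {R : realType} {m : nat}.
Implicit Types (f g : 'rV[R]_m -> R) (x : 'rV[R]_m) (U V : set 'rV[R]_m).

Lemma smooth_on_continuous U f x : smooth_on U f -> U x -> {for x, continuous f}.
Proof. by move=> /(_ 0); exact: Ck_continuous. Qed.

Lemma smooth_on_derivable U f x i : smooth_on U f -> U x -> derivable f x (delta_mx 0 i).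
Proof. by move=> /(_ 1)[_ /(_ i)[df _]]; exact: df. Qed.

Lemma smooth_on_derive U f i : smooth_on U f -> smooth_on U ('D_(delta_mx 0 i) f).
Proof. by move=> sf k; have [_ /(_ i)[_]] := sf k.+1. Qed.

Lemma smooth_on_eq U f g : open U -> (forall x, U x -> f x = g x) ->
  smooth_on U f -> smooth_on U g.
Proof. by move=> oU fg sf k; exact: Ck_eq fg (sf k). Qed.

Lemma smooth_on_sub U V f : V `<=` U -> smooth_on U f -> smooth_on V f.
Proof. by move=> VU sf k; exact: Ck_sub (sf k). Qed.

Lemma smooth_on_local U f :
  (forall x, U x -> exists2 V, V x & smooth_on V f) -> smooth_on U f.
Proof.
by move=> loc k; apply: Ck_local => x /loc[V Vx sf]; exists V.
Qed.

Lemma smooth_on_cst U (c : R) : open U -> smooth_on U (fun=> c).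
Proof. by move=> oU k; exact: Ck_cst. Qed.

Lemma smooth_onD U f g : open U -> smooth_on U f -> smooth_on U g ->
  smooth_on U (fun x => f x + g x).
Proof. by move=> oU sf sg k; exact: CkD. Qed.

Lemma smooth_onM U f g : open U -> smooth_on U f -> smooth_on U g ->
  smooth_on U (fun x => f x * g x).
Proof. by move=> oU sf sg k; exact: CkM. Qed.

Lemma smooth_onN U f : open U -> smooth_on U f -> smooth_on U (fun x => - f x).
Proof.
move=> oU sf; have := smooth_onM oU (smooth_on_cst (-1) oU) sf.
by apply: smooth_on_eq => // x _; rewrite mulN1r.
Qed.

Lemma smooth_onB U f g : open U -> smooth_on U f -> smooth_on U g ->
  smooth_on U (fun x => f x - g x).
Proof. by move=> oU sf sg; apply: smooth_onD => //; exact: smooth_onN. Qed.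

Lemma smooth_onV U f : open U -> (forall x, U x -> f x != 0) -> smooth_on U f ->
  smooth_on U (fun x => (f x)^-1).
Proof. by move=> oU f0 sf k; exact: CkV. Qed.

Lemma smooth_onX U f k : open U -> smooth_on U f -> smooth_on U (fun x => f x ^+ k).
Proof.
move=> oU sf; elim: k => [|k IH].
  by apply: smooth_on_eq (smooth_on_cst 1 oU) => // x _; rewrite expr0.
by apply: smooth_on_eq (smooth_onM oU sf IH) => // x _; rewrite exprS.
Qed.

Lemma smooth_on_coord U j : open U -> smooth_on U (fun x => x 0 j).
Proof. by move=> oU k; exact: Ck_coord. Qed.

Lemma derive_eq_on U f g x (v : 'rV[R]_m) : open U -> U x -> (forall y, U y -> f y = g y) ->
  'D_v f x = 'D_v g x.
Proof.
move=> oU Ux fg; apply: near_eq_derive; apply: filterS fg _.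
exact: open_nbhs_nbhs.
Qed.

Lemma is_derive_eq_on U f g x (v : 'rV[R]_m) d : open U -> U x -> (forall y, U y -> f y = g y) ->
  is_derive x v f d -> is_derive x v g d.
Proof.
move=> oU Ux fg; apply: near_eq_is_derive; apply: filterS fg _.
exact: open_nbhs_nbhs.
Qed.

Lemma smooth_on_is_derive U f x i : smooth_on U f -> U x ->
  is_derive x (delta_mx 0 i) f ('D_(delta_mx 0 i) f x).
Proof. by move=> sf Ux; apply: derivableP; exact: smooth_on_derivable sf Ux. Qed.

Lemma is_derive_shift_arg f x (v a : 'rV[R]_m) :
  derivable f (x + a) v -> is_derive x v (fun y => f (y + a)) ('D_v f (x + a)).
Proof.
move=> df; have E : (fun h : R => h^-1 *: (((fun y => f (y + a)) \o shift x) (h *: v) - f (x + a))) =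
    (fun h => h^-1 *: ((f \o shift (x + a)) (h *: v) - f (x + a))).
  by apply/funext => h /=; rewrite addrA.
by split; rewrite ?/derivable ?/derive E.
Qed.

Lemma delta_norm_le (i : 'I_m) : `|delta_mx 0 i : 'rV[R]_m| <= 1.
Proof.
apply: rV_norm_le => // j; rewrite mxE; by case: (_ && _); rewrite ?normr1 ?normr0.
Qed.

(** The mean value theorem is used twice: for [y |-> f (y + t e_j) - f y] along [e_i], then for the
    [i]-th partial derivative of [f] along [e_j]. *)
Lemma second_difference U f x i j (r t : R) : smooth_on U f -> ball x r `<=` U ->
  `|t| * 2 < r ->
  exists2 z, `|z - x| <= `|t| * 2 &
   f (x + t *: delta_mx 0 i + t *: delta_mx 0 j) - f (x + t *: delta_mx 0 i)
   - (f (x + t *: delta_mx 0 j) - f x) =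
   t * (t * 'D_(delta_mx 0 j) ('D_(delta_mx 0 i) f) z).
Proof.
move=> sf rU tr.
pose ei : 'rV[R]_m := delta_mx 0 i; pose ej : 'rV[R]_m := delta_mx 0 j.
have bd (s s' : R) : 0 <= s <= 1 -> 0 <= s' <= 1 ->
    `|x + (s * t) *: ei + (s' * t) *: ej - x| <= `|t| * 2.
  move=> /andP[s0 s1] /andP[s'0 s'1]; rewrite addrAC [x + _]addrC addrK.
  have l1 (k : 'I_m) (u : R) : 0 <= u -> u <= 1 -> `|(u * t) *: (delta_mx 0 k : 'rV[R]_m)| <= `|t|.
    move=> u0 u1; rewrite normrZ.
    have -> : `|u * t| = u * `|t| by rewrite normrM ger0_norm.
    apply: (@le_trans _ _ (u * `|t|)); last by rewrite ler_piMl.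
    by rewrite ler_piMr ?mulr_ge0 // delta_norm_le.
  apply: le_trans (ler_normD _ _) _; rewrite mulr_natr mulr2n.
  by apply: lerD; apply: l1.
have Ubd (s s' : R) : 0 <= s <= 1 -> 0 <= s' <= 1 -> U (x + (s * t) *: ei + (s' * t) *: ej).
  move=> s01 s'01; apply: rU; rewrite -ball_normE /= distrC.
  exact: le_lt_trans (bd _ _ s01 s'01) tr.
have U0 (s : R) : 0 <= s <= 1 -> U (x + (s * t) *: ei).
  by move=> s01; have := Ubd s 0 s01; rewrite mul0r scale0r addr0; apply; rewrite lexx ler01.
have U1 (s : R) : 0 <= s <= 1 -> U (x + (s * t) *: ei + t *: ej).
  by move=> s01; have := Ubd s 1 s01; rewrite mul1r; apply; rewrite lexx ler01.
have lt01 (s : R) : 0 < s < 1 -> 0 <= s <= 1 by move=> /andP[/ltW -> /ltW ->].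
pose phi y := f (y + t *: ej) - f y.
have dphi (s : R) : 0 <= s <= 1 -> is_derive (x + (s * t) *: ei) ei phi
   ('D_ei f (x + (s * t) *: ei + t *: ej) - 'D_ei f (x + (s * t) *: ei)).
  move=> s01; apply: is_deriveB.
    by apply: is_derive_shift_arg; apply: smooth_on_derivable sf (U1 _ s01).
  by apply: smooth_on_is_derive sf (U0 _ s01).
have [s s01] : exists2 s : R, 0 < s < 1 &
    phi (x + t *: ei) - phi x = t * 'D_ei phi (x + (s * t) *: ei).
  apply: mean_value_line => s s01; last by have [] := dphi s (lt01 s s01).
  apply: continuousB; last exact: smooth_on_continuous sf (U0 _ s01).
  apply: continuous_comp; last exact: smooth_on_continuous sf (U1 _ s01).
  exact: (cvgD cvg_id (cvg_cst _)).
have [_ ->] := dphi s (lt01 s s01); rewrite /phi => ->.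
set y := x + (s * t) *: ei.
have Uy (s' : R) : 0 <= s' <= 1 -> U (y + (s' * t) *: ej) by apply: Ubd; exact: lt01.
have [s' s'01] : exists2 s' : R, 0 < s' < 1 &
    'D_ei f (y + t *: ej) - 'D_ei f y = t * 'D_ej ('D_ei f) (y + (s' * t) *: ej).
  apply: (@mean_value_line R _ ('D_ei f) y ej t) => s' s'01.
    exact: smooth_on_continuous (smooth_on_derive i sf) (Uy _ s'01).
  exact: smooth_on_derivable (smooth_on_derive i sf) (Uy _ (lt01 _ s'01)).
move=> ->; exists (y + (s' * t) *: ej) => //.
by apply: bd; exact: lt01.
Qed.

Lemma eq_of_close_values (g1 g2 : 'rV[R]_m -> R) x :
  {for x, continuous g1} -> {for x, continuous g2} ->
  (forall d : R, 0 < d -> exists z z', [/\ ball x d z, ball x d z' & g1 z = g2 z']) ->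
  g1 x = g2 x.
Proof.
move=> /cvgrPdist_lt c1 /cvgrPdist_lt c2 H.
apply/eqP/negPn/negP => ab.
have e0 : 0 < `|g1 x - g2 x| / 2 by rewrite divr_gt0 // normr_gt0 subr_eq0.
have /nbhs_ballP[d /= d0 cd] : \forall z \near x,
    `|g1 x - g1 z| < `|g1 x - g2 x| / 2 /\ `|g2 x - g2 z| < `|g1 x - g2 x| / 2.
  by apply: filterI; [exact: c1|exact: c2].
have [z [z' [/cd[+ _] /cd[_ +] zz']]] := H d d0; rewrite /= zz' => l1 l2.
have : `|g1 x - g2 x| < `|g1 x - g2 x|; last by rewrite ltxx.
have {1}-> : g1 x - g2 x = (g1 x - g2 z') - (g2 x - g2 z') by ring.
by apply: le_lt_trans (ler_normB _ _) _; lra.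
Qed.

(** The second difference is symmetric in [i] and [j], so the two mixed derivatives take equal
    values at two points arbitrarily close to [x]. *)
Lemma schwarz U f x i j : open U -> smooth_on U f -> U x ->
  'D_(delta_mx 0 j) ('D_(delta_mx 0 i) f) x = 'D_(delta_mx 0 i) ('D_(delta_mx 0 j) f) x.
Proof.
move=> oU sf Ux.
have /nbhs_ballP[r /= r0 rU] : nbhs x U by exact: open_nbhs_nbhs.
apply: (@eq_of_close_values ('D_(delta_mx 0 j) ('D_(delta_mx 0 i) f)) ('D_(delta_mx 0 i) ('D_(delta_mx 0 j) f))) => [||d d0].
- exact: smooth_on_continuous (smooth_on_derive _ (smooth_on_derive _ sf)) Ux.
- exact: smooth_on_continuous (smooth_on_derive _ (smooth_on_derive _ sf)) Ux.
(* With this factor [|t| * 2] is half of the smaller radius, so the intermediate points fall in the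
   ball of radius [d]. *)
pose t := Num.min r d / 4.
have rd0 : 0 < Num.min r d by rewrite lt_min r0.
have t0 : 0 < t by rewrite divr_gt0.
have t2 : `|t| * 2 < Num.min r d by rewrite gtr0_norm // /t; lra.
have tr : `|t| * 2 < r by apply: lt_le_trans t2 _; rewrite ge_min lexx.
have td : `|t| * 2 < d by apply: lt_le_trans t2 _; rewrite ge_min lexx orbT.
have [z zx E] := second_difference i j sf rU tr.
have [z' z'x E'] := second_difference j i sf rU tr.
have inb (y : 'rV[R]_m) : `|y - x| <= `|t| * 2 -> ball x d y.
  by move=> yx; rewrite -ball_normE /= distrC; exact: le_lt_trans yx td.
exists z, z'; split; [exact: inb|exact: inb|].
have tn0 : t != 0 by rewrite gt_eqF.
move: E E'; move: ('D_(delta_mx 0 j) ('D_(delta_mx 0 i) f) z).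
move: ('D_(delta_mx 0 i) ('D_(delta_mx 0 j) f) z') => B A E E'.
apply: (mulfI tn0); apply: (mulfI tn0); rewrite -E -E'.
by rewrite (addrAC x); ring.
Qed.

End SmoothOn.

(** * Hadamard's lemma *)

Lemma near_line {R : realType} {V : normedModType R} (U : set V) (x v : V) :
  open U -> U x -> \forall h \near (0 : R), U (x + h *: v).
Proof.
move=> oU Ux; have := @continuous_line R V x v 0.
rewrite /continuous_at scale0r addr0 => /(_ U); apply.
exact: open_nbhs_nbhs.
Qed.

(** * Smooth division by a coordinate function *)

Section CoordinateDivision.
Context {R : realType} {m : nat}.
Variables (U : set 'rV[R]_m) (i : 'I_m) (a : R).
Hypothesis oU : open U.

(** Contraction by the factor [s] towards the hyperplane [x 0 i = a]: [slide 1] is the identity and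
    [slide 0] the projection. The hypothesis [slideU] says that [U] is star-shaped in this
    direction. *)
Definition slide (s : R) (x : 'rV[R]_m) : 'rV[R]_m :=
  x + ((s - 1) * (x 0 i - a)) *: delta_mx 0 i.

Hypothesis slideU : forall x (s : R), U x -> 0 <= s <= 1 -> U (slide s x).

Implicit Types (f g : 'rV[R]_m -> R) (x : 'rV[R]_m).

Definition iterD k f : 'rV[R]_m -> R := iter k (fun g => 'D_(delta_mx 0 i) g) f.

(** Vanishing to order [k] along the hyperplane, the condition under which division by
    [(x 0 i - a) ^+ k] leaves no singularity. *)
Definition flat k f := forall j x, (j < k)%N -> U x -> x 0 i = a -> iterD j f x = 0.

(* The partial derivatives of such a quotient are again quotients of this form,
   see [is_derive_quot_tangent] and [is_derive_quot_normal]; so a continuity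
   argument (Taylor-Lagrange) suffices for smoothness, without integrals. *)
Definition quot k f x : R :=
  if x 0 i == a then iterD k f x / k`!%:R else f x / (x 0 i - a) ^+ k.

Lemma iterDSr k f : iterD k.+1 f = iterD k ('D_(delta_mx 0 i) f).
Proof. by rewrite /iterD iterSr. Qed.

Lemma smooth_on_iterD k f : smooth_on U f -> smooth_on U (iterD k f).
Proof. by move=> sf; elim: k => [//|k IH]; exact: smooth_on_derive IH. Qed.

Lemma iterD_comm k f x l : smooth_on U f -> U x ->
  'D_(delta_mx 0 l) (iterD k f) x = iterD k ('D_(delta_mx 0 l) f) x.
Proof.
move=> sf; elim: k x => [//|k IH] x Ux /=.
rewrite (schwarz _ _ oU (smooth_on_iterD k sf) Ux).
exact: (derive_eq_on _ oU Ux IH).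
Qed.

Lemma slide_coord s x : slide s x 0 i - a = s * (x 0 i - a).
Proof. by rewrite !mxE !eqxx mulr1; ring. Qed.

Lemma slide_slide s s' x : slide s (slide s' x) = slide (s * s') x.
Proof.
rewrite {1}/slide slide_coord /slide -addrA -scalerDl; congr (_ + _ *: _).
by ring.
Qed.

Lemma slide1 x : slide 1 x = x.
Proof. by rewrite /slide subrr mul0r scale0r addr0. Qed.

Lemma slide_line s x : slide s x = slide 0 x + (s * (x 0 i - a)) *: delta_mx 0 i.
Proof. by rewrite /slide -addrA -scalerDl; congr (_ + _ *: _); ring. Qed.

Lemma taylor_lagrange k f x : smooth_on U f -> flat k f -> U x ->
  exists2 s : R, 0 <= s <= 1 & f x = (x 0 i - a) ^+ k * iterD k f (slide s x) / k`!%:R.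
Proof.
elim: k f x => [|k IH] f x sf ff Ux.
  by exists 1; rewrite ?ler01 ?lexx // slide1 expr0 mul1r divr1.
have [xa|xa] := eqVneq (x 0 i) a.
  have fx0 : f x = 0 := ff 0 x isT Ux xa.
  by exists 1; rewrite ?ler01 ?lexx // fx0 xa subrr expr0n mul0r mul0r.
pose t := x 0 i - a; have t0 : t != 0 by rewrite subr_eq0.
have Us (s : R) : 0 <= s <= 1 -> U (slide s x) by exact: slideU.
(* This function vanishes at 0, because [f] vanishes on the hyperplane, and at 1. A zero of its
   derivative at [s1] relates [f x] to the normal derivative at [slide s1 x]; the exponent [k.+1] is
   the one for which the factor [s1 ^+ k] produced by the induction hypothesis cancels. *)
pose psi (s : R) := f (slide s x) - s ^+ k.+1 * f x.
have dpsi (s : R) : s \in `]0, 1[%R ->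
    is_derive s 1 psi (t * 'D_(delta_mx 0 i) f (slide s x) - (k.+1%:R * s ^+ k) * f x).
  rewrite in_itv => /andP[/ltW s0 /ltW s1].
  apply: is_deriveB.
    have -> : (fun s => f (slide s x)) = (fun u => f (slide 0 x + u *: delta_mx 0 i)) \o (fun s : R => s * t).
      by apply/funext => u /=; rewrite (slide_line u).
    rewrite mulrC (slide_line s x); apply: is_derive1_comp.
      apply: is_derive_line; rewrite -(slide_line s x).
      by apply: smooth_on_derivable sf (Us _ _); rewrite s0 s1.
    by apply: is_derive_eq; rewrite scaler0 add0r [_ *: _]mulr1.
  have dpow : is_derive s 1 (fun u : R => u ^+ k.+1) (k.+1%:R * s ^+ k).
    split; first exact: exprn_derivable.
    by rewrite -derive1E exp_derive1.
  have := is_deriveM dpow (is_derive_cst (f x) s 1).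
  by move=> d; apply: is_derive_eq d _; rewrite scaler0 add0r [_ *: _]mulrC.
have cpsi : {within `[0, 1], continuous psi}.
  apply: continuous_in_subspaceT => s /set_mem /=; rewrite in_itv /= => s01.
  have c1 : {for s, continuous (fun u : R => f (slide u x))}.
    have -> : (fun s => f (slide s x)) = f \o (fun s : R => slide 0 x + (s * t) *: delta_mx 0 i).
      by apply/funext => u /=; rewrite (slide_line u).
    apply: continuous_comp; last first.
      by rewrite -(slide_line s x); apply: smooth_on_continuous sf (Us _ s01).
    apply: (@continuous_comp _ _ _ (fun s : R => s * t) (fun s : R => slide 0 x + s *: delta_mx 0 i)).
      exact: mulrr_continuous.
    exact: continuous_line.
  have c2 : {for s, continuous (fun u : R => u ^+ k.+1 * f x)}.
    exact: (cvgM (@exprn_continuous R k.+1 s) (cvg_cst (f x))).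
  exact: (continuousB c1 c2).
have [s1 s1_01 E] := MVT ltr01 dpsi cpsi.
have f0 : f (slide 0 x) = 0.
  apply: (ff 0) => //; first by apply: Us; rewrite lexx ler01.
  by apply/eqP; rewrite -subr_eq0 slide_coord mul0r.
have z : (0 : R) ^+ k.+1 = 0 by rewrite expr0n.
move: s1_01; rewrite in_itv => s1_01.
move: E s1_01; rewrite /psi f0 slide1 expr1n z !mul0r mul1r !subrr subr0 mulr1.
move=> /esym/eqP; rewrite subr_eq0 => /eqP E /andP[s10 s11].
have s1n0 : s1 != 0 by rewrite gt_eqF.
have s1i : 0 <= s1 <= 1 by rewrite !ltW.
have [j y jk Uy ya|s s01 Es] := IH ('D_(delta_mx 0 i) f) (slide s1 x) (smooth_on_derive _ sf) _ (Us _ s1i).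
  by rewrite -iterDSr; apply: ff.
exists (s * s1).
  have /andP[s0 s1'] := s01; rewrite mulr_ge0 ?(ltW s10) //=.
  by apply: mulr_ile1 => //; exact: ltW.
move: E; rewrite Es slide_coord slide_slide -iterDSr -/t; move: (iterD k.+1 f _) => d E.
have kn0 : (k.+1%:R : R) != 0 by rewrite pnatr_eq0.
have kf : (k`!%:R : R) != 0 by rewrite pnatr_eq0 -lt0n fact_gt0.
apply: (mulfI (_ : k.+1%:R * s1 ^+ k != 0)); first by rewrite mulf_neq0 ?expf_neq0.
rewrite -E factS natrM exprMn exprS.
move: kn0 kf; move: (k.+1%:R : R) (k`!%:R : R) => u w u0 w0.
by field; rewrite u0 w0.
Qed.
Lemma slide_close (s : R) (x y : 'rV[R]_m) : x 0 i = a -> 0 <= s <= 1 ->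
  `|slide s y - x| <= `|y - x|.
Proof.
move=> xa /andP[s0 s1]; apply: rV_norm_le => // j.
have [->|ji] := eqVneq j i.
  have subE (u v : 'rV[R]_m) : (u - v) 0 i = u 0 i - v 0 i by rewrite !mxE.
  have := slide_coord s y; rewrite -xa => E; rewrite subE.
  rewrite E normrM ger0_norm //.
  have := rV_coord_le (y - x) i; rewrite subE; apply: le_trans.
  by rewrite ler_piMl.
have := rV_coord_le (y - x) j; rewrite !mxE (negPf ji) andbF mulr0 addr0.
by [].
Qed.

Lemma quot_slide k f x : smooth_on U f -> flat k f -> U x ->
  exists2 s : R, 0 <= s <= 1 & quot k f x = iterD k f (slide s x) / k`!%:R.
Proof.
move=> sf ff Ux; rewrite /quot; case: ifPn => xa.
  by exists 1; rewrite ?ler01 ?lexx // slide1.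
have [s s01 ->] := taylor_lagrange sf ff Ux; exists s => //.
have d0 : (x 0 i - a) ^+ k != 0 by rewrite expf_neq0 // subr_eq0.
by rewrite mulrC mulrA mulKf.
Qed.

Let offU := U `&` [set x | x 0 i != a].

Let open_off : open offU.
Proof.
apply: openI => //.
apply: (@open_comp _ _ (fun x : 'rV[R]_m => x 0 i) [set t | t != a]).
  by move=> x _; exact: coord_continuous.
exact: open_neq.
Qed.

Lemma smooth_on_off k : smooth_on offU (fun x => (x 0 i - a) ^- k).
Proof.
apply: smooth_onV => //; first by move=> x [_ /=]; rewrite -subr_eq0 => x0; rewrite expf_neq0.
apply: smooth_onX => //; apply: smooth_onB => //; last exact: smooth_on_cst.
exact: smooth_on_coord.
Qed.

(** Near a point [x] of the hyperplane, [quot_slide] makes the quotient a value of a continuous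
    function at a contracted point, and contraction does not increase the distance to [x]. *)
Lemma quot_continuous k f x : smooth_on U f -> flat k f -> U x ->
  {for x, continuous (quot k f)}.
Proof.
move=> sf ff Ux; have [xa|xa] := eqVneq (x 0 i) a; last first.
  have : smooth_on offU (quot k f).
    apply: (@smooth_on_eq _ _ _ (fun x => f x * (x 0 i - a) ^- k)) => //.
      by move=> y [_ /= /negPf ya]; rewrite /quot ya.
    apply: smooth_onM => //; last exact: smooth_on_off.
    by apply: smooth_on_sub sf => y [].
  by move=> /smooth_on_continuous; apply.
have cD : {for x, continuous (fun y => iterD k f y / k`!%:R)}.
  exact: (cvgM (smooth_on_continuous (smooth_on_iterD k sf) Ux) (cvg_cst _)).
apply/(@cvgrPdist_lt _ R^o _ (nbhs x) _ (quot k f) (quot k f x)) => e e0.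
have /nbhs_ballP[d /= d0 dD] : \forall y \near x, `|iterD k f x / k`!%:R - iterD k f y / k`!%:R| < e.
  by move/cvgrPdist_lt : cD; apply.
have nU : \forall y \near x, U y by exact: open_nbhs_nbhs.
have nB : \forall y \near x, ball x d y by exact: nbhsx_ballx.
apply: filterS (filterI nU nB) => y [Uy xy].
have [s s01 ->] := quot_slide sf ff Uy.
have -> : quot k f x = iterD k f x / k`!%:R by rewrite /quot xa eqxx.
apply: dD; move: xy; rewrite -!ball_normE /= distrC => xy.
by rewrite distrC; apply: le_lt_trans (slide_close _ xa s01) xy.
Qed.

Lemma is_derive_negpow k x (v : 'rV[R]_m) : x 0 i != a ->
  is_derive x v (fun y : 'rV[R]_m => (y 0 i - a) ^- k)
    (- (k%:R * v 0 i / (x 0 i - a) ^+ k.+1)).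
Proof.
rewrite -subr_eq0 => xa.
have d1 : is_derive x v (fun y : 'rV[R]_m => y 0 i - a : R) (v 0 i).
  have := is_deriveB (is_derive_coord x v i) (is_derive_cst a x v).
  by rewrite subr0.
have [dX eX] := is_deriveX k d1.
have xk : ((fun y : 'rV[R]_m => y 0 i - a) ^+ k) x != 0 by rewrite exprfctE expf_neq0.
have dX' : derivable (fun y : 'rV[R]_m => (y 0 i - a) ^+ k) x v.
  by move: dX; rewrite exprfctE.
split; first by have := derivableV xk dX; rewrite exprfctE.
have := deriveV xk dX; rewrite eX exprfctE => ->.
rewrite [_ *: _]mulrC [_ *: _]mulrC; case: k xk {dX eX dX'} => [|k] _.
  by rewrite !mul0r mulr0 mul0r oppr0.
rewrite /= !exprS; move: xa; move: (x 0 i - a) => b b0.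
have := expf_neq0 k b0; move: (b ^+ k) => B B0.
by field; rewrite b0 B0.
Qed.

Lemma is_derive_quot_off k f x l : smooth_on U f -> offU x ->
  is_derive x (delta_mx 0 l) (quot k f)
   ('D_(delta_mx 0 l) f x / (x 0 i - a) ^+ k
     - k%:R * (delta_mx 0 l : 'rV[R]_m) 0 i * f x / (x 0 i - a) ^+ k.+1).
Proof.
move=> sf ox; have [Ux xa] := ox.
apply: (is_derive_eq_on (f := fun y => f y * (y 0 i - a) ^- k) open_off ox).
  by move=> y [_ /= /negPf ya]; rewrite /quot ya.
have := is_deriveM (smooth_on_is_derive l sf Ux) (is_derive_negpow k (delta_mx 0 l) xa).
move=> d; apply: is_derive_eq d _; rewrite [_ *: _]mulrC [X in _ + X]mulrC.
by ring.
Qed.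

(** A line in direction [l] through a point of the hyperplane stays in it, so only the first branch
    of [quot] enters the difference quotient; the derivatives then commute by [schwarz]. *)
Lemma is_derive_quot_tangent k f x l : smooth_on U f -> U x -> l != i ->
  is_derive x (delta_mx 0 l) (quot k f) (quot k ('D_(delta_mx 0 l) f) x).
Proof.
move=> sf Ux li; have [xa|xa] := eqVneq (x 0 i) a; last first.
  have := is_derive_quot_off k l sf (conj Ux xa).
  move=> d; apply: is_derive_eq d _; rewrite /quot (negPf xa) mxE.
  by rewrite eq_sym (negPf li) andbF !mulr0 !mul0r subr0.
have dk := smooth_on_is_derive l (smooth_on_iterD k sf) Ux.
have [d1 d2] : is_derive x (delta_mx 0 l) (fun y => iterD k f y / k`!%:R)
   (iterD k ('D_(delta_mx 0 l) f) x / k`!%:R).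
  have := is_deriveM dk (is_derive_cst (k`!%:R^-1 : R) x (delta_mx 0 l)).
  move=> d; apply: is_derive_eq d _.
  by rewrite scaler0 add0r [_ *: _]mulrC (iterD_comm _ _ sf Ux).
have E : (fun h : R => h^-1 *: (((fun y => iterD k f y / k`!%:R) \o shift x) (h *: delta_mx 0 l) - iterD k f x / k`!%:R)) =
    (fun h => h^-1 *: ((quot k f \o shift x) (h *: delta_mx 0 l) - quot k f x)).
  apply/funext => h /=; rewrite /quot xa eqxx.
  have -> : (h *: delta_mx 0 l + x) 0 i = a.
    by rewrite !mxE eq_sym (negPf li) andbF mulr0 add0r.
  by rewrite eqxx.
move: d1 d2; rewrite /derivable /derive E => d1 d2.
by split=> //; rewrite /derive d2 /quot xa eqxx.
Qed.

(** The numerator, over [(y 0 i - a) ^+ k.+1], of the normal derivative of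
    [f y / (y 0 i - a) ^+ k]. *)
Definition quot_numer (k : nat) f (y : 'rV[R]_m) : R := (y 0 i - a) * 'D_(delta_mx 0 i) f y - k%:R * f y.

Lemma smooth_on_quot_numer k f : smooth_on U f -> smooth_on U (quot_numer k f).
Proof.
move=> sf; apply: smooth_onB => //.
  apply: smooth_onM => //; last exact: smooth_on_derive.
  by apply: smooth_onB => //; [exact: smooth_on_coord|exact: smooth_on_cst].
by apply: smooth_onM => //; exact: smooth_on_cst.
Qed.

Lemma iterD_quot_numer k j f x : smooth_on U f -> U x ->
  iterD j (quot_numer k f) x = (x 0 i - a) * iterD j.+1 f x + (j%:R - k%:R) * iterD j f x.
Proof.
move=> sf; elim: j x => [|j IH] x Ux; first by rewrite /quot_numer /=; ring.
rewrite [LHS]/= (derive_eq_on _ oU Ux IH).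
have d1 := smooth_on_is_derive i (smooth_on_iterD j.+1 sf) Ux.
have d2 := smooth_on_is_derive i (smooth_on_iterD j sf) Ux.
have d3 := is_deriveB (is_derive_coord x (delta_mx 0 i) i) (is_derive_cst a x (delta_mx 0 i)).
have d4 := is_deriveM (is_derive_cst (j%:R - k%:R : R) x (delta_mx 0 i)) d2.
have [_ ->] := is_deriveD (is_deriveM d3 d1) d4.
rewrite !mxE !eqxx scaler0 addr0 subr0 -natr1 [_ *: 1]mulr1.
change ((x 0 i - a) * iterD j.+2 f x + iterD j.+1 f x + (j%:R - k%:R) * iterD j.+1 f x =
  (x 0 i - a) * iterD j.+2 f x + (j%:R + 1 - k%:R) * iterD j.+1 f x).
by ring.
Qed.

(** The additional order of vanishing is due to the coefficient [j%:R - k%:R] of [iterD_quot_numer],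
    which is zero for [j = k]. *)
Lemma flat_quot_numer k f : smooth_on U f -> flat k f -> flat k.+1 (quot_numer k f).
Proof.
move=> sf ff j x; rewrite ltnS leq_eqVlt => /orP[/eqP ->|jk] Ux xa.
  by rewrite iterD_quot_numer // xa !subrr !mul0r addr0.
by rewrite iterD_quot_numer // xa subrr mul0r add0r ff // mulr0.
Qed.

Lemma flat_derive k f l : smooth_on U f -> flat k f -> l != i -> flat k ('D_(delta_mx 0 l) f).
Proof.
move=> sf ff li j x jk Ux xa; rewrite -iterD_comm //.
rewrite /derive; apply: cvg_lim => //.
have Unear : \forall h \near (0 : R)^', U (h *: delta_mx 0 l + x).
  apply: nbhs_dnbhs; have := near_line (delta_mx 0 l) oU Ux.
  by apply: filterS => h; rewrite addrC.
suff E : \forall h \near (0 : R)^', cst 0 h = h^-1 *: ((iterD j f \o shift x) (h *: delta_mx 0 l) - iterD j f x).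
  by apply: cvg_trans (near_eq_cvg E) _; exact: cvg_cst.
apply: filterS Unear => h Uh /=.
rewrite (ff j x jk Ux xa) (ff j _ jk Uh) ?subrr ?scaler0 //.
by rewrite !mxE eq_sym (negPf li) andbF mulr0 add0r.
Qed.

(** Off the hyperplane this is the quotient rule. The right-hand side is continuous across it, so
    [is_derive_extend] gives the remaining points. *)
Lemma is_derive_quot_normal k f x : smooth_on U f -> flat k f -> U x ->
  is_derive x (delta_mx 0 i) (quot k f) (quot k.+1 (quot_numer k f) x).
Proof.
move=> sf ff Ux.
have off y : offU y -> is_derive y (delta_mx 0 i) (quot k f) (quot k.+1 (quot_numer k f) y).
  move=> oy; have d := is_derive_quot_off k i sf oy; apply: is_derive_eq d _.
  have [_ /= ya] := oy; rewrite /quot (negPf ya) mxE !eqxx mulr1 /quot_numer exprS.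
  move: ya; rewrite -subr_eq0; move: (y 0 i - a) => b b0.
  have := expf_neq0 k b0; move: (b ^+ k) => B B0.
  by field; rewrite b0 B0.
have [xa|xa] := eqVneq (x 0 i) a; last exact: off.
apply: is_derive_extend.
- apply: quot_continuous => //; first exact: smooth_on_quot_numer.
  exact: flat_quot_numer.
- by apply: filterS (near_line (delta_mx 0 i) oU Ux) => h; exact: quot_continuous.
have n0 : \forall h \near (0 : R)^', h != 0 by exact: nbhs_dnbhs_neq.
have nU : \forall h \near (0 : R)^', U (x + h *: delta_mx 0 i).
  by apply: nbhs_dnbhs; exact: near_line.
apply: filterS (filterI n0 nU) => h [h0 Uh]; apply: off; split=> //=.
by rewrite !mxE !eqxx mulr1 xa -subr_eq0 addrAC subrr add0r.
Qed.

Lemma Ck_quot n k f : smooth_on U f -> flat k f -> Ck n U (quot k f).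
Proof.
elim: n k f => [|n IH] k f sf ff; first by split=> // x; exact: quot_continuous.
split=> [x|l]; first exact: quot_continuous.
have [->|li] := eqVneq l i.
  have d x := @is_derive_quot_normal k f x sf ff.
  split=> [x /d[]//|].
  apply: (@Ck_eq _ _ n U (quot k.+1 (quot_numer k f))) => //; last first.
    by apply: IH; [exact: smooth_on_quot_numer|exact: flat_quot_numer].
  by move=> x /d[].
have d x Ux := @is_derive_quot_tangent k f x l sf Ux li.
split=> [x /d[]//|].
apply: (@Ck_eq _ _ n U (quot k ('D_(delta_mx 0 l) f))) => //; last first.
  by apply: IH; [exact: smooth_on_derive|exact: flat_derive].
by move=> x /d[].
Qed.

Lemma smooth_on_divide f : smooth_on U f -> (forall x, U x -> x 0 i = a -> f x = 0) ->
  exists2 g, smooth_on U g & forall x, U x -> f x = (x 0 i - a) * g x.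
Proof.
move=> sf f0; have ff : flat 1 f by case=> // x _; exact: f0.
exists (quot 1 f) => [n|x Ux]; first exact: Ck_quot.
rewrite /quot; case: ifPn => [/eqP xa|xa]; first by rewrite (f0 x Ux xa) xa subrr mul0r.
by rewrite expr1 mulrC divfK // subr_eq0.
Qed.

End CoordinateDivision.

Lemma smooth_on_comp {R : realType} {m n : nat} (F : 'rV[R]_m -> 'rV[R]_n) (f : 'rV[R]_n -> R)
    (U : set 'rV[R]_m) (V : set 'rV[R]_n) :
  open U -> open V -> (forall x, U x -> V (F x)) ->
  (forall j, smooth_on U (fun x => F x 0 j)) -> smooth_on V f -> smooth_on U (f \o F).
Proof. by move=> oU oV UV sF sf k; apply: Ck_comp UV _ (sf k) => // j; exact: sF. Qed.

(** A ball of the maximum norm is a box, so it is stable under replacing coordinates by those of [b]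
    and under sliding one of them. Replacing the [i]-th coordinate changes [f] by a function that
    vanishes for [x 0 i = b 0 i], hence is divisible by [x 0 i - b 0 i]. The point [b] need not be
    the centre: the expansion is used at all points of a fixed chart ball. *)
Lemma hadamard {R : realType} {m : nat} (c : 'rV[R]_m) (r : R) (b : 'rV[R]_m) f :
  ball c r b -> smooth_on (ball c r) f ->
  exists g : 'I_m -> 'rV[R]_m -> R,
    [/\ forall i, smooth_on (ball c r) (g i),
        forall x : 'rV[R]_m, ball c r x -> f x = f b + \sum_i (x 0 i - b 0 i) * g i x
      & forall i, g i b = 'D_(delta_mx 0 i) f b].
Proof.
pose U : set 'rV[R]_m := ball c r; rewrite -/U => Ub sf; have oU : open U by exact: ball_open.
have Ucoord (x y : 'rV[R]_m) : U x -> (forall j, ball (c 0 j) r (y 0 j)) -> U y.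
  by move=> [r0 _] cy; split=> // i j; rewrite ord1.
have coordU (x : 'rV[R]_m) j : U x -> ball (c 0 j) r (x 0 j) by move=> [_ /(_ 0 j)].
pose p (k : nat) (x : 'rV[R]_m) : 'rV[R]_m := \row_j (if (j < k)%N then b 0 j else x 0 j).
have pU k (x : 'rV[R]_m) : U x -> U (p k x).
  move=> Ux; apply: (Ucoord x) => // j; rewrite mxE.
  by case: ifP => _; exact: coordU.
have sfp k : smooth_on U (f \o p k).
  apply: smooth_on_comp (pU k) _ sf => // j.
  apply: (@smooth_on_eq _ _ _ (if (j < k)%N then fun=> b 0 j else fun x : 'rV[R]_m => x 0 j)) => //.
    by move=> x _; rewrite mxE; case: ifP.
  by case: ifP => _; [exact: smooth_on_cst|exact: smooth_on_coord].
have slideU (i : 'I_m) (x : 'rV[R]_m) (s : R) : U x -> 0 <= s <= 1 -> U (slide i (b 0 i) s x).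
  move=> Ux /andP[s0 s1]; apply: (Ucoord x) => // j.
  have [->|ji] := eqVneq j i; last first.
    by rewrite !mxE (negPf ji) andbF mulr0 addr0; exact: coordU.
  have -> : slide i (b 0 i) s x 0 i = b 0 i + s * (x 0 i - b 0 i).
    by rewrite -slide_coord addrC subrK.
  have := coordU _ i Ux; have := coordU _ i Ub; rewrite /ball /= => bi xi.
  have -> : c 0 i - (b 0 i + s * (x 0 i - b 0 i)) = (1 - s) * (c 0 i - b 0 i) + s * (c 0 i - x 0 i).
    by ring.
  apply: le_lt_trans (ler_normD _ _) _; rewrite !normrM (ger0_norm s0) ger0_norm ?subr_ge0 //.
  have [->|sn0] := eqVneq s 0; first by rewrite subr0 mul1r mul0r addr0.
  have sp : 0 < s by rewrite lt_neqAle eq_sym sn0.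
  have -> : r = (1 - s) * r + s * r by ring.
  apply: ler_ltD; last by rewrite ltr_pM2l.
  by rewrite ler_wpM2l ?subr_ge0 // ltW.
have /choice[g Hg] (i : 'I_m) : exists g, smooth_on U g /\
    forall x : 'rV[R]_m, U x -> f (p i x) - f (p i.+1 x) = (x 0 i - b 0 i) * g x.
  have sd : smooth_on U (fun x => f (p i x) - f (p i.+1 x)).
    by apply: smooth_onB => //; exact: sfp.
  have v0 (x : 'rV[R]_m) : U x -> x 0 i = b 0 i -> f (p i x) - f (p i.+1 x) = 0.
    move=> Ux xi; apply/eqP; rewrite subr_eq0; apply/eqP; congr f.
    apply/rowP => j; rewrite !mxE (ltnS j i).
    by case: (ltngtP (val j) (val i)) => // /val_inj ->.
  by have [g sg Eg] := smooth_on_divide oU (slideU i) sd v0; exists g.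
have E (x : 'rV[R]_m) : U x -> f x = f b + \sum_i (x 0 i - b 0 i) * g i x.
  move=> Ux.
  have -> : \sum_i (x 0 i - b 0 i) * g i x = f x - f b; last by rewrite addrC subrK.
  have -> : f x - f b = - (f (p m x) - f (p 0%N x)).
    rewrite opprB; congr (f _ - f _); apply/rowP => j; rewrite !mxE ?ltn_ord //.
  rewrite -(telescope_sumr (fun k : nat => f (p k x)) (leq0n m)) big_mkord -sumrN.
  by apply: eq_bigr => i _; rewrite opprB; have [_ ->] := Hg i.
exists g; split=> // [i|i]; first by have [] := Hg i.
have db (j : 'I_m) : is_derive b (delta_mx 0 i) (fun x : 'rV[R]_m => (x 0 j - b 0 j) * g j x)
    ((j == i)%:R * g j b).
  have [sg _] := Hg j.
  have d1 := is_deriveB (is_derive_coord b (delta_mx 0 i) j) (is_derive_cst (b 0 j) b (delta_mx 0 i)).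
  have d := is_deriveM d1 (smooth_on_is_derive i sg Ub); apply: is_derive_eq d _.
  change ((b 0 j - b 0 j) * 'D_(delta_mx 0 i) (g j) b + g j b * ((delta_mx 0 i : 'rV[R]_m) 0 j - 0) = (j == i)%:R * g j b).
  by rewrite subrr mul0r add0r mxE eqxx subr0 mulrC.
have [_ D] : is_derive b (delta_mx 0 i) f (\sum_j (j == i)%:R * g j b).
  apply: (is_derive_eq_on (f := fun x : 'rV[R]_m => f b + \sum_i (x 0 i - b 0 i) * g i x) oU Ub).
    by move=> y Uy; rewrite -E.
  have ds : is_derive b (delta_mx 0 i) (fun x : 'rV[R]_m => \sum_j (x 0 j - b 0 j) * g j x) (\sum_j (j == i)%:R * g j b).
    have := is_derive_sum db.
    by congr (is_derive _ _ _ _); apply/funext => x; rewrite fct_sumE.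
  have := is_deriveD (is_derive_cst (f b) b (delta_mx 0 i)) ds.
  by rewrite add0r.
rewrite D (bigD1 i) //= eqxx mul1r big1 ?addr0 // => j /negPf ->.
by rewrite mul0r.
Qed.

(** * Bump functions *)

Section Bump.
Context {R : realType}.

(* The factors [t ^- k] make the family stable under differentiation. *)
Definition flat_exp (k : nat) (t : R) : R := if 0 < t then t ^- k * expR (- t^-1) else 0.

(** From [1 + u <= expR u] at [u = t^-1 / k.+1%:R] one gets
    [expR (- t^-1) <= (k.+1%:R * t) ^+ k.+1], and one power of [t] survives the factor [t ^- k]. *)
Lemma flat_exp_bound k (t : R) : `|flat_exp k t| <= k.+1%:R ^+ k.+1 * `|t|.
Proof.
rewrite /flat_exp; case: ifPn => [t0|_]; last by rewrite normr0 mulr_ge0.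
have n0 : (0 : R) < k.+1%:R by rewrite ltr0n.
have E : expR (- t^-1) <= (k.+1%:R * t) ^+ k.+1.
  have -> : expR (- t^-1) = (expR (t^-1 / k.+1%:R))^-1 ^+ k.+1.
    rewrite -expRN -expRM_natl; congr expR.
    by rewrite mulrN mulrC divfK // gt_eqF.
  have nt0 : 0 < k.+1%:R * t by rewrite mulr_gt0.
  have eV0 : 0 < (expR (t^-1 / k.+1%:R))^-1 by rewrite invr_gt0 expR_gt0.
  apply: lerXn2r; rewrite ?nnegrE ?(ltW eV0) ?(ltW nt0) //.
  rewrite -[leRHS]invrK lef_pV2 ?posrE ?expR_gt0 ?invr_gt0 //.
  by apply: le_trans (expR_ge1Dx _); rewrite invfM mulrC lerDr.
rewrite ger0_norm ?mulr_ge0 ?invr_ge0 ?exprn_ge0 ?expR_ge0 ?(ltW t0) // gtr0_norm //.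
rewrite -ler_pdivlMl ?invr_gt0 ?exprn_gt0 // invrK.
apply: le_trans E _; rewrite exprMn mulrCA -exprSr //.
Qed.

Lemma flat_exp_cts0 k : {for 0, continuous (flat_exp k)}.
Proof.
apply/(@cvgrPdist_lt _ R^o _ (nbhs (0 : R))) => e e0; rewrite /flat_exp ltxx.
have C0 : (0 : R) < k.+1%:R ^+ k.+1 by rewrite exprn_gt0 // ltr0n.
apply/nbhs_ballP; exists (e / k.+1%:R ^+ k.+1) => /= [|t].
  by rewrite divr_gt0.
rewrite /ball /= !sub0r !normrN ltr_pdivlMr // mulrC => te.
exact: le_lt_trans (flat_exp_bound k t) te.
Qed.

Definition flat_exp' k t : R := flat_exp k.+2 t - k%:R * flat_exp k.+1 t.

Lemma is_derive_flat_exp_neq0 k (t : R) : t != 0 -> is_derive t 1 (flat_exp k) (flat_exp' k t).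
Proof.
rewrite neq_lt => /orP[t0|t0].
  have /near_eq_is_derive : \forall u \near t, cst 0 u = flat_exp k u.
    apply: filterS (open_nbhs_nbhs (conj (@open_lt R 0) t0)) => u /= u0.
    by rewrite /flat_exp ltNge (ltW u0).
  apply; apply: is_derive_eq.
  by rewrite /flat_exp' /flat_exp ltNge (ltW t0) /= mulr0 subr0.
have /near_eq_is_derive : \forall u \near t, u ^- k * expR (- u^-1) = flat_exp k u.
  by apply: filterS (open_nbhs_nbhs (conj (@open_gt R 0) t0)) => u /= u0; rewrite /flat_exp u0.
apply.
have tn0 : t != 0 by rewrite gt_eqF.
have dV : is_derive t 1 (fun u : R => u^-1) (- t ^- 2).
  have did : derivable (fun u : R => u) t 1 by exact: derivable_id.
  split; first exact: (derivableV (f := fun u : R => u) tn0 did).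
  rewrite (deriveV (f := fun u : R => u) tn0 did).
  by rewrite (@derive_id R R^o t 1) [_ *: _]mulr1.
have dE := @is_derive1_comp R expR (fun u : R => - u^-1) t _ _ (is_derive_expR (- t^-1)) (is_deriveN dV).
have dX := is_deriveX k dV.
have d := is_deriveM dX dE.
have E : ((fun u : R => u^-1) ^+ k * (expR \o (fun u : R => - u^-1))) = (fun u => u ^- k * expR (- u^-1)).
  by apply/funext => u; rewrite fctE exprfctE /= exprVn.
rewrite -E; apply: is_derive_eq d _.
rewrite exprfctE /flat_exp' /flat_exp t0 /=.
change (t^-1 ^+ k * (expR (- t^-1) * - - t ^- 2) +
    expR (- t^-1) * ((k%:R * t^-1 ^+ k.-1) * - t ^- 2) =
  t ^- k.+2 * expR (- t^-1) - k%:R * (t ^- k.+1 * expR (- t^-1))).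
move: (expR _) => e; case: k {dX E} => [|k].
  by rewrite !mul0r mulr0 addr0 subr0 expr0 opprK mul1r mulrC.
rewrite /= exprVn exprVn !exprS; have := expf_neq0 k tn0; move: (t ^+ k) => B B0.
by field; rewrite B0 tn0.
Qed.

Lemma flat_exp_continuous k : continuous (flat_exp k).
Proof.
move=> t; have [->|t0] := eqVneq t 0; first exact: flat_exp_cts0.
have [d _] := is_derive_flat_exp_neq0 k t0.
exact/differentiable_continuous/derivable1_diffP.
Qed.

Lemma flat_exp'_continuous k : continuous (flat_exp' k).
Proof.
move=> t; have c2 := @flat_exp_continuous k.+2 t.
have c1 : {for t, continuous (fun u => k%:R * flat_exp k.+1 u)}.
  exact: (cvgM (cvg_cst _) (@flat_exp_continuous k.+1 t)).
exact: (cvgB c2 c1).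
Qed.

Lemma is_derive_flat_exp k (t : R) : is_derive t 1 (flat_exp k) (flat_exp' k t).
Proof.
have [->|t0] := eqVneq t 0; last exact: is_derive_flat_exp_neq0.
apply: is_derive_extend; first exact: flat_exp'_continuous.
  by apply: (@filterE _ (nbhs (0 : R)) _) => h; exact: flat_exp_continuous.
apply: filterS (nbhs_dnbhs_neq (0 : R)) => h h0.
by apply: is_derive_flat_exp_neq0; rewrite add0r [_ *: _]mulr1.
Qed.

(** The real line appears as ['rV[R]_1] because [Ck] speaks of row vectors, so that [smooth_on_comp]
    applies afterwards. *)
Lemma Ck_flat_exp n k (U : set 'rV[R]_1) : open U -> Ck n U (fun y => flat_exp k (y 0 0)).
Proof.
move=> oU.
have cts j (y : 'rV[R]_1) : {for y, continuous (fun y : 'rV[R]_1 => flat_exp j (y 0 0))}.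
  exact: (continuous_comp (@coord_continuous R 1 1 0 0 y) (@flat_exp_continuous j (y 0 0))).
elim: n k => [|n IH] k; first by split.
split=> [y _|i]; first exact: cts.
have d (y : 'rV[R]_1) : is_derive y (delta_mx 0 i) (fun y : 'rV[R]_1 => flat_exp k (y 0 0)) (flat_exp' k (y 0 0)).
  have [d1 d2] := is_derive_flat_exp k (y 0 0).
  have E : (fun h : R => h^-1 *: ((flat_exp k \o shift (y 0 0)) (h *: 1) - flat_exp k (y 0 0))) =
    (fun h => h^-1 *: (((fun y : 'rV[R]_1 => flat_exp k (y 0 0)) \o shift y) (h *: delta_mx 0 i) - flat_exp k (y 0 0))).
    by apply/funext => h /=; rewrite !mxE (ord1 i) !eqxx.
  by move: d1 d2; rewrite /derivable /derive E => d1 d2; split.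
split=> [y _|]; first by have [] := d y.
apply: (@Ck_eq _ _ n U (fun y => flat_exp k.+2 (y 0 0) + - k%:R * flat_exp k.+1 (y 0 0))) => //.
  by move=> y _; have [_ ->] := d y; rewrite mulNr.
by apply: CkD => //; apply: CkM => //; exact: Ck_cst.
Qed.

Lemma smooth_on_flat_exp {m : nat} (U : set 'rV[R]_m) k (f : 'rV[R]_m -> R) :
  open U -> smooth_on U f -> smooth_on U (flat_exp k \o f).
Proof.
move=> oU sf.
have := @smooth_on_comp R m 1 (fun x => const_mx (f x)) (fun y => flat_exp k (y 0 0)) U setT oU openT.
move=> /(_ (fun _ _ => I)) H; apply: (@smooth_on_eq _ _ _ _ _ oU _ (H _ _)).
- by move=> x _ /=; rewrite mxE.
- by move=> j; apply: smooth_on_eq sf => // x _; rewrite mxE.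
- by move=> n; apply: Ck_flat_exp; exact: openT.
Qed.

Lemma flat_exp_neq0 k (t : R) : (flat_exp k t != 0) = (0 < t).
Proof.
rewrite /flat_exp; case: ifPn => [t0|]; last by rewrite eqxx.
by rewrite gt_eqF // mulr_gt0 ?expR_gt0 // invr_gt0 exprn_gt0.
Qed.

(** A product over the coordinates suffices, since the balls of the norm in use are boxes. *)
Definition box_bump {m : nat} (c : 'rV[R]_m) (r : R) (x : 'rV[R]_m) : R :=
  \prod_j (flat_exp 0 (r - (x 0 j - c 0 j)) * flat_exp 0 (r + (x 0 j - c 0 j))).

Lemma smooth_on_box_bump {m : nat} (U : set 'rV[R]_m) c r : open U -> smooth_on U (box_bump c r).
Proof.
move=> oU; rewrite /box_bump.
have sm j : smooth_on U (fun x => flat_exp 0 (r - (x 0 j - c 0 j)) * flat_exp 0 (r + (x 0 j - c 0 j))).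
  have s1 : smooth_on U (fun x => x 0 j - c 0 j).
    by apply: smooth_onB => //; [exact: smooth_on_coord|exact: smooth_on_cst].
  apply: smooth_onM => //.
    apply: (@smooth_on_flat_exp _ U 0 (fun x => r - (x 0 j - c 0 j))) => //.
    by apply: smooth_onB => //; exact: smooth_on_cst.
  apply: (@smooth_on_flat_exp _ U 0 (fun x => r + (x 0 j - c 0 j))) => //.
  by apply: smooth_onD => //; exact: smooth_on_cst.
elim: (index_enum _) => [|j s IH].
  by apply: (smooth_on_eq oU _ (smooth_on_cst 1 oU)) => x _; rewrite big_nil.
by apply: (smooth_on_eq oU _ (smooth_onM oU (sm j) IH)) => x _; rewrite big_cons.
Qed.

Lemma box_bump_neq0 {m : nat} (c : 'rV[R]_m) (r : R) x : 0 < r -> box_bump c r x != 0 <-> ball c r x.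
Proof.
move=> r0; rewrite /box_bump; split=> [/prodf_neq0 H|[_ H]].
  split=> // i j; rewrite ord1; have := H j isT; rewrite mulf_eq0 negb_or !flat_exp_neq0.
  by move=> /andP[h1 h2]; rewrite /ball /= ltr_norml; apply/andP; split; lra.
apply/prodf_neq0 => j _; have := H 0 j; rewrite /ball /= ltr_norml => /andP[h1 h2].
by rewrite mulf_neq0 // flat_exp_neq0; lra.
Qed.

End Bump.

(** * Smooth functions, tangent vectors and frames *)

Section Charts.
Context {R : realType} {m : nat} {M : manifold R m}.
Implicit Types (c d : chart R M m) (p q : M) (f g : M -> R).

Lemma cinv_cdom c x : (cmap c @` cdom c) x -> cdom c (cinv c x).
Proof. by move=> [p cp <-]; rewrite cmapK. Qed.

Lemma cinvK c x : (cmap c @` cdom c) x -> cmap c (cinv c x) = x.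
Proof. by move=> [p cp <-]; rewrite cmapK. Qed.

Lemma open_cmap_image c (W : set M) : open W -> open (cmap c @` (cdom c `&` W)).
Proof.
move=> oW; rewrite openE => x [p [cp Wp] px].
have cx : (cmap c @` cdom c) x by exists p.
have xp : cinv c x = p by rewrite -px cmapK.
have n1 : \forall y \near x, (cmap c @` cdom c) y.
  by apply: open_nbhs_nbhs; split=> //; exact: cimg_open.
have n2 : \forall y \near x, W (cinv c y).
  by apply: (cinv_continuous cx); apply: open_nbhs_nbhs; rewrite xp.
apply: filterS (filterI n1 n2) => y [cy Wy].
by exists (cinv c y); [split=> //; exact: cinv_cdom|exact: cinvK].
Qed.

Lemma open_cmap_preimage c (V : set 'rV[R]_m) : open V -> open (cdom c `&` cmap c @^-1` V).
Proof.
move=> oV; rewrite openE => p [cp Vp].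
have n1 : \forall q \near p, cdom c q by apply: open_nbhs_nbhs; split=> //; exact: cdom_open.
have n2 : \forall q \near p, V (cmap c q).
  by apply: (cmap_continuous cp); exact: open_nbhs_nbhs.
exact: filterI n1 n2.
Qed.

(** Extension by zero of a function given in a chart. The test on [cdom c] is needed because the
    total map [cmap c] is arbitrary outside its domain. *)
Definition cutoff c (x0 : 'rV[R]_m) (r : R) (h : 'rV[R]_m -> R) q : R :=
  if `[< cdom c q >] then box_bump x0 r (cmap c q) * h (cmap c q) else 0.

(** The closed box of radius [r] is compact, so its image in [M] is compact, hence closed because
    [M] is Hausdorff. Two open sets cover [M]: the preimage of the ball of radius [r'], where the
    formula is smooth, and the complement of that image, where the cutoff is zero. *)
Lemma smooth_cutoff c (x0 : 'rV[R]_m) (r r' : R) h : atlas c -> ball x0 r' `<=` cmap c @` cdom c ->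
  0 < r -> r < r' -> smooth_on (ball x0 r') h -> smooth (cutoff c x0 r h).
Proof.
move=> ac sub r0 rr' sh d ad.
pose K' : set 'rV[R]_m := [set v | forall i, [set` `[x0 0 i - r, x0 0 i + r]] (v 0 i)].
have K'ball : K' `<=` ball x0 r'.
  move=> v Kv; split; first exact: lt_trans rr'.
  move=> i j; rewrite ord1; have := Kv j; rewrite /= in_itv /= => /andP[h1 h2].
  by rewrite /ball /= ltr_norml; apply/andP; split; lra.
have cK' : compact K' by apply: (@rV_compact R m (fun i => [set` `[x0 0 i - r, x0 0 i + r]])) => i; exact: segment_compact.
have cK : compact (cinv c @` K').
  apply: continuous_compact cK'; apply: continuous_in_subspaceT => v /set_mem /K'ball /sub.
  exact: cinv_continuous.
have closedK : closed (cinv c @` K') by apply: compact_closed cK; exact: m_hausdorff.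
pose O := cdom c `&` cmap c @^-1` (ball x0 r').
have oO : open O by apply: open_cmap_preimage; exact: ball_open.
have sm : smooth_on (ball x0 r') (fun x => box_bump x0 r x * h x).
  by apply: smooth_onM => //; [exact: ball_open|exact/smooth_on_box_bump/ball_open].
apply: smooth_on_local => y dy; set q := cinv d y.
have [Oq|nOq] := pselect (O q).
  exists (cmap d @` (cdom d `&` O)).
    by exists q; [split=> //; exact: cinv_cdom|exact: cinvK].
  apply: (@smooth_on_eq _ _ _ ((fun x => box_bump x0 r x * h x) \o (fun x => cmap c (cinv d x)))).
  - exact: open_cmap_image.
  - by move=> z [q' [dq' [cq' _]] <-] /=; rewrite cmapK // /cutoff asboolT.
  apply: smooth_on_comp sm.
  - exact: open_cmap_image.
  - exact: ball_open.
  - by move=> z [q' [dq' [cq' bq']] <-]; rewrite cmapK.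
  move=> j; apply: smooth_on_sub (atlas_compatible ad ac j).
  by move=> z [q' [dq' [cq' _]] <-]; exists q'.
have nKq : ~ (cinv c @` K') q.
  move=> [v Kv vq]; apply: nOq; rewrite -vq; have cv := sub _ (K'ball _ Kv).
  by split; [exact: cinv_cdom|rewrite /= cinvK //; exact: K'ball].
exists (cmap d @` (cdom d `&` ~` (cinv c @` K'))).
  by exists q; [split=> //; exact: cinv_cdom|exact: cinvK].
have oV : open (cmap d @` (cdom d `&` ~` (cinv c @` K'))).
  by apply: open_cmap_image; exact: closed_openC.
apply: (smooth_on_eq oV _ (smooth_on_cst 0 oV)) => z [q' [dq' nK] <-] /=.
rewrite cmapK // /cutoff; case: asboolP => // cq'.
have [/(box_bump_neq0 _ _ r0)[_ b]|/negPn/eqP ->] := boolP (box_bump x0 r (cmap c q') != 0); last by rewrite mul0r.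
exfalso; apply: nK; exists (cmap c q'); last exact: cmapK.
move=> i; have := b 0 i; rewrite /ball /= ltr_norml in_itv /= => /andP[h1 h2].
by apply/andP; split; lra.
Qed.

End Charts.

Section SmoothAlgebra.
Context {R : realType} {m : nat} {M : manifold R m}.
Implicit Types (f g : M -> R).

Lemma smooth_eq f g : smooth f -> (forall p, f p = g p) -> smooth g.
Proof. by move=> sf /funext <-. Qed.

Lemma smoothN f : smooth f -> smooth (fun p => - f p).
Proof.
move=> sf.
apply: smooth_eq (smoothM (@smooth_cst _ _ M (-1)) sf) _ => p.
by rewrite mulN1r.
Qed.

Lemma smoothB f g : smooth f -> smooth g -> smooth (fun p => f p - g p).
Proof. by move=> sf sg; apply: smoothD => //; exact: smoothN. Qed.

Lemma smooth_sum (I : Type) (s : seq I) (F : I -> M -> R) :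
  (forall i, smooth (F i)) -> smooth (fun p => \sum_(i <- s) F i p).
Proof.
move=> sF; elim: s => [|i s IH].
  by apply: smooth_eq (@smooth_cst _ _ M 0) _ => p; rewrite big_nil.
by apply: smooth_eq (smoothD (sF i) IH) _ => p; rewrite big_cons.
Qed.

Lemma smooth_prod (I : Type) (s : seq I) (F : I -> M -> R) :
  (forall i, smooth (F i)) -> smooth (fun p => \prod_(i <- s) F i p).
Proof.
move=> sF; elim: s => [|i s IH].
  by apply: smooth_eq (@smooth_cst _ _ M 1) _ => p; rewrite big_nil.
by apply: smooth_eq (smoothM (sF i) IH) _ => p; rewrite big_cons.
Qed.

Lemma smooth_continuous f : smooth f -> continuous f.
Proof.
move=> sf p; have [c ac cp] := atlas_cover p.
have n1 : \forall q \near p, cdom c q by apply: open_nbhs_nbhs; split=> //; exact: cdom_open.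
have : f (cinv c (cmap c q)) @[q --> p] --> f p.
  have cx : (cmap c @` cdom c) (cmap c p) by exists p.
  have h := smooth_on_continuous (sf c ac) cx.
  have := continuous_comp (cmap_continuous cp) h.
  by rewrite /prop_for /continuous_at /= cmapK.
apply: cvg_trans; apply: near_eq_cvg; apply: filterS n1 => q cq.
by rewrite cmapK.
Qed.

(* Smoothness is local, so it can be tested after multiplication by smooth
   functions that do not vanish at a given point. *)
Lemma smooth_div_local f :
  (forall p, exists2 d, smooth d /\ d p != 0 & smooth (fun q => d q * f q)) -> smooth f.
Proof.
move=> H c ac; apply: smooth_on_local => x cx.
have [d [sd d0] sdf] := H (cinv c x).
pose W := [set q | d q != 0].
have oW : open W by apply: (open_comp (fun q _ => @smooth_continuous d sd q) (@open_neq R 0)).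
have oV : open (cmap c @` (cdom c `&` W)) by exact: open_cmap_image.
have VW y : (cmap c @` (cdom c `&` W)) y -> d (cinv c y) != 0.
  by move=> [q [cq Wq] <-]; rewrite cmapK.
have VU : cmap c @` (cdom c `&` W) `<=` cmap c @` cdom c.
  by move=> y [q [cq _] <-]; exists q.
exists (cmap c @` (cdom c `&` W)).
  by exists (cinv c x); [split=> //; exact: cinv_cdom|exact: cinvK].
have sV := smooth_onV oV VW (smooth_on_sub VU (sd c ac)).
apply: (smooth_on_eq oV _ (smooth_onM oV (smooth_on_sub VU (sdf c ac)) sV)).
by move=> y /VW dy /=; rewrite mulrC mulKf.
Qed.

End SmoothAlgebra.

(** * Tangent vectors as derivations, smooth fields *)

Section TangentAlgebra.
Context {R : realType} {m : nat} {M : manifold R m}.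
Implicit Types (p : M) (f g : M -> R).

Lemma tangent_ext p (u v : tangent p) : (forall f, smooth f -> u f = v f) -> u = v.
Proof.
move=> uv; apply/val_inj/funext => f /=.
have [sf|nf] := pselect (smooth f); first exact: uv.
by have [-> // _ _] := tangent_derivation u; have [-> // _ _] := tangent_derivation v.
Qed.

Lemma tangentZDE p (a : R) (u v : tangent p) f : (a *: u + v) f = a * u f + v f.
Proof. by []. Qed.

Lemma tangentDE p (u v : tangent p) f : (u + v) f = u f + v f.
Proof. by []. Qed.

Lemma tangentZE p (a : R) (u : tangent p) f : (a *: u) f = a * u f.
Proof. by []. Qed.

Lemma tangentNE p (u : tangent p) f : (- u) f = - u f.
Proof. by []. Qed.

Lemma tangentBE p (u v : tangent p) f : (u - v) f = u f - v f.
Proof. by []. Qed.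

Lemma tangent0E p f : (0 : tangent p) f = 0.
Proof. by []. Qed.

Lemma tangent_sumE p (I : Type) (s : seq I) (F : I -> tangent p) f :
  (\sum_(i <- s) F i) f = \sum_(i <- s) F i f.
Proof. by elim/big_rec2: _ => // i x y _ <-. Qed.

Lemma tangent_lin p (v : tangent p) (a : R) f g : smooth f -> smooth g ->
  v (fun q => a * f q + g q) = a * v f + v g.
Proof. by have [_ + _] := tangent_derivation v; apply. Qed.

Lemma tangent_mul p (v : tangent p) f g : smooth f -> smooth g ->
  v (fun q => f q * g q) = f p * v g + g p * v f.
Proof. by have [_ _] := tangent_derivation v; apply. Qed.

Lemma tangent_add p (v : tangent p) f g : smooth f -> smooth g ->
  v (fun q => f q + g q) = v f + v g.
Proof.
move=> sf sg; rewrite -[v f]mul1r -tangent_lin //; congr (tangent_fun v _).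
by apply/funext => q; rewrite mul1r.
Qed.

Lemma tangent_cst p (v : tangent p) (a : R) : v (fun=> a) = 0.
Proof.
have one : v (fun=> 1) = 0.
  have := tangent_mul v (@smooth_cst _ _ M 1) (@smooth_cst _ _ M 1).
  have -> : (fun _ : M => 1 * 1 : R) = fun=> 1 by apply/funext => q; rewrite mulr1.
  by rewrite mul1r => /eqP; rewrite -subr_eq subrr eq_sym => /eqP.
have v0 : v (fun=> 0) = 0.
  have := tangent_add v (@smooth_cst _ _ M 0) (@smooth_cst _ _ M 0).
  rewrite addr0 => /eqP; rewrite -subr_eq subrr eq_sym => /eqP //.
have := tangent_lin v a (@smooth_cst _ _ M 1) (@smooth_cst _ _ M 0).
rewrite one v0 => E; have -> : (fun _ : M => a) = fun=> a * 1 + 0.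
  by apply/funext => q; rewrite mulr1 addr0.
by rewrite E mulr0 addr0.
Qed.

Lemma tangent_scale p (v : tangent p) (a : R) f : smooth f ->
  v (fun q => a * f q) = a * v f.
Proof.
by move=> sf; rewrite tangent_mul ?tangent_cst ?mulr0 ?addr0 //; exact: smooth_cst.
Qed.

Lemma tangent_opp p (v : tangent p) f : smooth f -> v (fun q => - f q) = - v f.
Proof.
move=> sf; rewrite -mulN1r -tangent_scale //; congr (tangent_fun v _).
by apply/funext => q; rewrite mulN1r.
Qed.

Lemma tangent_sub p (v : tangent p) f g : smooth f -> smooth g ->
  v (fun q => f q - g q) = v f - v g.
Proof. by move=> sf sg; rewrite tangent_add ?tangent_opp //; exact: smoothN. Qed.

Lemma tangent_sum p (v : tangent p) (I : Type) (s : seq I) (F : I -> M -> R) :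
  (forall i, smooth (F i)) ->
  v (fun q => \sum_(i <- s) F i q) = \sum_(i <- s) v (F i).
Proof.
move=> sF; elim: s => [|i s IH].
  rewrite big_nil -[RHS](tangent_cst v 0); congr (tangent_fun v _).
  by apply/funext => q; rewrite big_nil.
rewrite big_cons -IH -tangent_add //; last exact: smooth_sum.
by congr (tangent_fun v _); apply/funext => q; rewrite big_cons.
Qed.

Implicit Types (X Y : vfield M).

Lemma smooth_vfield_add X Y : smooth_vfield X -> smooth_vfield Y ->
  smooth_vfield (fun p => X p + Y p).
Proof. by move=> sX sY f sf; apply: smoothD; [exact: sX|exact: sY]. Qed.

Lemma smooth_vfield_scale f X : smooth f -> smooth_vfield X ->
  smooth_vfield (fun p => f p *: X p).
Proof. by move=> sf sX g sg; exact: smoothM sf (sX g sg). Qed.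

Lemma smooth_vfield0 : smooth_vfield (fun p => 0 : tangent p).
Proof. by move=> f sf; exact: smooth_cst. Qed.

Lemma smooth_vfield_lin f X Y : smooth f -> smooth_vfield X -> smooth_vfield Y ->
  smooth_vfield (fun p => f p *: X p + Y p).
Proof. by move=> sf sX sY; apply: smooth_vfield_add => //; exact: smooth_vfield_scale. Qed.

Lemma smooth_vfield_opp X : smooth_vfield X -> smooth_vfield (fun p => - X p).
Proof. by move=> sX f sf; apply: smoothN; exact: sX. Qed.

Lemma smooth_vfield_sum (I : Type) (s : seq I) (F : I -> vfield M) :
  (forall i, smooth_vfield (F i)) -> smooth_vfield (fun p => \sum_(i <- s) F i p).
Proof.
move=> sF f sf; apply: (@smooth_eq _ _ M (fun p => \sum_(i <- s) F i p f)).
  by apply: smooth_sum => i; exact: sF.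
by move=> p; rewrite tangent_sumE.
Qed.

Lemma smooth_bracket X Y : smooth_vfield X -> smooth_vfield Y -> smooth_vfield (bracket X Y).
Proof.
move=> sX sY f sf; have sXY : smooth (fun p => X p (fun q => Y q f)) by apply: sX; exact: sY.
have sYX : smooth (fun p => Y p (fun q => X q f)) by apply: sY; exact: sX.
by apply: smooth_eq (smoothB sXY sYX) _ => p; rewrite bracketE.
Qed.

(** The form [u dw - w du], that is [u^2 d(w / u)] without the division. If [u] is a cutoff and [w]
    is [u] times a coordinate, it is [u^2] times the differential of the coordinate. *)
Definition coord_form (u w : M -> R) p (v : tangent p) : R := u p * v w - w p * v u.

(* Multiplication by a cutoff function makes every object of a coordinate frame
   globally defined; [fr_rho] absorbs the resulting factors. *)
Record framing (p : M) := Framing {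
  fr_rho : M -> R;
  fr_u : M -> R;
  fr_w : 'I_m -> M -> R;
  fr_E : 'I_m -> vfield M;
  fr_rho_smooth : smooth fr_rho;
  fr_u_smooth : smooth fr_u;
  fr_w_smooth : forall a, smooth (fr_w a);
  fr_E_smooth : forall a, smooth_vfield (fr_E a);
  fr_expand : forall q (v : tangent q),
    fr_rho q *: v = \sum_a coord_form fr_u (fr_w a) v *: fr_E a q;
  fr_rho1 : fr_rho p = 1;
  fr_dual : forall a b, coord_form fr_u (fr_w a) (fr_E b p) = (a == b)%:R }.

End TangentAlgebra.

(** * Cut-off coordinate frames *)

Section Framing.
Context {R : realType} {m : nat} {M : manifold R m}.
Variables (c : chart R M m) (ac : atlas c).
Implicit Types (q : M) (f : M -> R).

Definition coord_vector (a : 'I_m) q : tangent q :=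
  to_tangent q (fun f => 'D_(delta_mx 0 a) (f \o cinv c) (cmap c q)).

Lemma coord_vectorE a q f : cdom c q -> smooth f ->
  coord_vector a q f = 'D_(delta_mx 0 a) (f \o cinv c) (cmap c q).
Proof.
move=> cq; have ci : (cmap c @` cdom c) (cmap c q) by exists q.
have der h : smooth h -> is_derive (cmap c q) (delta_mx 0 a) (h \o cinv c)
    ('D_(delta_mx 0 a) (h \o cinv c) (cmap c q)).
  by move=> sh; exact: smooth_on_is_derive (sh c ac) ci.
apply: to_tangentE => [k g h sg sh|g h sg sh].
  have [_] := is_deriveD (is_deriveM (is_derive_cst k (cmap c q) (delta_mx 0 a)) (der g sg)) (der h sh).
  by rewrite scaler0 addr0.
have [_] := is_deriveM (der g sg) (der h sh).
by rewrite /= cmapK.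
Qed.

Variables (p : M) (cp : cdom c p) (r r' : R) (r0 : 0 < r) (rr' : r < r').
Hypothesis sub : ball (cmap c p) r' `<=` cmap c @` cdom c.

Let cut := cutoff c (cmap c p) r.
Let chi := cut (fun=> 1).
Let w (a : 'I_m) := cut (fun x => x 0 a).
Let E (a : 'I_m) : vfield M := fun q => chi q *: coord_vector a q.

Let cut_smooth h : smooth_on (ball (cmap c p) r') h -> smooth (cut h).
Proof. by move=> sh; apply: smooth_cutoff sh. Qed.

Let cutE h q : cut h q = chi q * h (cmap c q).
Proof. by rewrite /chi /cut /cutoff; case: asboolP => _; rewrite ?mul0r // mulr1. Qed.

Let chi_neq0 q : chi q != 0 -> cdom c q /\ ball (cmap c p) r (cmap c q).
Proof.
rewrite /chi /cut /cutoff; case: asboolP => [cq|]; last by rewrite eqxx.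
by rewrite mulr1 => /(box_bump_neq0 _ _ r0).
Qed.

Let obr' : open (ball (cmap c p) r'). Proof. exact: ball_open. Qed.

Let ball_rr' x : ball (cmap c p) r x -> ball (cmap c p) r' x.
Proof. by apply: le_ball; exact: ltW. Qed.

Let chi_smooth : smooth chi.
Proof. by apply: cut_smooth; exact: smooth_on_cst. Qed.

Let w_smooth a : smooth (w a).
Proof. by apply: cut_smooth; exact: smooth_on_coord. Qed.

Let E_app a q f : smooth f -> E a q f = cut ('D_(delta_mx 0 a) (f \o cinv c)) q.
Proof.
move=> sf; rewrite tangentZE cutE.
have [/chi_neq0[cq _]|/negPn/eqP ->] := boolP (chi q != 0); last by rewrite !mul0r.
by rewrite coord_vectorE.
Qed.

Let E_smooth a : smooth_vfield (E a).
Proof.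
move=> f sf; apply: (@smooth_eq _ _ M (cut ('D_(delta_mx 0 a) (f \o cinv c)))).
  apply: cut_smooth; apply: smooth_on_derive; apply: smooth_on_sub (sf c ac).
  exact: sub.
by move=> q; rewrite E_app.
Qed.

(** By Hadamard's lemma at [cmap c q], [chi^2 (f - f q)] is a sum of products of globally smooth
    functions, to which the derivation [v] can be applied. Two factors [chi] belong to [coord_form]
    and the third to [E]. *)
Let E_expand q (v : tangent q) :
  chi q ^+ 3 *: v = \sum_a coord_form chi (w a) v *: E a q.
Proof.
apply: tangent_ext => f sf; rewrite tangentZE tangent_sumE.
under eq_bigr => a _ do rewrite tangentZE.
have [cq0|/negPn/eqP cq0] := boolP (chi q != 0); last first.
  rewrite cq0 expr0n mul0r big1 // => a _.
  by rewrite /coord_form /w cutE cq0 !mul0r subrr mul0r.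
have [cq bq] := chi_neq0 cq0; set b := cmap c q.
have sfc : smooth_on (ball (cmap c p) r') (f \o cinv c).
  by apply: smooth_on_sub (sf c ac); exact: sub.
have [g [sg hg gb]] := hadamard (ball_rr' bq) sfc.
pose F a := cut (fun y => y 0 a - b 0 a); pose G a := cut (g a).
have sF a : smooth (F a).
  by apply: cut_smooth; apply: smooth_onB => //; [exact: smooth_on_coord|exact: smooth_on_cst].
have sG a : smooth (G a) by exact: cut_smooth.
have id1 q' : chi q' * chi q' * (f q' - f q) = \sum_a F a q' * G a q'.
  have [/chi_neq0[cq' bq']|/negPn/eqP c0] := boolP (chi q' != 0); last first.
    by rewrite c0 !mul0r big1 // => a _; rewrite /F cutE c0 !mul0r.
  have := hg _ (ball_rr' bq'); rewrite /= !cmapK // => ->.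
  rewrite (addrC (f q)) addrK mulr_sumr; apply: eq_bigr => a _.
  by rewrite /F /G !cutE; ring.
have vL : v (fun q' => chi q' * chi q' * (f q' - f q)) = chi q * chi q * v f.
  have sB : smooth (fun q' => f q' - f q) by apply: smoothB => //; exact: smooth_cst.
  rewrite (tangent_mul v (smoothM chi_smooth chi_smooth) sB) subrr mul0r addr0.
  by rewrite tangent_sub ?tangent_cst ?subr0 //; exact: smooth_cst.
have vF a : v (F a) = v (w a) - b 0 a * v chi.
  rewrite -tangent_scale // -tangent_sub //; last by apply: smoothM => //; exact: smooth_cst.
  by congr (tangent_fun v _); apply/funext => q'; rewrite /F /w !cutE; ring.
have vR : v (fun q' => \sum_a F a q' * G a q') = \sum_a chi q * g a b * (v (w a) - b 0 a * v chi).
  rewrite tangent_sum; last by move=> a; exact: smoothM.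
  apply: eq_bigr => a _; rewrite tangent_mul // vF /F /G !cutE subrr mulr0 mul0r add0r.
  by [].
have -> : chi q ^+ 3 * v f = chi q * (chi q * chi q * v f) by ring.
rewrite -vL (_ : (fun q' => _) = (fun q' => \sum_a F a q' * G a q')); last exact/funext.
rewrite vR mulr_sumr; apply: eq_bigr => a _.
rewrite E_app // /coord_form /w !cutE -(gb a) -/b.
by ring.
Qed.

Let chip : chi p != 0.
Proof.
rewrite /chi /cut /cutoff asboolT // mulr1; apply/(box_bump_neq0 _ _ r0).
exact: ballxx.
Qed.

(** The terms containing derivatives of the bump cancel in [coord_form]. *)
Let E_dual a b : coord_form chi (w a) (E b p) = chi p ^+ 3 * (a == b)%:R.
Proof.
set x := cmap c p; have cx : (cmap c @` cdom c) x by exists p.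
pose B := box_bump x r.
have oc := @cimg_open _ _ _ c.
have DB : is_derive x (delta_mx 0 b) B ('D_(delta_mx 0 b) B x).
  by apply: smooth_on_is_derive cx; exact: smooth_on_box_bump.
have Echi : E b p chi = chi p * 'D_(delta_mx 0 b) B x.
  rewrite E_app // cutE; congr (_ * _); apply: (derive_eq_on _ oc cx) => y cy.
  by rewrite /= /chi /cut /cutoff asboolT ?mulr1 ?cinvK //; exact: cinv_cdom.
have Ew : E b p (w a) = chi p * (B x * (a == b)%:R + x 0 a * 'D_(delta_mx 0 b) B x).
  rewrite E_app // cutE; congr (_ * _).
  have -> : 'D_(delta_mx 0 b) (w a \o cinv c) (cmap c p) = 'D_(delta_mx 0 b) (B * (fun y => y 0 a)) x.
    apply: (derive_eq_on _ oc cx) => y cy.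
    by rewrite /= /w /cut /cutoff asboolT ?cinvK //; exact: cinv_cdom.
  have [_ ->] := is_deriveM DB (is_derive_coord x (delta_mx 0 b) a).
  by rewrite mxE eqxx.
have Bx : chi p = B x by rewrite /chi /cut /cutoff asboolT // mulr1.
by rewrite /coord_form Echi Ew /w cutE -/x Bx; ring.
Qed.

Definition chart_framing : framing p.
Proof.
have c3 : chi p ^+ 3 != 0 by exact: expf_neq0.
(* Dividing by the value [chi p ^+ 3] normalizes both [fr_rho] and the duality at [p]. *)
apply: (@Framing _ _ _ p (fun q => (chi p ^+ 3)^-1 * chi q ^+ 3) chi w
   (fun a q => (chi p ^+ 3)^-1 *: E a q)) => //.
- apply: smoothM; first exact: smooth_cst.
  by apply: smooth_eq (smoothM chi_smooth (smoothM chi_smooth chi_smooth)) _ => q; rewrite !exprS expr0; ring.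
- by move=> a; apply: smooth_vfield_scale => //; exact: smooth_cst.
- move=> q v; rewrite -scalerA E_expand scaler_sumr; apply: eq_bigr => a _.
  by rewrite [LHS]scalerA [RHS]scalerA (mulrC (coord_form _ _ _)).
- by rewrite mulVf.
move=> a b; rewrite /coord_form !tangentZE.
have := E_dual a b; rewrite /coord_form => e.
by rewrite mulrCA [w a p * _]mulrCA -mulrBr e mulrA mulVf // mul1r.
Qed.

End Framing.

Lemma framing_exists {R : realType} {m : nat} {M : manifold R m} (p : M) : exists fr : framing p, True.
Proof.
have [c ac cp] := atlas_cover p.
have /nbhs_ballP[r' /= r'0 sub] : nbhs (cmap c p) (cmap c @` cdom c).
  by apply: open_nbhs_nbhs; split; [exact: cimg_open|exists p].
have rr' : r' / 2 < r' by rewrite ltr_pdivrMr // ltr_pMr // ltr1n.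
have r0 : 0 < r' / 2 by rewrite divr_gt0.
by exists (chart_framing ac cp r0 rr' sub).
Qed.

Section FramingTheory.
Context {R : realType} {m : nat} {M : manifold R m}.
Implicit Types (p q : M) (X Y Z : vfield M).

Definition frame p : framing p := sval (cid (framing_exists p)).

Definition theta p (a : 'I_m) q (v : tangent q) : R :=
  coord_form (fr_u (frame p)) (fr_w (frame p) a) v.

Definition frame_field p (a : 'I_m) : vfield M := fr_E (frame p) a.

Definition rho p : M -> R := fr_rho (frame p).

Lemma theta_lin p a q (k : R) (u v : tangent q) :
  theta p a (k *: u + v) = k * theta p a u + theta p a v.
Proof. by rewrite /theta /coord_form !tangentZDE; ring. Qed.

Lemma theta_smooth p a X : smooth_vfield X -> smooth (fun q => theta p a (X q)).
Proof.
move=> sX; have su := fr_u_smooth (frame p); have sw := fr_w_smooth (frame p) a.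
by apply: smoothB; apply: smoothM => //; exact: sX.
Qed.

Lemma frame_field_smooth p a : smooth_vfield (frame_field p a).
Proof. exact: fr_E_smooth. Qed.

Lemma rho_smooth p : smooth (rho p).
Proof. exact: fr_rho_smooth. Qed.

Lemma rho1 p : rho p p = 1.
Proof. exact: fr_rho1. Qed.

Lemma rho_expand p q (v : tangent q) : rho p q *: v = \sum_a theta p a v *: frame_field p a q.
Proof. exact: fr_expand. Qed.

Lemma frame_expand p (v : tangent p) : v = \sum_a theta p a v *: frame_field p a p.
Proof. by rewrite -rho_expand rho1 scale1r. Qed.

Lemma theta_dual p a b : theta p a (frame_field p b p) = (a == b)%:R.
Proof. exact: fr_dual. Qed.

(** The coefficients in the frame are constant, so derivatives of the extension involve only those
    of the frame fields. *)
Definition extend p (v : tangent p) : vfield M :=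
  fun q => \sum_a theta p a v *: frame_field p a q.

Lemma extend_smooth p (v : tangent p) : smooth_vfield (extend v).
Proof.
apply: smooth_vfield_sum => a; apply: smooth_vfield_scale; first exact: smooth_cst.
exact: frame_field_smooth.
Qed.

Lemma extendE p (v : tangent p) : extend v p = v.
Proof. by rewrite /extend -frame_expand. Qed.

End FramingTheory.

(** * Levi-Civita connections *)

Section Riemannian.
Context {R : realType} {m : nat} {M : manifold R m}.
Variables (g : bilinear_field M) (nabla : vfield M -> vfield M -> vfield M).
Arguments g : clear implicits.
Hypothesis metric_g : riemannian_metric g.
Hypothesis LC : levi_civita g nabla.
Implicit Types (p q : M) (X Y Z : vfield M) (f : M -> R).

Lemma metric_linl p (a : R) u v w : g p (a *: u + v) w = a * g p u w + g p v w.
Proof. by have [H _ _ _] := metric_g; exact: H. Qed.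

Lemma riemannian_sym p u v : g p u v = g p v u.
Proof. by have [_ H _ _] := metric_g; exact: H. Qed.

Lemma metric_linr p (a : R) u v w : g p w (a *: u + v) = a * g p w u + g p w v.
Proof. by rewrite riemannian_sym metric_linl !(riemannian_sym w). Qed.

Lemma metricDl p u v w : g p (u + v) w = g p u w + g p v w.
Proof. by rewrite -{1}[u]scale1r metric_linl mul1r. Qed.

Lemma metric0l p w : g p 0 w = 0.
Proof. by apply: (addrI (g p 0 w)); rewrite -metricDl !addr0. Qed.

Lemma metricZl p (a : R) u w : g p (a *: u) w = a * g p u w.
Proof. by rewrite -[a *: u]addr0 metric_linl metric0l addr0. Qed.

Lemma metricNl p u w : g p (- u) w = - g p u w.
Proof. by rewrite -scaleN1r metricZl mulN1r. Qed.

Lemma metricBl p u v w : g p (u - v) w = g p u w - g p v w.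
Proof. by rewrite metricDl metricNl. Qed.

Lemma metricDr p u v w : g p w (u + v) = g p w u + g p w v.
Proof. by rewrite -!(riemannian_sym _ w) metricDl. Qed.

Lemma metricZr p (a : R) u w : g p w (a *: u) = a * g p w u.
Proof. by rewrite -!(riemannian_sym _ w) metricZl. Qed.

Lemma metricNr p u w : g p w (- u) = - g p w u.
Proof. by rewrite -!(riemannian_sym _ w) metricNl. Qed.

Lemma metric0r p w : g p w 0 = 0.
Proof. by rewrite riemannian_sym metric0l. Qed.

Lemma metric_suml p (I : Type) (s : seq I) (F : I -> tangent p) w :
  g p (\sum_(i <- s) F i) w = \sum_(i <- s) g p (F i) w.
Proof.
elim: s => [|i s IH]; first by rewrite !big_nil metric0l.
by rewrite !big_cons metricDl IH.
Qed.

Lemma metric_sumr p (I : Type) (s : seq I) (F : I -> tangent p) w :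
  g p w (\sum_(i <- s) F i) = \sum_(i <- s) g p w (F i).
Proof. by rewrite riemannian_sym metric_suml; apply: eq_bigr => i _; rewrite riemannian_sym. Qed.

Lemma metric_eq0 p u : g p u u = 0 -> u = 0.
Proof.
have [_ _ H _] := metric_g; move=> u0; apply/eqP/negPn/negP => /H.
by rewrite u0 ltxx.
Qed.

Lemma metric_nondeg p u : (forall w, g p u w = 0) -> u = 0.
Proof. by move=> /(_ u)/metric_eq0. Qed.

Lemma metric_inj p u v : (forall w, g p u w = g p v w) -> u = v.
Proof.
move=> uv; apply/eqP; rewrite -subr_eq0; apply/eqP/metric_nondeg => w.
by rewrite metricBl uv subrr.
Qed.

Lemma metric_smooth X Y : smooth_vfield X -> smooth_vfield Y -> smooth (fun q => g q (X q) (Y q)).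
Proof. by have [_ _ _ H] := metric_g; exact: H. Qed.

Lemma nabla_linl f X X' Y p : smooth f -> smooth_vfield X -> smooth_vfield X' -> smooth_vfield Y ->
  nabla (fun q => f q *: X q + X' q) Y p = f p *: nabla X Y p + nabla X' Y p.
Proof. by have [_ H _ _ _] := LC; exact: H. Qed.

Lemma nabla_linr f X Y Y' p : smooth f -> smooth_vfield X -> smooth_vfield Y -> smooth_vfield Y' ->
  nabla X (fun q => f q *: Y q + Y' q) p = X p f *: Y p + f p *: nabla X Y p + nabla X Y' p.
Proof. by have [_ _ H _ _] := LC; exact: H. Qed.

Lemma nabla_torsion X Y p : smooth_vfield X -> smooth_vfield Y ->
  bracket X Y p = nabla X Y p - nabla Y X p.
Proof. by have [_ _ _ H _] := LC; move=> sX sY; rewrite H. Qed.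

Lemma nabla_metric X Y Z p : smooth_vfield X -> smooth_vfield Y -> smooth_vfield Z ->
  X p (fun q => g q (Y q) (Z q)) = g p (nabla X Y p) (Z p) + g p (Y p) (nabla X Z p).
Proof. by have [_ _ _ _ H] := LC; exact: H. Qed.

Let zero : vfield M := fun q => 0.

Lemma nabla0l Y p : smooth_vfield Y -> nabla zero Y p = 0.
Proof.
move=> sY; have s0 : smooth_vfield zero by exact: smooth_vfield0.
have := nabla_linl p (@smooth_cst _ _ M 1) s0 s0 sY.
have -> : (fun q => (1 : R) *: zero q + zero q) = zero.
  by apply: functional_extensionality_dep => q; rewrite /zero scaler0 addr0.
rewrite scale1r => /eqP; rewrite -subr_eq subrr eq_sym => /eqP //.
Qed.

Lemma nabla_suml (I : Type) (s : seq I) (F : I -> M -> R) (E : I -> vfield M) Y p :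
  (forall i, smooth (F i)) -> (forall i, smooth_vfield (E i)) -> smooth_vfield Y ->
  nabla (fun q => \sum_(i <- s) F i q *: E i q) Y p = \sum_(i <- s) F i p *: nabla (E i) Y p.
Proof.
move=> sF sE sY; elim: s => [|i s IH].
  rewrite big_nil -[RHS](nabla0l p sY); congr (nabla _ Y p).
  by apply: functional_extensionality_dep => q; rewrite big_nil.
rewrite big_cons -IH -nabla_linl //; last first.
  by apply: smooth_vfield_sum => j; exact: smooth_vfield_scale.
by congr (nabla _ Y p); apply: functional_extensionality_dep => q; rewrite big_cons.
Qed.

(** Since [rho p] is 1 at [p], a field may be multiplied by it without changing the derivative at
    [p]; the product is a combination of globally defined frame fields. *)
Lemma nabla_tensorial X X' Y p : smooth_vfield X -> smooth_vfield X' -> smooth_vfield Y ->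
  X p = X' p -> nabla X Y p = nabla X' Y p.
Proof.
move=> sX sX' sY; have E Z : smooth_vfield Z ->
    nabla Z Y p = \sum_a theta p a (Z p) *: nabla (frame_field p a) Y p.
  move=> sZ; have s0 : smooth_vfield zero by exact: smooth_vfield0.
  have := nabla_linl p (rho_smooth p) sZ s0 sY.
  rewrite rho1 scale1r nabla0l // addr0 => <-.
  rewrite -(@nabla_suml _ _ (fun a q => theta p a (Z q)) (frame_field p)) //.
  - congr (nabla _ Y p); apply: functional_extensionality_dep => q.
    by rewrite addr0 rho_expand.
  - by move=> a; exact: theta_smooth.
  - by move=> a; exact: frame_field_smooth.
by move=> XX'; rewrite !E // XX'.
Qed.

Definition nab p (v : tangent p) Y : tangent p := nabla (extend v) Y p.

Lemma nabE X Y p : smooth_vfield X -> smooth_vfield Y -> nabla X Y p = nab (X p) Y.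
Proof.
by move=> sX sY; apply: nabla_tensorial => //; [exact: extend_smooth|rewrite extendE].
Qed.

Lemma nab_lin p (a : R) (u v : tangent p) Y : smooth_vfield Y ->
  nab (a *: u + v) Y = a *: nab u Y + nab v Y.
Proof.
move=> sY; have su := extend_smooth u; have sv := extend_smooth v.
rewrite /nab -(nabla_linl p (@smooth_cst _ _ M a)) //.
apply: nabla_tensorial => //; first exact: extend_smooth.
  by apply: smooth_vfield_lin => //; exact: smooth_cst.
by rewrite !extendE.
Qed.

End Riemannian.

(** * Ranks of distributions *)

Section Rank.
Context {R : realType} {m : nat} {M : manifold R m}.
Implicit Types (D : Defs.distribution M).

(** Expanding the frame in [e] and pairing with the dual forms factors the identity matrix of size
    [m] through dimension [r]. *)
Lemma rank_eq_dim D p r : has_rank D r -> (forall v : tangent p, D p v) -> (m <= r)%N.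
Proof.
move=> /(_ p)[e [sp _]] full.
have /choice[B HB] (a : 'I_m) : exists c : 'I_r -> R, frame_field p a p = \sum_i c i *: e i.
  by apply/sp; exact: full.
apply: (@mulmx1_min R m r (\matrix_(a, i) B a i) (\matrix_(i, b) theta p b (e i))).
apply/matrixP => a b; rewrite !mxE eq_sym -(theta_dual p) HB.
have -> : theta p b (\sum_i B a i *: e i) = \sum_i B a i * theta p b (e i).
  elim: (index_enum _) => [|i s IH]; last by rewrite !big_cons theta_lin IH.
  by rewrite !big_nil /theta /coord_form !tangent0E !mulr0 subrr.
by apply: eq_bigr => i _; rewrite !mxE.
Qed.

(** The matrix [C] of the basis [e] in the frame has independent rows; as [m <= r] it also has full
    column rank, and its left inverse expresses the frame through [e]. *)
Lemma rank_full D r q (v : tangent q) : has_rank D r -> (m <= r)%N -> D q v.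
Proof.
move=> /(_ q)[e [sp ind]] mr.
pose C := \matrix_(i < r, a < m) theta q a (e i).
have eC i : e i = \sum_a C i a *: frame_field q a q.
  by rewrite {1}(frame_expand (e i)); apply: eq_bigr => a _; rewrite mxE.
have fC : row_free C.
  apply: inj_row_free => u uC; apply/rowP => i; rewrite [RHS]mxE.
  apply: (ind (fun i => u 0 i)).
  under eq_bigr => j _ do rewrite eC scaler_sumr.
  rewrite exchange_big /=; apply: big1 => a _.
  under eq_bigr => j _ do rewrite scalerA.
  rewrite -scaler_suml; have := congr1 (fun A : 'rV[R]_m => A 0 a) uC; rewrite !mxE => ->.
  by rewrite scale0r.
have /row_fullP[D' D'C] : row_full C.
  by rewrite /row_full eqn_leq rank_leq_col /=; move: fC => /eqP ->.
apply/sp; exists (fun i => \sum_a theta q a v * D' a i).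
rewrite {1}(frame_expand v).
under [RHS]eq_bigr => i _ do rewrite eC scaler_sumr.
rewrite [RHS]exchange_big /=; apply: eq_bigr => b _.
under eq_bigr => i _ do rewrite scalerA.
rewrite -scaler_suml; congr (_ *: _).
under eq_bigr => i _ do rewrite mulr_suml.
rewrite exchange_big /= (bigD1 b) //= [X in _ + X]big1 ?addr0.
  have := congr1 (fun A : 'M[R]_m => A b b) D'C; rewrite !mxE eqxx /= => e1.
  by under eq_bigr => i _ do rewrite -mulrA; rewrite -mulr_sumr e1 mulr1.
move=> a ab; under eq_bigr => i _ do rewrite -mulrA; rewrite -mulr_sumr.
have := congr1 (fun A : 'M[R]_m => A a b) D'C; rewrite !mxE (negPf ab) /= => ->.
by rewrite mulr0.
Qed.

End Rank.

Section BracketIdentities.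
Context {R : realType} {m : nat} {M : manifold R m}.
Implicit Types (X Y Z : vfield M).

Lemma bracket_jacobi X Y Z p : smooth_vfield X -> smooth_vfield Y -> smooth_vfield Z ->
  bracket (bracket X Y) Z p = bracket X (bracket Y Z) p - bracket Y (bracket X Z) p.
Proof.
move=> sX sY sZ; apply: tangent_ext => f sf.
have sXY := smooth_bracket sX sY; have sYZ := smooth_bracket sY sZ.
have sXZ := smooth_bracket sX sZ.
have app (V : vfield M) h : smooth_vfield V -> smooth h -> smooth (fun q => V q h) by move=> sV; exact: sV.
have subE (V W1 W2 : vfield M) : smooth_vfield W1 -> smooth_vfield W2 ->
   V p (fun q => bracket W1 W2 q f) = V p (fun q => W1 q (fun q => W2 q f)) - V p (fun q => W2 q (fun q => W1 q f)).
  move=> s1 s2; rewrite -tangent_sub; [|exact: (app _ _ s1 (app _ _ s2 sf))|exact: (app _ _ s2 (app _ _ s1 sf))].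
  by congr (tangent_fun (V p) _); apply/funext => q; rewrite bracketE.
rewrite tangentBE !bracketE //; try exact: app.
by rewrite !subE //; ring.
Qed.

End BracketIdentities.

(** * Anti-quasi-Sasakian structures *)

Section AntiQuasiSasakian.
Context {R : realType} {m : nat} {M : manifold R m}.
Variables (phi : endo_field M) (xi : vfield M) (eta : covector_field M) (g : bilinear_field M).
Variable nabla : vfield M -> vfield M -> vfield M.
Arguments phi : clear implicits.
Arguments eta : clear implicits.
Arguments g : clear implicits.
Hypothesis acm : almost_contact_metric phi xi eta g.
Hypothesis LC : levi_civita g nabla.
Implicit Types (p q : M) (X Y Z W : vfield M) (f : M -> R).

Lemma acm_metric : riemannian_metric g.
Proof. by have [[_ _ _ H] _ _ _] := acm. Qed.
Let metric_g := acm_metric.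

Lemma phi_lin p (a : R) u v : phi p (a *: u + v) = a *: phi p u + phi p v.
Proof. by have [[[H _] _ _ _] _ _ _] := acm; exact: H. Qed.

Lemma phi_smooth X : smooth_vfield X -> smooth_vfield (endo_app phi X).
Proof. by have [[[_ H] _ _ _] _ _ _] := acm; exact: H. Qed.

Lemma xi_smooth : smooth_vfield xi.
Proof. by have [[_ H _ _] _ _ _] := acm. Qed.

Lemma eta_lin p (a : R) u v : eta p (a *: u + v) = a * eta p u + eta p v.
Proof. by have [[_ _ [H _] _] _ _ _] := acm; exact: H. Qed.

Lemma eta_smooth X : smooth_vfield X -> smooth (fun p => eta p (X p)).
Proof. by have [[_ _ [_ H] _] _ _ _] := acm; exact: H. Qed.

Lemma phi2 p v : phi p (phi p v) = - v + eta p v *: xi p.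
Proof. by have [_ H _ _] := acm; exact: H. Qed.

Lemma eta_xi p : eta p (xi p) = 1.
Proof. by have [_ _ H _] := acm; exact: H. Qed.

Lemma metric_phi p u v : g p (phi p u) (phi p v) = g p u v - eta p u * eta p v.
Proof. by have [_ _ _ H] := acm; exact: H. Qed.

Lemma phiD p u v : phi p (u + v) = phi p u + phi p v.
Proof. by rewrite -{1}[u]scale1r phi_lin scale1r. Qed.

Lemma phi0 p : phi p 0 = 0.
Proof. by apply: (addrI (phi p 0)); rewrite -phiD !addr0. Qed.

Lemma phiZ p (a : R) u : phi p (a *: u) = a *: phi p u.
Proof. by rewrite -[a *: u]addr0 phi_lin phi0 addr0. Qed.

Lemma phiN p u : phi p (- u) = - phi p u.
Proof. by rewrite -scaleN1r phiZ scaleN1r. Qed.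

Lemma phiB p u v : phi p (u - v) = phi p u - phi p v.
Proof. by rewrite phiD phiN. Qed.

Lemma etaD p u v : eta p (u + v) = eta p u + eta p v.
Proof. by rewrite -{1}[u]scale1r eta_lin mul1r. Qed.

Lemma eta0 p : eta p 0 = 0.
Proof. by apply: (addrI (eta p 0)); rewrite -etaD !addr0. Qed.

Lemma etaZ p (a : R) u : eta p (a *: u) = a * eta p u.
Proof. by rewrite -[a *: u]addr0 eta_lin eta0 addr0. Qed.

Lemma etaN p u : eta p (- u) = - eta p u.
Proof. by rewrite -scaleN1r etaZ mulN1r. Qed.

Lemma etaB p u v : eta p (u - v) = eta p u - eta p v.
Proof. by rewrite etaD etaN. Qed.

Lemma xi_neq0 p : xi p <> 0.
Proof. by move=> x0; have := eta_xi p; rewrite x0 eta0 => /eqP; rewrite eq_sym oner_eq0. Qed.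

(** As [phi^2] kills [xi], the identity for [phi^2] at [phi xi] gives [phi xi = c xi] with
    [c = eta (phi xi)]; then [0 = phi^2 xi = c phi xi]. *)
Lemma phi_xi p : phi p (xi p) = 0.
Proof.
have pp : phi p (phi p (xi p)) = 0 by rewrite phi2 eta_xi scale1r addNr.
have := phi2 (phi p (xi p)); rewrite pp phi0 => /esym/eqP.
rewrite addrC subr_eq0 => /eqP E.
have [e0|e0] := eqVneq (eta p (phi p (xi p))) 0; first by rewrite -E e0 scale0r.
have : eta p (phi p (xi p)) *: phi p (xi p) = 0 by rewrite -phiZ E.
by move/eqP; rewrite scaler_eq0 (negPf e0) => /eqP.
Qed.

(** Computing [phi^3 v] in two ways leaves [eta (phi v) xi = 0]. *)
Lemma eta_phi p v : eta p (phi p v) = 0.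
Proof.
have := phi2 (phi p v); rewrite {1}(phi2 v) phiD phiN phiZ phi_xi scaler0 addr0.
move=> /eqP; rewrite -subr_eq0 opprD addrA subrr add0r oppr_eq0 scaler_eq0.
by move=> /orP[/eqP//|/eqP/xi_neq0].
Qed.

Lemma metric_xi p v : g p v (xi p) = eta p v.
Proof.
have := metric_phi v (xi p); rewrite phi_xi metric0r // eta_xi mulr1.
by move=> /esym/eqP; rewrite subr_eq0 => /eqP.
Qed.

Lemma metric_phil p u v : g p (phi p u) v = - g p u (phi p v).
Proof.
have := metric_phi u (phi p v); rewrite eta_phi mulr0 subr0 phi2 metricDr // metricNr // metricZr //.
by rewrite metric_xi eta_phi mulr0 addr0 => <-; rewrite opprK.
Qed.

Definition Dphi X Y p : tangent p := nabla X (endo_app phi Y) p - phi p (nabla X Y p).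

(** This is [(nabla_v eta) (w)]. Its skew part [deta] is [d eta] as a form on single tangent
    vectors, whereas [d1] takes vector fields. *)
Definition Bxi p (v w : tangent p) : R := g p (nab nabla v xi) w.

Definition deta p (v w : tangent p) : R := 2^-1 * (Bxi v w - Bxi w v).

Lemma Bxi_linl p (a : R) (u v w : tangent p) : Bxi (a *: u + v) w = a * Bxi u w + Bxi v w.
Proof. by rewrite /Bxi (nab_lin LC) ?metric_linl //; exact: xi_smooth. Qed.

Lemma Bxi_linr p (a : R) (u v w : tangent p) : Bxi w (a *: u + v) = a * Bxi w u + Bxi w v.
Proof. by rewrite /Bxi metric_linr. Qed.

Lemma deta_linl p (a : R) (u v w : tangent p) : deta (a *: u + v) w = a * deta u w + deta v w.
Proof. by rewrite /deta Bxi_linl Bxi_linr; ring. Qed.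

Lemma deta0l p (w : tangent p) : deta (0 : tangent p) w = 0.
Proof. by have := deta_linl 1 0 0 w; rewrite scale1r addr0 mul1r; lra. Qed.

Lemma deta_skew p (u v : tangent p) : deta u v = - deta v u.
Proof. by rewrite /deta; ring. Qed.

Lemma deta_linr p (a : R) (u v w : tangent p) : deta w (a *: u + v) = a * deta w u + deta w v.
Proof. by rewrite !(deta_skew w) deta_linl; ring. Qed.

Lemma deta0r p (w : tangent p) : deta w (0 : tangent p) = 0.
Proof. by rewrite deta_skew deta0l oppr0. Qed.

Lemma nabla_xiE X Y p : smooth_vfield X -> g p (nabla X xi p) (Y p) = Bxi (X p) (Y p).
Proof. by move=> sX; rewrite /Bxi (nabE LC) //; exact: xi_smooth. Qed.

Lemma derive_eta X Y p : smooth_vfield X -> smooth_vfield Y ->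
  X p (fun q => eta q (Y q)) = eta p (nabla X Y p) + Bxi (X p) (Y p).
Proof.
move=> sX sY; have -> : (fun q => eta q (Y q)) = (fun q => g q (Y q) (xi q)).
  by apply/funext => q; rewrite metric_xi.
rewrite (nabla_metric LC) // ?metric_xi; last exact: xi_smooth.
by rewrite -nabla_xiE // (riemannian_sym metric_g (Y p)).
Qed.

Lemma d1E X Y p : smooth_vfield X -> smooth_vfield Y -> d1 eta X Y p = deta (X p) (Y p).
Proof.
move=> sX sY; rewrite /d1 !derive_eta // (nabla_torsion LC) // etaB /deta.
by congr (_ * _); ring.
Qed.

(** The covariant derivative of the skew-symmetry of [phi]. *)
Lemma Dphi_skew X Y Z p : smooth_vfield X -> smooth_vfield Y -> smooth_vfield Z ->
  g p (Dphi X Y p) (Z p) = - g p (Dphi X Z p) (Y p).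
Proof.
move=> sX sY sZ.
have e1 := nabla_metric LC p sX (phi_smooth sY) sZ.
have e2 := nabla_metric LC p sX sY (phi_smooth sZ).
have E : X p (fun q => g q (endo_app phi Y q) (Z q)) = - X p (fun q => g q (Y q) (endo_app phi Z q)).
  rewrite -tangent_opp; last by apply: (metric_smooth metric_g) => //; exact: phi_smooth.
  by congr (tangent_fun (X p) _); apply/funext => q; rewrite metric_phil.
move: E; rewrite e1 e2 /Dphi !metricBl // /endo_app !metric_phil.
by rewrite !(riemannian_sym metric_g (Y p)) metric_phil; lra.
Qed.

Lemma nabla0r X p : smooth_vfield X -> nabla X (fun q => 0) p = 0.
Proof.
move=> sX; have s0 : smooth_vfield (fun q : M => 0 : tangent q) by exact: smooth_vfield0.
have := nabla_linr LC p (@smooth_cst _ _ M 1) sX s0 s0; rewrite tangent_cst scale0r add0r scale1r.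
have -> : (fun q : M => (1 : R) *: (0 : tangent q) + 0) = (fun q => 0).
  by apply: functional_extensionality_dep => q; rewrite scaler0 addr0.
by move=> /eqP; rewrite -subr_eq subrr eq_sym => /eqP.
Qed.

(** The covariant derivative of [phi^2 = - id + eta (x) xi], paired with [w]. *)
Lemma Dphi_phi X Y p w : smooth_vfield X -> smooth_vfield Y ->
  g p (Dphi X (endo_app phi Y) p) w - g p (Dphi X Y p) (phi p w)
  = Bxi (X p) (Y p) * eta p w + eta p (Y p) * Bxi (X p) w.
Proof.
move=> sX sY; rewrite /Dphi.
have -> : endo_app phi (endo_app phi Y) = (fun q => eta q (Y q) *: xi q + ((-1) *: Y q + 0)).
  by apply: functional_extensionality_dep => q; rewrite /endo_app phi2 scaleN1r addr0 addrC.
have s0 : smooth_vfield (fun q : M => 0 : tangent q) by exact: smooth_vfield0.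
have s1 : smooth_vfield (fun q => (-1) *: Y q + 0).
  by apply: smooth_vfield_lin => //; exact: smooth_cst.
rewrite (nabla_linr LC p (eta_smooth sY) sX xi_smooth s1).
rewrite (nabla_linr LC p (@smooth_cst _ _ M (-1)) sX sY s0) tangent_cst scale0r add0r.
rewrite nabla0r //.
rewrite derive_eta // addr0 scaleN1r.
have N : nabla X xi p = nab nabla (X p) xi by rewrite (nabE LC) //; exact: xi_smooth.
rewrite !(metricDl, metricBl, metricNl, metricZl) // metric_phi metric_phil N.
rewrite (riemannian_sym metric_g (xi p)) metric_xi -/(Bxi (X p) w).
by ring.
Qed.

(** For a torsion-free connection the exterior derivative of [Phi] is, up to a constant, the cyclic
    sum of its covariant derivative. *)
Lemma Dphi_cyclic X Y Z p : closed_2form (fundamental_form g phi) ->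
  smooth_vfield X -> smooth_vfield Y -> smooth_vfield Z ->
  g p (Dphi X Y p) (Z p) + g p (Dphi Y Z p) (X p) + g p (Dphi Z X p) (Y p) = 0.
Proof.
move=> cl sX sY sZ; have := cl X Y Z p sX sY sZ; rewrite /d2 /fundamental_form => /eqP.
have n3 : (3 : R) != 0 by rewrite pnatr_eq0.
rewrite mulf_eq0 invr_eq0 (negPf n3) /= => /eqP.
have D V W U : smooth_vfield V -> smooth_vfield W -> smooth_vfield U ->
    V p (fun q => g q (W q) (phi q (U q))) =
    g p (nabla V W p) (phi p (U p)) + g p (W p) (phi p (nabla V U p)) - g p (Dphi V W p) (U p).
  move=> sV sW sU; rewrite (nabla_metric LC p sV sW (phi_smooth sU)).
  rewrite (Dphi_skew p sV sW sU) {1}/Dphi metricBl //.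
  rewrite (riemannian_sym metric_g (W p) (phi p _)) (riemannian_sym metric_g (W p) (nabla _ _ p)).
  by ring.
rewrite !D // !(nabla_torsion LC) // !metricBl // => E.
have sw (u v : tangent p) : g p u (phi p v) = - g p v (phi p u).
  by rewrite riemannian_sym // metric_phil.
move: E; rewrite (sw (Y p) (nabla X Z p)) (sw (Z p) (nabla Y X p)) (sw (X p) (nabla Z Y p)).
by move=> E; lra.
Qed.

(** Once the brackets are written through [nabla], the derivatives of [X] and [Y] themselves combine
    into derivatives of [phi]. *)
Lemma Dphi_nijenhuis X Y p w : smooth_vfield X -> smooth_vfield Y ->
  g p (Dphi (endo_app phi X) Y p) w - g p (Dphi (endo_app phi Y) X p) w
  + g p (Dphi X Y p) (phi p w) - g p (Dphi Y X p) (phi p w) = g p (nijenhuis phi X Y p) w.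
Proof.
move=> sX sY; have sfX := phi_smooth sX; have sfY := phi_smooth sY.
rewrite /nijenhuis !(nabla_torsion LC) // /Dphi !phiB.
rewrite !(metricDl, metricNl) // !metric_phil.
by ring.
Qed.

Lemma Dphi_xi X p w : smooth_vfield X -> g p (Dphi X xi p) w = Bxi (X p) (phi p w).
Proof.
move=> sX; rewrite /Dphi.
have -> : endo_app phi xi = (fun q => 0).
  by apply: functional_extensionality_dep => q; exact: phi_xi.
rewrite nabla0r // sub0r metricNl // metric_phil opprK.
by rewrite /Bxi (nabE LC) //; exact: xi_smooth.
Qed.

(** * Consequences of the torsion identity and of the closed fundamental form *)

Section ClosedForm.
Hypothesis N1E : forall X Y p, smooth_vfield X -> smooth_vfield Y ->
  N1 phi xi eta X Y p = (4 * d1 eta X Y p) *: xi p.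
Hypothesis dPhi : closed_2form (fundamental_form g phi).

Lemma nijenhuis_deta X Y p : smooth_vfield X -> smooth_vfield Y ->
  nijenhuis phi X Y p = (2 * deta (X p) (Y p)) *: xi p.
Proof.
move=> sX sY; have := N1E p sX sY; rewrite /N1 d1E // => /eqP.
rewrite -subr_eq0 -addrA -scalerBl addr_eq0 -scaleNr => /eqP ->.
by congr (_ *: _); ring.
Qed.

(** The [xi]-component of [N_phi] is [- 2 deta (phi u, phi v)], because [phi xi = 0]; the hypothesis
    on [N_phi] makes it [2 deta (u, v)]. *)
Lemma deta_phi p (u v : tangent p) : deta (phi p u) (phi p v) = - deta u v.
Proof.
have su := extend_smooth u; have sv := extend_smooth v.
have := Dphi_nijenhuis (xi p) su sv.
rewrite nijenhuis_deta // metricZl // (metric_xi (xi p)) eta_xi mulr1 phi_xi !metric0r // addr0 subr0.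
have sfu := phi_smooth su; have sfv := phi_smooth sv.
rewrite (Dphi_skew p sfu sv xi_smooth) (Dphi_skew p sfv su xi_smooth).
rewrite !Dphi_xi // /endo_app !extendE /deta.
by lra.
Qed.

Lemma deta_xi p (v : tangent p) : deta (xi p) v = 0.
Proof.
have := deta_phi (xi p) v; rewrite phi_xi deta0l.
by move/eqP; rewrite eq_sym oppr_eq0 => /eqP.
Qed.

Lemma deta_xir p (v : tangent p) : deta v (xi p) = 0.
Proof. by rewrite deta_skew deta_xi oppr0. Qed.

Lemma deta_phil p (u v : tangent p) : deta (phi p u) v = deta u (phi p v).
Proof.
have := deta_phi u (phi p v); rewrite phi2 addrC deta_linr deta_xir mulr0 add0r.
rewrite -scaleN1r -[(-1) *: v]addr0 deta_linr.
by rewrite deta0r addr0 mulN1r => /oppr_inj.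
Qed.

(* The classical formula for [nabla phi] on an almost contact metric manifold,
   with [N1 = 4 d eta (x) xi] and [d Phi = 0]. *)
Lemma DphiE X Y p w : smooth_vfield X -> smooth_vfield Y ->
  g p (Dphi X Y p) w = 2 * eta p (X p) * deta (phi p (Y p)) w
    + eta p w * deta (phi p (Y p)) (X p) - eta p (Y p) * deta (phi p w) (X p).
Proof.
move=> sX sY.
have [Z sZ <-] : exists2 Z, smooth_vfield Z & Z p = w.
  by exists (extend w); [exact: extend_smooth|exact: extendE].
have sfX := phi_smooth sX; have sfY := phi_smooth sY; have sfZ := phi_smooth sZ.
have fE (V : vfield M) : endo_app phi V p = phi p (V p) by [].
(* A Koszul-type elimination. The ingredients are the torsion identity for [Y], [Z] paired with
   [phi X], where its right-hand side dies since [eta] vanishes on the image of [phi], and the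
   cyclic identity for [(X, Y, Z)] and [(X, phi Y, phi Z)]; the other relations move [phi] between
   arguments. *)
have e1 : g p (Dphi (endo_app phi Y) Z p) (phi p (X p)) - g p (Dphi (endo_app phi Z) Y p) (phi p (X p))
  + g p (Dphi Y Z p) (phi p (phi p (X p))) - g p (Dphi Z Y p) (phi p (phi p (X p))) = 0.
  by rewrite Dphi_nijenhuis // nijenhuis_deta // metricZl // (riemannian_sym metric_g (xi p)) metric_xi eta_phi mulr0.
have e2 := Dphi_cyclic p dPhi sX sY sZ.
have e3 := Dphi_cyclic p dPhi sX sfY sfZ.
have e4 := Dphi_phi (X p) sfY sZ.
have e5 := Dphi_phi (X p) sfZ sY.
have e6 := Dphi_phi (phi p (Z p)) sX sY.
have s1 := Dphi_skew p sZ sY sX.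
have s2 := Dphi_skew p sfZ sfY sX.
have s3 := Dphi_skew p sY sZ xi_smooth; have s4 := Dphi_skew p sZ sY xi_smooth.
have s5 := Dphi_skew p sX sY xi_smooth.
have x1 := Dphi_xi (Z p) sY; have x2 := Dphi_xi (Y p) sZ; have x3 := Dphi_xi (Y p) sX.
have h1 : eta p (X p) * deta (phi p (Y p)) (Z p) = eta p (X p) * deta (Y p) (phi p (Z p)).
  by rewrite deta_phil.
move: e1 e2 e3 e4 e5 e6 s1 s2 h1; rewrite !fE !phi2 !metricDr ?metricNr ?metricZr // !eta_phi.
rewrite s3 s4 s5 x1 x2 x3 /deta => e1 e2 e3 e4 e5 e6 s1 s2 h1.
by lra.
Qed.


Definition deta_null p (v : tangent p) : Prop := forall w, deta v w = 0.

Definition parallel_null p (v : tangent p) : Prop :=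
  deta_null v /\ forall u w : tangent p, eta p v * deta u w = 0.

(** Each term of [DphiE] contains [deta] with [X p] or [w] inserted. The field [Y] stays arbitrary,
    which lets it serve as an ambient test field along a leaf. *)
Lemma Dphi_deta_null X Y p w : smooth_vfield X -> smooth_vfield Y ->
  deta_null (X p) -> deta_null w -> g p (Dphi X Y p) w = 0.
Proof.
move=> sX sY Xn wn; rewrite DphiE //.
by rewrite !(deta_skew (phi p _)) !Xn wn; ring.
Qed.

(** In [DphiE], the choice [Y = xi] paired with [phi w] leaves [deta (phi^2 w, X)], which gives the
    first condition; then [Y = phi u] leaves [eta (X) deta (u, w)] up to a constant. *)
Lemma parallelP X : smooth_vfield X ->
  parallel_along nabla phi X <-> forall p, parallel_null (X p).
Proof.
move=> sX; split=> [par p|nul Y p sY]; last first.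
  apply: (metric_nondeg metric_g) => w; rewrite -/(Dphi X Y p) DphiE //.
  have [n1 n2] := nul p.
  by rewrite !(deta_skew _ (X p)) !n1 -mulrA n2; ring.
have T0 Y w : smooth_vfield Y -> 2 * eta p (X p) * deta (phi p (Y p)) w
    + eta p w * deta (phi p (Y p)) (X p) - eta p (Y p) * deta (phi p w) (X p) = 0.
  by move=> sY; rewrite -DphiE // /Dphi par // metric0l.
have Xn : deta_null (X p).
  move=> w; have := T0 xi (phi p w) xi_smooth.
  rewrite phi_xi eta_phi eta_xi mul0r mul1r phi2 deta0l.
  rewrite mulr0 add0r sub0r addrC deta_linl deta_xi mulr0 add0r => /eqP.
  rewrite oppr_eq0 -scaleN1r -[_ *: w]addr0 deta_linl.
  by rewrite deta0l addr0 mulN1r oppr_eq0 deta_skew oppr_eq0 => /eqP.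
split=> // u w.
have := T0 (extend (phi p u)) w (extend_smooth _); rewrite extendE.
rewrite !(deta_skew _ (X p)) !Xn phi2 addrC; move=> E.
have {E} : 2 * eta p (X p) * deta (- u + eta p u *: xi p) w = 0 by lra.
rewrite addrC deta_linl deta_xi mulr0 add0r -scaleN1r -[_ *: u]addr0 deta_linl.
by rewrite deta0l => E; lra.
Qed.

Let H1 := parallel_distribution nabla phi.

Lemma parallel_distributionP p v : H1 v <->
  exists X, [/\ smooth_vfield X, forall q, parallel_null (X q) & X p = v].
Proof.
by split=> -[X [sX pX Xp]]; exists X; split=> //; apply/parallelP.
Qed.

Lemma parallel_distribution_null p v : H1 v -> @parallel_null p v.
Proof. by move=> /parallel_distributionP[X [_ nX <-]]. Qed.

(** The values of a section come from parallel fields that may differ from point to point. The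
    section itself is parallel because the criterion [parallel_null] is pointwise. *)
Lemma parallel_sectionP X : distribution_section H1 X <->
  smooth_vfield X /\ forall q, parallel_null (X q).
Proof.
split=> -[sX HX]; split=> // q; first exact: parallel_distribution_null.
by apply/parallel_distributionP; exists X.
Qed.

Lemma bracket_eta X Y p : smooth_vfield X -> smooth_vfield Y -> deta_null (X p) ->
  eta p (bracket X Y p) = X p (fun q => eta q (Y q)) - Y p (fun q => eta q (X q)).
Proof.
move=> sX sY Xn; have := d1E p sX sY; rewrite Xn /d1 => /eqP.
have n2 : (2 : R) != 0 by rewrite pnatr_eq0.
by rewrite mulf_eq0 invr_eq0 (negPf n2) /= subr_eq0 => /eqP.
Qed.

(** The Jacobi identity leaves only brackets with [X] or [Y] as an entry. On these [eta] is a
    difference of derivatives by [bracket_eta], and all terms cancel: this is [d (d eta) = 0]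
    written out. *)
Lemma bracket_deta_null X Y p : smooth_vfield X -> smooth_vfield Y ->
  (forall q, deta_null (X q)) -> (forall q, deta_null (Y q)) -> deta_null (bracket X Y p).
Proof.
move=> sX sY Xn Yn w; have [Z sZ <-] : exists2 Z, smooth_vfield Z & Z p = w.
  by exists (extend w); [exact: extend_smooth|exact: extendE].
have sXY := smooth_bracket sX sY; have sYZ := smooth_bracket sY sZ; have sXZ := smooth_bracket sX sZ.
rewrite -(d1E p sXY sZ) /d1.
have sE V : smooth_vfield V -> smooth (fun q => eta q (V q)) by exact: eta_smooth.
have eX V : smooth_vfield V -> (fun q => eta q (bracket X V q)) =
    (fun q => X q (fun q => eta q (V q)) - V q (fun q => eta q (X q))).
  by move=> sV; apply/funext => q; rewrite bracket_eta.
have eY V : smooth_vfield V -> (fun q => eta q (bracket Y V q)) =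
    (fun q => Y q (fun q => eta q (V q)) - V q (fun q => eta q (Y q))).
  by move=> sV; apply/funext => q; rewrite bracket_eta.
have sD V h : smooth_vfield V -> smooth h -> smooth (fun q => V q h) by move=> sV; exact: sV.
rewrite eX // bracketE //; last exact: sE.
rewrite tangent_sub; try by apply: sD => //; exact: sE.
rewrite bracket_jacobi // etaB !bracket_eta // eX // eY //.
rewrite !tangent_sub; try by apply: sD => //; exact: sE.
rewrite !bracketE //; try exact: sE.
by ring.
Qed.

(* If [f a = 0] then [X a] vanishes wherever [f] does not: multiply
   [a (X f) + f (X a) = 0] by [f]. *)
Lemma derive_annihilated X (a f : M -> R) p : smooth a -> smooth f ->
  (forall q, a q * f q = 0) -> X p a * f p = 0.
Proof.
move=> sa sf af; have := tangent_mul (X p) sa sf.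
have -> : (fun q => a q * f q) = fun=> 0 by apply/funext.
rewrite tangent_cst => E.
have : f p * (X p a * f p) = 0.
  have -> : f p * (X p a * f p) = f p * (a p * X p f + f p * X p a) - a p * f p * X p f by ring.
  by rewrite -E af mulr0 mul0r subr0.
by move/eqP; rewrite mulf_eq0 => /orP[/eqP ->|/eqP//]; rewrite mulr0.
Qed.

Lemma parallel_involutive : involutive_distribution H1.
Proof.
move=> X Y /parallel_sectionP[sX nX] /parallel_sectionP[sY nY]; apply/parallel_sectionP.
split=> [|q]; first exact: smooth_bracket.
split; first by apply: bracket_deta_null => // q'; [have [] := nX q'|have [] := nY q'].
move=> u w; rewrite bracket_eta //; last by have [] := nX q.
(* [eta [X, Y]] is a difference of derivatives of [eta (Y)] and [eta (X)], and each of these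
   functions annihilates [deta]. To differentiate such a product, the number [deta u w] is replaced
   by a smooth function with that value at [q]. *)
pose f q' := deta (extend u q') (extend w q').
have su := extend_smooth u; have sw := extend_smooth w.
have sf : smooth f.
  apply: (@smooth_eq _ _ M (d1 eta (extend u) (extend w))); last by move=> q'; rewrite d1E.
  rewrite /d1; apply: smoothM; first exact: smooth_cst.
  apply: smoothB; last by apply: eta_smooth; exact: smooth_bracket.
  by apply: smoothB; [apply: su; exact: eta_smooth|apply: sw; exact: eta_smooth].
have fq : f q = deta u w by rewrite /f !extendE.
rewrite -fq mulrBl !derive_annihilated ?subrr //; try exact: eta_smooth.
- by move=> q'; have [_] := nX q'; exact.
- by move=> q'; have [_] := nY q'; exact.
Qed.

Lemma line_plus_null p v : line_plus xi H1 v -> @deta_null p v.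
Proof.
move=> [a [w0 [/parallel_distribution_null[n _] ->]]] w.
by rewrite deta_linl deta_xi n mulr0 addr0.
Qed.

(** Removing the [xi]-component makes [eta] vanish, so both conditions of [parallel_null] hold. *)
Lemma parallel_component X : smooth_vfield X -> (forall q, deta_null (X q)) ->
  forall q, H1 (X q - eta q (X q) *: xi q).
Proof.
move=> sX nX q; apply/parallel_distributionP.
exists (fun q => X q - eta q (X q) *: xi q); split=> // [|q'].
  apply: smooth_vfield_add => //; apply: smooth_vfield_opp.
  by apply: smooth_vfield_scale xi_smooth; exact: eta_smooth.
split=> [w|u w].
  by rewrite addrC -scaleNr deta_linl deta_xi nX mulr0 addr0.
by rewrite etaB etaZ eta_xi mulr1 subrr mul0r.
Qed.

Lemma line_plus_sectionP X : distribution_section (line_plus xi H1) X <->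
  smooth_vfield X /\ forall q, deta_null (X q).
Proof.
split=> -[sX HX]; split=> // q; first exact: line_plus_null.
exists (eta q (X q)), (X q - eta q (X q) *: xi q); split; first exact: parallel_component.
by rewrite addrC subrK.
Qed.

Lemma line_plus_involutive : involutive_distribution (line_plus xi H1).
Proof.
move=> X Y /line_plus_sectionP[sX nX] /line_plus_sectionP[sY nY]; apply/line_plus_sectionP.
by split=> [|q]; [exact: smooth_bracket|exact: bracket_deta_null].
Qed.

Lemma parallel_phi p v : H1 v -> H1 (phi p v).
Proof.
move=> /parallel_distributionP[X [sX nX <-]]; apply/parallel_distributionP.
exists (endo_app phi X); split=> // [|q]; first exact: phi_smooth.
split=> [w|u w]; last by rewrite eta_phi mul0r.
by rewrite deta_phil; have [n _] := nX q.
Qed.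

Lemma line_plus_phi p v : line_plus xi H1 v -> line_plus xi H1 (phi p v).
Proof.
move=> [a [w [Hw ->]]]; exists 0, (phi p w); split; first exact: parallel_phi.
by rewrite phi_lin phi_xi scaler0 scale0r.
Qed.

Lemma line_plus_xi p : line_plus xi H1 (xi p).
Proof.
exists 1, 0; split; last by rewrite scale1r addr0.
apply/parallel_distributionP; exists (fun q => 0); split=> // [|q].
  exact: smooth_vfield0.
by split=> [w|u w]; rewrite ?deta0l // eta0 mul0r.
Qed.

Lemma deta0_cosymplectic : (forall q (u w : tangent q), deta u w = 0) ->
  cosymplectic phi xi eta g.
Proof.
move=> d0; split=> //; first by move=> X Y p sX sY; rewrite N1E // d1E // d0 mulr0 scale0r.
by split=> // X Y p sX sY; rewrite d1E.
Qed.

(* If [f = eta (W)] does not vanish at [p], then [f Y] is parallel for every [Y],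
   so that the distribution has full rank. *)
Lemma parallel_eta0 p v : constant_rank H1 -> ~ cosymplectic phi xi eta g ->
  H1 v -> eta p v = 0.
Proof.
move=> [r rk] ncos /parallel_distributionP[W [sW nW <-]].
apply: contra_notP ncos => /eqP f0; apply: deta0_cosymplectic.
have full (u : tangent p) : H1 u.
  apply/parallel_distributionP.
  have sY := extend_smooth ((eta p (W p))^-1 *: u).
  exists (fun q => eta q (W q) *: extend ((eta p (W p))^-1 *: u) q).
  split=> [|q|]; first by apply: smooth_vfield_scale => //; exact: eta_smooth.
    have [_ n2] := nW q; split=> [w|u' w].
      by rewrite -[_ *: _]addr0 deta_linl n2 add0r deta0l.
    by rewrite etaZ mulrAC n2 mul0r.
  by rewrite extendE scalerA divff // scale1r.
have mr := rank_eq_dim rk full.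
move=> q u w; have Hxi : H1 (xi q) by exact: (rank_full (xi q) rk mr).
by have [_ n2] := parallel_distribution_null Hxi; have := n2 u w; rewrite eta_xi mul1r.
Qed.

End ClosedForm.

End AntiQuasiSasakian.

(** * Leaves *)

Section SmoothOfMetric.
Context {R : realType} {k : nat} {N : manifold R k}.
Variable h : bilinear_field N.
Arguments h : clear implicits.
Hypothesis metric_h : riemannian_metric h.

Let gram q0 q : 'M[R]_k := \matrix_(b, c) h q (frame_field q0 b q) (frame_field q0 c q).

Lemma smooth_det (n : nat) (A : N -> 'M[R]_n) :
  (forall b c, smooth (fun q => A q b c)) -> smooth (fun q => \det (A q)).
Proof.
move=> sA; apply: smooth_sum => s; apply: smoothM; first exact: smooth_cst.
by apply: smooth_prod => b; exact: sA.
Qed.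

Lemma smooth_adj (n : nat) (A : N -> 'M[R]_n) b c :
  (forall b c, smooth (fun q => A q b c)) -> smooth (fun q => (\adj (A q)) b c).
Proof.
move=> sA; apply: (@smooth_eq _ _ N (fun q => cofactor (A q) c b)); last by move=> q; rewrite mxE.
apply: smoothM; first exact: smooth_cst.
apply: smooth_det => b' c'.
by apply: smooth_eq (sA (lift c b') (lift b c')) _ => q; rewrite !mxE.
Qed.

(** A kernel vector would give a combination of the frame of length zero at [q0], where the dual
    forms show the frame to be independent. *)
Lemma gram_det_neq0 q0 : \det (gram q0 q0) != 0.
Proof.
apply/negP => /det0P[t t0 tG].
have S0 : \sum_b t 0 b *: frame_field q0 b q0 = 0.
  apply: (metric_eq0 metric_h); rewrite (metric_sumr metric_h); apply: big1 => c _.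
  rewrite (metricZr metric_h) (metric_suml metric_h).
  have := congr1 (fun A : 'rV[R]_k => A 0 c) tG; rewrite !mxE => E.
  rewrite (_ : \sum_b _ = 0) ?mulr0 // -[RHS]E; apply: eq_bigr => b _.
  by rewrite (metricZl metric_h) mxE.
move/negP: t0; apply; apply/eqP/rowP => c; rewrite [RHS]mxE.
have th0 : theta q0 c (0 : tangent q0) = 0.
  by rewrite /theta /coord_form !tangent0E !mulr0 subrr.
rewrite -[RHS]th0 -S0.
have -> : theta q0 c (\sum_b t 0 b *: frame_field q0 b q0) =
    \sum_b t 0 b * theta q0 c (frame_field q0 b q0).
  by elim: (index_enum _) => [|b s IH]; rewrite ?big_nil ?th0 // !big_cons theta_lin IH.
rewrite (bigD1 c) //= theta_dual eqxx mulr1 big1 ?addr0 // => b bc.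
by rewrite theta_dual eq_sym (negPf bc) mulr0.
Qed.

(* In a local frame the components of [v] are recovered from the products
   [h (v, E_c)] by Cramer's rule applied to the Gram matrix. *)
Lemma smooth_vfield_of_metric (v : vfield N) :
  (forall W, smooth_vfield W -> smooth (fun q => h q (v q) (W q))) -> smooth_vfield v.
Proof.
move=> sv f sf; apply: smooth_div_local => q0.
have sE b := @frame_field_smooth _ _ N q0 b.
have sG b c : smooth (fun q => gram q0 q b c).
  apply: (@smooth_eq _ _ N (fun q => h q (frame_field q0 b q) (frame_field q0 c q))).
    by apply: (metric_smooth metric_h).
  by move=> q; rewrite mxE.
exists (fun q => \det (gram q0 q) * rho q0 q).
  split; first by apply: smoothM; [exact: smooth_det|exact: rho_smooth].
  by rewrite rho1 mulr1 gram_det_neq0.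
pose s q : 'rV[R]_k := \row_c (rho q0 q * h q (v q) (frame_field q0 c q)).
have ss c : smooth (fun q => s q 0 c).
  apply: (@smooth_eq _ _ N (fun q => rho q0 q * h q (v q) (frame_field q0 c q))).
    by apply: smoothM; [exact: rho_smooth|exact: sv].
  by move=> q; rewrite mxE.
apply: (@smooth_eq _ _ N (fun q => \sum_b (\sum_c s q 0 c * (\adj (gram q0 q)) c b) * frame_field q0 b q f)).
  apply: smooth_sum => b; apply: smoothM; last exact: sE.
  by apply: smooth_sum => c; apply: smoothM => //; exact: smooth_adj.
move=> q; pose t : 'rV[R]_k := \row_b theta q0 b (v q).
have st : s q = t *m gram q0 q.
  apply/rowP => c; rewrite !mxE -(metricZl metric_h) rho_expand (metric_suml metric_h).
  by apply: eq_bigr => b _; rewrite !mxE (metricZl metric_h).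
have sadj b : \sum_c s q 0 c * (\adj (gram q0 q)) c b = t 0 b * \det (gram q0 q).
  have : (s q *m \adj (gram q0 q)) 0 b = t 0 b * \det (gram q0 q).
    by rewrite st -mulmxA mul_mx_adj mul_mx_scalar mxE mulrC.
  by rewrite mxE.
under eq_bigr => b _ do rewrite sadj mxE.
rewrite -mulrA -tangentZE rho_expand tangent_sumE mulr_sumr; apply: eq_bigr => b _.
by rewrite tangentZE; ring.
Qed.

End SmoothOfMetric.

(** * The connection along an immersion *)

Section PullbackConnection.
Context {R : realType} {k m : nat} {N : manifold R k} {M : manifold R m}.
Variable i : N -> M.
Hypothesis smooth_i : smooth_map i.

Lemma smooth_pullback (f : M -> R) : smooth f -> smooth (f \o i).
Proof.
move=> sf c ac; apply: smooth_on_local => x cx.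
have [ci si] := smooth_i.
have [d ad dp] := atlas_cover (i (cinv c x)).
have oi : open (i @^-1` cdom d).
  by apply: open_comp; [move=> q _; exact: ci|exact: cdom_open].
exists (cmap c @` (cdom c `&` i @^-1` cdom d)).
  by exists (cinv c x); [split=> //; exact: cinv_cdom|exact: cinvK].
have oV := @open_cmap_image _ _ _ c _ oi.
apply: (@smooth_on_eq _ _ _ ((f \o cinv d) \o (fun x => cmap d (i (cinv c x))))) => //.
  by move=> y [q [cq dq] <-] /=; rewrite cmapK // cmapK.
apply: (smooth_on_comp oV (@cimg_open _ _ _ d)) (sf d ad).
  by move=> y [q [cq dq] <-]; rewrite cmapK //; exists (i q).
by move=> j; exact: si.
Qed.

Notation di := (@differential R k m N M i _).

Lemma differentialE q (v : tangent q) (f : M -> R) : smooth f -> di v f = v (f \o i).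
Proof.
apply: to_tangentE => [a f1 f2 s1 s2|f1 f2 s1 s2].
  exact: (tangent_lin v a (smooth_pullback s1) (smooth_pullback s2)).
exact: (tangent_mul v (smooth_pullback s1) (smooth_pullback s2)).
Qed.

Lemma differential_lin q (a : R) (u v : tangent q) : di (a *: u + v) = a *: di u + di v.
Proof.
by apply: tangent_ext => f sf; rewrite tangentZDE !differentialE.
Qed.

Definition smooth_along (V : forall q : N, tangent (i q)) : Prop :=
  forall f : M -> R, smooth f -> smooth (fun q => V q f).

Implicit Types V W : forall q : N, tangent (i q).

Lemma smooth_along_differential (X : vfield N) : smooth_vfield X ->
  smooth_along (fun q => di (X q)).
Proof.
move=> sX f sf; apply: (smooth_eq (sX _ (smooth_pullback sf))) => q.
by rewrite differentialE.
Qed.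

Lemma smooth_along_field (Z : vfield M) : smooth_vfield Z -> smooth_along (fun q => Z (i q)).
Proof. by move=> sZ f sf; exact: (smooth_pullback (sZ f sf)). Qed.

Lemma theta_along p a V : smooth_along V -> smooth (fun q => theta p a (V q)).
Proof.
move=> sV; apply: smoothB; apply: smoothM.
- exact: (smooth_pullback (fr_u_smooth (frame p))).
- by apply: sV; exact: fr_w_smooth.
- exact: (smooth_pullback (fr_w_smooth (frame p) a)).
- by apply: sV; exact: fr_u_smooth.
Qed.

Variables (g : bilinear_field M) (nabla : vfield M -> vfield M -> vfield M).
Arguments g : clear implicits.
Hypothesis metric_g : riemannian_metric g.
Hypothesis LC : levi_civita g nabla.

Lemma metric_expandl p q V (w : tangent (i q)) :
  rho p (i q) * g (i q) (V q) w = \sum_a theta p a (V q) * g (i q) (frame_field p a (i q)) w.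
Proof.
rewrite -(metricZl metric_g) rho_expand (metric_suml metric_g).
by apply: eq_bigr => a _; rewrite (metricZl metric_g).
Qed.

Lemma metric_along_field V (Z : vfield M) : smooth_along V -> smooth_vfield Z ->
  smooth (fun q => g (i q) (V q) (Z (i q))).
Proof.
move=> sV sZ; apply: smooth_div_local => q0; exists (rho (i q0) \o i).
  by split; [exact/smooth_pullback/rho_smooth|rewrite /= rho1 oner_eq0].
apply: (@smooth_eq _ _ N (fun q => \sum_a theta (i q0) a (V q) *
    ((fun p => g p (frame_field (i q0) a p) (Z p)) \o i) q)).
  apply: smooth_sum => a; apply: smoothM; first exact: theta_along.
  apply: smooth_pullback; apply: (metric_smooth metric_g) => //; exact: frame_field_smooth.
by move=> q; rewrite -(metric_expandl (i q0) V).
Qed.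

Lemma metric_along V W : smooth_along V -> smooth_along W ->
  smooth (fun q => g (i q) (V q) (W q)).
Proof.
move=> sV sW; apply: smooth_div_local => q0; exists (rho (i q0) \o i).
  by split; [exact/smooth_pullback/rho_smooth|rewrite /= rho1 oner_eq0].
apply: (@smooth_eq _ _ N (fun q => \sum_a theta (i q0) a (V q) *
    g (i q) (W q) (frame_field (i q0) a (i q)))).
  apply: smooth_sum => a; apply: smoothM; first exact: theta_along.
  by apply: metric_along_field => //; exact: frame_field_smooth.
move=> q; rewrite /= (metric_expandl (i q0) V); apply: eq_bigr => a _.
by rewrite (riemannian_sym metric_g (W q)).
Qed.

(** [smooth_endo] only concerns fields on [M]; expansion in an ambient frame carries it over to
    fields along [i]. *)
Lemma endo_along (phi : endo_field M) V : smooth_endo phi -> smooth_along V ->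
  smooth_along (fun q => phi (i q) (V q)).
Proof.
move=> [phi_lin phi_smooth] sV f sf; apply: smooth_div_local => q0; exists (rho (i q0) \o i).
  by split; [exact/smooth_pullback/rho_smooth|rewrite /= rho1 oner_eq0].
pose E a : vfield M := endo_app phi (frame_field (i q0) a).
apply: (@smooth_eq _ _ N (fun q => \sum_a theta (i q0) a (V q) * ((fun p => E a p f) \o i) q)).
  apply: smooth_sum => a; apply: smoothM; first exact: theta_along.
  by apply: smooth_pullback; apply: (phi_smooth _ _ f sf); exact: frame_field_smooth.
move=> q; rewrite /= -tangentZE.
have phi0 p : phi p 0 = 0.
  by have := phi_lin p 1 0 0; rewrite !scale1r addr0 => /eqP; rewrite -subr_eq subrr eq_sym => /eqP.
have -> : rho (i q0) (i q) *: phi (i q) (V q) = phi (i q) (rho (i q0) (i q) *: V q).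
  by have := phi_lin (i q) (rho (i q0) (i q)) (V q) 0; rewrite phi0 !addr0.
rewrite rho_expand.
have -> : phi (i q) (\sum_a theta (i q0) a (V q) *: frame_field (i q0) a (i q)) =
    \sum_a theta (i q0) a (V q) *: E a (i q).
  by elim: (index_enum _) => [|a s IH]; rewrite ?big_nil ?phi0 // !big_cons phi_lin IH.
by rewrite tangent_sumE.
Qed.

Lemma frame_metric_expand q V (w : tangent (i q)) :
  g (i q) (V q) w = \sum_a theta (i q) a (V q) * g (i q) (frame_field (i q) a (i q)) w.
Proof. by rewrite -metric_expandl rho1 mul1r. Qed.

(* The Levi-Civita connection pulled back along [i]. It differentiates vector
   fields along [i], so that fields on the leaf need not be extended to [M]
   (which would require the inverse function theorem). *)
Definition cov q (x : tangent q) V : tangent (i q) :=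
  \sum_a (x (fun q' => theta (i q) a (V q')) *: frame_field (i q) a (i q)
          + theta (i q) a (V q) *: nab nabla (di x) (frame_field (i q) a))
  - x (rho (i q) \o i) *: V q.

Lemma cov_app q (x : tangent q) V (f : M -> R) :
  cov x V f = \sum_a (x (fun q' => theta (i q) a (V q')) * frame_field (i q) a (i q) f
          + theta (i q) a (V q) * nab nabla (di x) (frame_field (i q) a) f)
  - x (rho (i q) \o i) * V q f.
Proof.
pose S : tangent (i q) := \sum_a (x (fun q' => theta (i q) a (V q')) *: frame_field (i q) a (i q)
          + theta (i q) a (V q) *: nab nabla (di x) (frame_field (i q) a)).
transitivity (S f - x (rho (i q) \o i) * V q f); first by [].
by rewrite tangent_sumE; congr (_ - _); apply: eq_bigr.
Qed.

Lemma metric_cov_l q (x : tangent q) V (w : tangent (i q)) :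
  g (i q) (cov x V) w = \sum_a (x (fun q' => theta (i q) a (V q')) * g (i q) (frame_field (i q) a (i q)) w
          + theta (i q) a (V q) * g (i q) (nab nabla (di x) (frame_field (i q) a)) w)
  - x (rho (i q) \o i) * g (i q) (V q) w.
Proof.
rewrite /cov (metricBl metric_g) (metric_suml metric_g) (metricZl metric_g); congr (_ - _).
by apply: eq_bigr => a _; rewrite (metricDl metric_g) !(metricZl metric_g).
Qed.

Lemma nab_metric p (v : tangent p) (Y Z : vfield M) : smooth_vfield Y -> smooth_vfield Z ->
  v (fun q => g q (Y q) (Z q)) = g p (nab nabla v Y) (Z p) + g p (Y p) (nab nabla v Z).
Proof.
move=> sY sZ; rewrite -{1}(extendE v) (nabla_metric LC) //; exact: extend_smooth.
Qed.

Lemma cov_field q (x : tangent q) V (Z : vfield M) : smooth_along V -> smooth_vfield Z ->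
  x (fun q' => g (i q') (V q') (Z (i q'))) =
    g (i q) (cov x V) (Z (i q)) + g (i q) (V q) (nab nabla (di x) Z).
Proof.
move=> sV sZ; have sE a := @frame_field_smooth _ _ M (i q) a.
pose h a p := g p (frame_field (i q) a p) (Z p).
have sh a : smooth (h a) by apply: (metric_smooth metric_g).
have srho : smooth (rho (i q) \o i) by exact/smooth_pullback/rho_smooth.
have sth a := theta_along (i q) a sV.
have E : (fun q' => (rho (i q) \o i) q' * g (i q') (V q') (Z (i q'))) =
    (fun q' => \sum_a theta (i q) a (V q') * (h a \o i) q').
  by apply/funext => q'; rewrite /= metric_expandl.
have := congr1 (fun f => x f) E; rewrite (tangent_mul x srho (metric_along_field sV sZ)).
rewrite /= rho1 mul1r tangent_sum; last by move=> a; apply: smoothM => //; exact: smooth_pullback.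
move=> /(canRL (addrK _)) ->.
rewrite metric_cov_l (frame_metric_expand V (nab _ _ _)) addrAC -big_split /= mulrC.
congr (_ - _); apply: eq_bigr => a _.
rewrite (tangent_mul x (sth a) (smooth_pullback (sh a))) -(differentialE x (sh a)) nab_metric //.
by rewrite /= /h; ring.
Qed.

(** Every vector at [i q] is the value of an ambient field, so [cov_field] characterizes [cov]
    independently of the frame in its definition. *)
Lemma cov_unique q (x : tangent q) V (D : tangent (i q)) : smooth_along V ->
  (forall Z, smooth_vfield Z -> x (fun q' => g (i q') (V q') (Z (i q'))) =
    g (i q) D (Z (i q)) + g (i q) (V q) (nab nabla (di x) Z)) ->
  cov x V = D.
Proof.
move=> sV H; apply: (metric_inj metric_g) => w.
have sw := extend_smooth w; have := H _ sw; rewrite (cov_field x sV sw) extendE.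
by move/addIr.
Qed.

Lemma cov_metric q (x : tangent q) V W : smooth_along V -> smooth_along W ->
  x (fun q' => g (i q') (V q') (W q')) =
    g (i q) (cov x V) (W q) + g (i q) (V q) (cov x W).
Proof.
move=> sV sW; have sE a := @frame_field_smooth _ _ M (i q) a.
have srho : smooth (rho (i q) \o i) by exact/smooth_pullback/rho_smooth.
have sth a := theta_along (i q) a sW.
have sVE a := metric_along_field sV (sE a).
have E : (fun q' => (rho (i q) \o i) q' * g (i q') (V q') (W q')) =
    (fun q' => \sum_a theta (i q) a (W q') * g (i q') (V q') (frame_field (i q) a (i q'))).
  apply/funext => q'; rewrite /= (riemannian_sym metric_g (V q')) metric_expandl.
  by apply: eq_bigr => a _; rewrite (riemannian_sym metric_g (V q')).
have := congr1 (fun f => x f) E; rewrite (tangent_mul x srho (metric_along sV sW)).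
rewrite /= rho1 mul1r tangent_sum; last by move=> a; exact: smoothM.
move=> /(canRL (addrK _)) ->.
rewrite (riemannian_sym metric_g (V q) (cov x W)) (metric_cov_l x W).
rewrite (riemannian_sym metric_g (cov x V)) (frame_metric_expand W (cov x V)).
rewrite addrA -big_split /= [X in _ = _ - X]mulrC (riemannian_sym metric_g (W q)).
congr (_ - _); apply: eq_bigr => a _.
rewrite (tangent_mul x (sth a) (sVE a)) cov_field //.
rewrite (riemannian_sym metric_g (cov x V)) (riemannian_sym metric_g (V q) (frame_field _ _ _)).
rewrite (riemannian_sym metric_g (V q) (nab _ _ _)).
by ring.
Qed.

Lemma nabla_cst_sumr (X : vfield M) (c : 'I_m -> R) (E : 'I_m -> vfield M) p :
  smooth_vfield X -> (forall a, smooth_vfield (E a)) ->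
  nabla X (fun q => \sum_a c a *: E a q) p = \sum_a c a *: nabla X (E a) p.
Proof.
move=> sX sE; elim: (index_enum _) => [|a s IH].
  rewrite big_nil -[RHS](nabla0r LC p sX); congr (nabla X _ p).
  by apply: functional_extensionality_dep => q; rewrite big_nil.
have ss : smooth_vfield (fun q => \sum_(a <- s) c a *: E a q).
  by apply: smooth_vfield_sum => b; apply: smooth_vfield_scale => //; exact: smooth_cst.
have := nabla_linr LC p (@smooth_cst _ _ M (c a)) sX (sE a) ss.
rewrite tangent_cst scale0r add0r big_cons -IH => <-; congr (nabla X _ p).
by apply: functional_extensionality_dep => q; rewrite big_cons.
Qed.

Lemma extend_app p (v : tangent p) (f : M -> R) :
  (fun q => extend v q f) = (fun q => \sum_a theta p a v * frame_field p a q f).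
Proof. by apply/funext => q; rewrite /extend tangent_sumE. Qed.

(** Torsion-freeness of [nabla] for [extend u] and [extend v], expanded in their constant
    coefficients. *)
Lemma frame_torsion p (u v : tangent p) (f : M -> R) : smooth f ->
  \sum_a theta p a v * nab nabla u (frame_field p a) f - \sum_a theta p a u * nab nabla v (frame_field p a) f
  = \sum_a theta p a v * u (fun q => frame_field p a q f) - \sum_a theta p a u * v (fun q => frame_field p a q f).
Proof.
move=> sf; have su := extend_smooth u; have sv := extend_smooth v.
have sE a := @frame_field_smooth _ _ M p a.
have nE (x y : tangent p) : nabla (extend x) (extend y) p f = \sum_a theta p a y * nab nabla x (frame_field p a) f.
  rewrite (nabla_cst_sumr (fun a => theta p a y) p (extend_smooth x) sE) tangent_sumE.
  by apply: eq_bigr => a _; rewrite tangentZE.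
have eE (x y : tangent p) : x (fun q => extend y q f) = \sum_a theta p a y * x (fun q => frame_field p a q f).
  rewrite extend_app tangent_sum; last by move=> a; apply: smoothM; [exact: smooth_cst|exact: sE].
  by apply: eq_bigr => a _; rewrite tangent_scale //; exact: sE.
rewrite -!nE -!eE -tangentBE -(nabla_torsion LC) // bracketE //.
by rewrite !extendE.
Qed.

(** Expanding [Y (f \o i)] in the ambient frame before applying [X] yields the coefficient terms of
    [cov] and derivatives of the frame fields; antisymmetrized, the latter are converted by
    [frame_torsion]. *)
Lemma cov_torsion (X Y : vfield N) q : smooth_vfield X -> smooth_vfield Y ->
  cov (X q) (fun q' => di (Y q')) - cov (Y q) (fun q' => di (X q')) = di (bracket X Y q).
Proof.
move=> sX sY; apply: tangent_ext => f sf.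
have sE a := @frame_field_smooth _ _ M (i q) a.
have srho : smooth (rho (i q) \o i) by exact/smooth_pullback/rho_smooth.
have sfi := smooth_pullback sf.
have covE (U V : vfield N) : smooth_vfield U -> smooth_vfield V ->
   U q (fun q' => V q' (f \o i)) - \sum_a theta (i q) a (di (V q)) * di (U q) (fun p => frame_field (i q) a p f)
   = cov (U q) (fun q' => di (V q')) f
     - \sum_a theta (i q) a (di (V q)) * nab nabla (di (U q)) (frame_field (i q) a) f.
  move=> sU sV; rewrite cov_app differentialE //; have sdV := smooth_along_differential sV.
  have sth a := theta_along (i q) a sdV.
  have E : (fun q' => (rho (i q) \o i) q' * V q' (f \o i)) =
      (fun q' => \sum_a theta (i q) a (di (V q')) * ((fun p => frame_field (i q) a p f) \o i) q').
    apply/funext => q'; rewrite /= -(differentialE _ sf) -tangentZE rho_expand tangent_sumE.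
    by apply: eq_bigr => a _; rewrite tangentZE.
  have := congr1 (fun h => U q h) E; rewrite (tangent_mul (U q) srho); last exact: sV.
  rewrite /= rho1 mul1r tangent_sum; last by move=> a; apply: smoothM => //; exact: (smooth_pullback (sE a f sf)).
  move=> /(canRL (addrK _)) ->.
  rewrite addrAC [RHS]addrAC -!sumrB [X in _ - X]mulrC; congr (_ - _); apply: eq_bigr => a _.
  rewrite (tangent_mul (U q) (sth a) (smooth_pullback (sE a f sf))).
  rewrite (differentialE (U q) (sE a f sf)) /=.
  by ring.
rewrite tangentBE differentialE // bracketE //.
have := covE X Y sX sY; have := covE Y X sY sX.
have := frame_torsion (di (X q)) (di (Y q)) sf.
set s1 := \sum_a _ * nab _ _ _ _; set s2 := \sum_a _ * nab _ _ _ _.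
by move=> e1 e2 e3; lra.
Qed.


End PullbackConnection.

(** * Integral submanifolds of a [phi]-invariant distribution in the kernel of [d eta] *)

Section AdaptedLeaf.
Context {R : realType} {k m : nat} {N : manifold R k} {M : manifold R m}.
Variables (phi : endo_field M) (xi : vfield M) (eta : covector_field M) (g : bilinear_field M).
Variable nabla : vfield M -> vfield M -> vfield M.
Arguments phi : clear implicits.
Arguments eta : clear implicits.
Arguments g : clear implicits.
Hypothesis aqS : anti_quasi_sasakian phi xi eta g.
Hypothesis LC : levi_civita g nabla.
Variables (D : Defs.distribution M) (i : N -> M).
Arguments D : clear implicits.
Hypothesis integral : integral_submanifold D i.
Hypothesis D_null : forall p v, D p v -> deta_null xi g nabla v.
Hypothesis D_phi : forall p v, D p v -> D p (phi p v).

Let acm : almost_contact_metric phi xi eta g. Proof. by have [] := aqS. Qed.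
Let metric_g := acm_metric acm.
Let smooth_i : smooth_map i. Proof. by have [] := integral. Qed.
Notation di := (@differential R k m N M i _).
Notation g' := (pullback_metric i g).
Notation cov := (cov nabla).

Let di_inj q : injective (@differential R k m N M i q).
Proof. by have [_ _ H _] := integral; exact: H. Qed.

Let diD q (v : tangent q) : D (i q) (di v).
Proof. by have [_ _ _ H] := integral; apply/H; exists v. Qed.

Let di_lin q (a : R) (u v : tangent q) : di (a *: u + v) = a *: di u + di v.
Proof. exact: differential_lin. Qed.

Let diDr q (u v : tangent q) : di (u + v) = di u + di v.
Proof. by rewrite -{1}[u]scale1r di_lin scale1r. Qed.

Let di0 q : di (0 : tangent q) = 0.
Proof. by apply: (addrI (di (0 : tangent q))); rewrite -diDr !addr0. Qed.

Let diZ q (a : R) (u : tangent q) : di (a *: u) = a *: di u.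
Proof. by rewrite -[a *: u]addr0 di_lin di0 addr0. Qed.

Let diN q (u : tangent q) : di (- u) = - di u.
Proof. by rewrite -scaleN1r diZ scaleN1r. Qed.

Lemma leaf_endo_exists q (v : tangent q) : {u : tangent q | di u = phi (i q) (di v)}.
Proof. by apply: cid; have [_ _ _ H] := integral; apply/H; apply: D_phi; exact: diD. Qed.

Definition leaf_endo q (v : tangent q) : tangent q := sval (leaf_endo_exists v).
Notation J := leaf_endo.

Lemma di_leaf_endo q (v : tangent q) : di (J v) = phi (i q) (di v).
Proof. exact: svalP (leaf_endo_exists v). Qed.

Lemma leaf_metric : riemannian_metric g'.
Proof.
split=> [q a u v w|q u v|q u u0|X Y sX sY]; rewrite /pullback_metric.
- by rewrite di_lin (metric_linl metric_g).
- exact: riemannian_sym.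
- have [_ _ H _] := metric_g; apply: H; apply: contra_neq u0 => du0.
  by apply: (@di_inj q); rewrite du0 di0.
apply: (metric_along smooth_i metric_g); exact: smooth_along_differential.
Qed.

Lemma leaf_phi_along (X : vfield N) : smooth_vfield X ->
  smooth_along (fun q => phi (i q) (di (X q))).
Proof.
move=> sX; apply: endo_along => //; first by have [[]] := acm.
exact: smooth_along_differential.
Qed.

(** [J] is obtained pointwise from injectivity of the differential. Its smoothness is tested with
    [smooth_vfield_of_metric]: the products with fields of the leaf equal products of smooth fields
    along [i]. *)
Lemma leaf_endo_smooth : smooth_endo J.
Proof.
split=> [q a u v|X sX].
  by apply: (@di_inj q); rewrite di_leaf_endo !di_lin !di_leaf_endo (phi_lin acm).
apply: (smooth_vfield_of_metric leaf_metric) => W sW.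
apply: (@smooth_eq _ _ N (fun q => g (i q) (phi (i q) (di (X q))) (di (W q)))).
  apply: (metric_along smooth_i metric_g); first exact: leaf_phi_along.
  exact: smooth_along_differential.
by move=> q; rewrite /pullback_metric /endo_app di_leaf_endo.
Qed.

(** Paired with an ambient field [Z], the difference of the two sides is, by skew-symmetry,
    [- g ((nabla_x phi) Z, Y)], which is zero because [x] and [Y] are both in the kernel of
    [d eta]. *)
Lemma leaf_cov_phi (Y : vfield N) q (x : tangent q) : smooth_vfield Y ->
  cov x (fun q' => di (endo_app J Y q')) = phi (i q) (cov x (fun q' => di (Y q'))).
Proof.
move=> sY; have sdY := smooth_along_differential smooth_i sY.
have -> : (fun q' => di (endo_app J Y q')) = (fun q' => phi (i q') (di (Y q'))).
  by apply: functional_extensionality_dep => q'; rewrite di_leaf_endo.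
apply: (cov_unique smooth_i metric_g LC); first exact: leaf_phi_along.
move=> Z sZ; have sfZ := phi_smooth acm sZ.
have -> : (fun q' => g (i q') (phi (i q') (di (Y q'))) (Z (i q'))) =
    (fun q' => - g (i q') (di (Y q')) (endo_app phi Z (i q'))).
  by apply/funext => q'; rewrite (metric_phil acm).
rewrite tangent_opp; last exact: (metric_along_field smooth_i metric_g).
rewrite (cov_field smooth_i metric_g LC x sdY sfZ) !(metric_phil acm).
have sx := extend_smooth (di x).
have := @Dphi_deta_null _ _ _ _ _ _ _ _ acm LC.
have [_ N1E dPhi] := aqS.
move=> /(_ N1E dPhi (extend (di x)) Z (i q) (di (Y q)) sx sZ).
rewrite extendE => /(_ (D_null (diD x)) (D_null (diD (Y q)))).
rewrite /Dphi (metricBl metric_g) !(nabE LC _ sx) // extendE (metric_phil acm) => E.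
rewrite (riemannian_sym metric_g (di (Y q)) (nab _ _ (endo_app phi Z))).
rewrite (riemannian_sym metric_g (di (Y q)) (phi _ _)) (metric_phil acm).
rewrite /endo_app in E *; lra.
Qed.

(** After the injective differential is applied, brackets become differences of [cov], which
    commutes with [phi], and the terms cancel in pairs. *)
Lemma leaf_nijenhuis (X Y : vfield N) q : smooth_vfield X -> smooth_vfield Y ->
  nijenhuis J X Y q = 0.
Proof.
move=> sX sY; have sJX := (leaf_endo_smooth.2 _ sX); have sJY := (leaf_endo_smooth.2 _ sY).
apply: (@di_inj q); rewrite di0 /nijenhuis !diDr !diN !di_leaf_endo.
have tor (U V : vfield N) : smooth_vfield U -> smooth_vfield V -> di (bracket U V q) =
    cov (U q) (fun q' => di (V q')) - cov (V q) (fun q' => di (U q')).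
  by move=> sU sV; rewrite (cov_torsion smooth_i LC).
rewrite !tor // !leaf_cov_phi // !(phiB acm).
by rewrite !opprB !addrA; apply: tangent_ext => f sf; rewrite !(tangentDE, tangentNE) tangent0E; ring.
Qed.

(** As [cov] is metric and commutes with [phi], differentiating the form only differentiates its
    arguments, and the bracket terms cancel the result. *)
Lemma leaf_closed_2form : closed_2form (fundamental_form g' J).
Proof.
move=> X Y Z q sX sY sZ.
have Dm (U V W : vfield N) : smooth_vfield U -> smooth_vfield V -> smooth_vfield W ->
    U q (fun q' => fundamental_form g' J (V q') (W q')) =
    g (i q) (cov (U q) (fun q' => di (V q'))) (phi (i q) (di (W q)))
    - g (i q) (cov (U q) (fun q' => di (W q'))) (phi (i q) (di (V q))).
  move=> sU sV sW.
  have -> : (fun q' => fundamental_form g' J (V q') (W q')) =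
      (fun q' => g (i q') (di (V q')) (di (endo_app J W q'))) by [].
  have sJW := leaf_endo_smooth.2 _ sW.
  rewrite (cov_metric smooth_i metric_g LC); try exact: smooth_along_differential.
  rewrite leaf_cov_phi // di_leaf_endo (riemannian_sym metric_g (di (V q))) (metric_phil acm).
  by [].
have tor (U V : vfield N) (w : tangent (i q)) : smooth_vfield U -> smooth_vfield V ->
    g (i q) (di (bracket U V q)) w =
    g (i q) (cov (U q) (fun q' => di (V q'))) w - g (i q) (cov (V q) (fun q' => di (U q'))) w.
  by move=> sU sV; rewrite -(cov_torsion smooth_i LC) // (metricBl metric_g).
rewrite /d2 !Dm // /fundamental_form /pullback_metric !di_leaf_endo !tor //.
by apply/eqP; rewrite mulf_eq0 invr_eq0 pnatr_eq0 /=; apply/eqP; ring.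
Qed.

Lemma leaf_kaehler : (forall p v, D p v -> eta p v = 0) -> kaehler J g'.
Proof.
move=> D_eta; split.
- by split; [exact: leaf_endo_smooth|exact: leaf_metric].
- move=> q v; apply: (@di_inj q); rewrite !di_leaf_endo (phi2 acm) (D_eta _ _ (diD v)) scale0r addr0.
  by rewrite diN.
- move=> q u v; rewrite /pullback_metric !di_leaf_endo (metric_phi acm) (D_eta _ _ (diD v)).
  by rewrite mulr0 subr0.
- by move=> X Y q; exact: leaf_nijenhuis.
exact: leaf_closed_2form.
Qed.

(** The terms with [cov] cancel by [cov_torsion], leaving [d eta] on two vectors tangent to the
    leaf. *)
Lemma leaf_closed_1form : closed_1form (pullback_form i eta).
Proof.
move=> X Y q sX sY; rewrite /d1 /pullback_form.
have Dm (U V : vfield N) : smooth_vfield U -> smooth_vfield V ->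
    U q (fun q' => eta (i q') (di (V q'))) =
    eta (i q) (cov (U q) (fun q' => di (V q'))) + Bxi xi g nabla (di (U q)) (di (V q)).
  move=> sU sV; have -> : (fun q' => eta (i q') (di (V q'))) = (fun q' => g (i q') (di (V q')) (xi (i q'))).
    by apply/funext => q'; rewrite (metric_xi acm).
  rewrite (cov_field smooth_i metric_g LC); try exact: smooth_along_differential; last exact: xi_smooth acm.
  by rewrite (metric_xi acm) (riemannian_sym metric_g (di (V q))).
rewrite !Dm // -(cov_torsion smooth_i LC) // (etaB acm (cov (X q) _) (cov (Y q) _)).
have := D_null (diD (X q)) (di (Y q)); rewrite /deta => e.
by rewrite -[RHS]e; congr (_ * _); ring.
Qed.

Lemma leaf_cosymplectic : (forall p, D p (xi p)) ->
  exists xi' : vfield N, (forall q, di (xi' q) = xi (i q)) /\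
    cosymplectic J xi' (pullback_form i eta) g'.
Proof.
move=> D_xi.
have xi_ex q : {u : tangent q | di u = xi (i q)}.
  by apply: cid; have [_ _ _ H] := integral; apply/H.
pose xi' : vfield N := fun q => sval (xi_ex q).
have dxi q : di (xi' q) = xi (i q) by exact: svalP (xi_ex q).
have sxi : smooth_vfield xi'.
  apply: (smooth_vfield_of_metric leaf_metric) => W sW.
  apply: (@smooth_eq _ _ N (fun q => g (i q) (xi (i q)) (di (W q)))).
    apply: (metric_along smooth_i metric_g); last exact: smooth_along_differential.
    exact: smooth_along_field (xi_smooth acm).
  by move=> q; rewrite /pullback_metric dxi.
exists xi'; split=> //; split.
- split; first split=> //; [exact: leaf_endo_smooth| |exact: leaf_metric| | |].
  + split=> [q a u v|X sX]; first by rewrite /pullback_form di_lin (eta_lin acm).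
    apply: (@smooth_eq _ _ N (fun q => g (i q) (di (X q)) (xi (i q)))).
      apply: (metric_along_field smooth_i metric_g); last exact: xi_smooth acm.
      exact: smooth_along_differential.
    by move=> q; rewrite (metric_xi acm).
  + move=> q v; apply: (@di_inj q); rewrite !di_leaf_endo (phi2 acm) diDr diN diZ dxi.
    by [].
  + by move=> q; rewrite /pullback_form dxi (eta_xi acm).
  + by move=> q u v; rewrite /pullback_metric !di_leaf_endo (metric_phi acm).
- move=> X Y q sX sY; rewrite /N1 leaf_nijenhuis // leaf_closed_1form //.
  by rewrite mulr0 scale0r addr0.
by split; [exact: leaf_closed_1form|exact: leaf_closed_2form].
Qed.

End AdaptedLeaf.

Theorem proposition3 (R : realType) (n : nat) (n_gt0 : (0 < n)%N)
    (M : manifold R (n.*2.+1)) (phi : endo_field M) (xi : vfield M)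
    (eta : covector_field M) (g : bilinear_field M)
    (nabla : vfield M -> vfield M -> vfield M)
    (aqS : anti_quasi_sasakian phi xi eta g)
    (LC : levi_civita g nabla)
    (rankH1 : constant_rank (parallel_distribution nabla phi)) :
  (involutive_distribution (parallel_distribution nabla phi) /\
   (* for a cosymplectic M the distribution is the whole tangent bundle, which
      has odd rank and contains xi *)
   (~ cosymplectic phi xi eta g ->
    forall (k : nat) (N : manifold R k) (i : N -> M),
      leaf (parallel_distribution nabla phi) i ->
      exists J : endo_field N,
        (forall (q : N) (v : tangent q),
           differential i (J q v) = phi (i q) (differential i v)) /\
        kaehler J (pullback_metric i g)))
  /\
  (involutive_distribution (line_plus xi (parallel_distribution nabla phi)) /\
   forall (k : nat) (N : manifold R k) (i : N -> M),
     leaf (line_plus xi (parallel_distribution nabla phi)) i ->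
     exists (phi' : endo_field N) (xi' : vfield N),
       [/\ forall (q : N) (v : tangent q),
             differential i (phi' q v) = phi (i q) (differential i v),
           forall q : N, differential i (xi' q) = xi (i q)
         & cosymplectic phi' xi' (pullback_form i eta) (pullback_metric i g)]).
Proof.
have [acm N1E dPhi] := aqS.
split; split.
- exact: (parallel_involutive acm LC N1E dPhi).
- move=> ncos k N i [int _].
  have D_null p v : parallel_distribution nabla phi v -> @deta_null _ _ _ xi g nabla p v.
    by move=> /(parallel_distribution_null acm LC N1E dPhi)[].
  have D_phi := parallel_phi acm LC N1E dPhi.
  exists (leaf_endo int D_phi); split; first by move=> q v; exact: di_leaf_endo.
  apply: (leaf_kaehler aqS LC) => // p v.
  exact: (parallel_eta0 acm LC N1E dPhi rankH1 ncos).
- exact: (line_plus_involutive acm LC N1E dPhi).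
move=> k N i [int _].
have D_null := line_plus_null acm LC N1E dPhi.
have D_phi := line_plus_phi acm LC N1E dPhi.
have D_xi := line_plus_xi acm LC N1E dPhi.
have [xi' [dxi cos]] := leaf_cosymplectic aqS LC int D_null D_phi D_xi.
exists (leaf_endo int D_phi), xi'; split=> // q v; exact: di_leaf_endo.
Qed.
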